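(* Let $\mathbb T=\mathbb R/\mathbb Z$ and $b\in W^{1,\infty}(\mathbb T)$ (real-valued). Let $\eta\in L^1(\mathbb R)$ be an odd function with $\int_{\mathbb R}\eta(z)\,dz=0$, $\int_{\mathbb R}z\,\eta(z)\,dz=-1$ and $C_\eta:=\frac12\int_{\mathbb R}|z|^2|\eta(z)|\,dz<\infty$. Let $\mathbf A u=-b\,\partial_xu$ on $L^2(\mathbb T)$ with domain $\mathcal D(\mathbf A)=H^1(\mathbb T)$, and for $\varepsilon>0$ let $\mathbf A_\varepsilon u=-b\,D_\varepsilon u$, where $$(D_\varepsilon u)(x)=\int_{\mathbb T}\eta_\varepsilon(x-y)\,u(y)\,dy$$ and $\eta_\varepsilon$ is the periodization on $\mathbb T$ of $z\mapsto\varepsilon^{-2}\eta(z/\varepsilon)$. Then, with $X=H^2(\mathbb T)$, there exist a dense subspace $\mathcal D_0\subset X$ which is a core for $\mathbf A$ and a function $r(\varepsilon)=\mathcal O(\varepsilon)$ as $\varepsilon\to0$ such that: (1) for every $\varepsilon>0$, $\mathbf A_\varepsilon$ generates a $C_0$-semigroup $(S_\varepsilon(t))_{t\ge0}$ on $L^2(\mathbb T)$ with $\|S_\varepsilon(t)\|_{\mathcal L(L^2(\mathbb T))}\le Me^{\omega t}$ for all $t\ge0$, where $M=1$ and $\omega=\frac12\|b'\|_{L^\infty}\int_{\mathbb R}|z|\,|\eta(z)|\,dz$; (2) $\|\mathbf A_\varepsilon\varphi-\mathbf A\varphi\|_{L^2(\mathbb T)}\le r(\varepsilon)\,\|\varphi\|_{H^2(\mathbb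 T)}$ for all $\varphi\in\mathcal D_0$.
   Context: The periodization of an integrable function $h$ on $\mathbb R$ is the function $\sum_{n\in\mathbb Z}h(\cdot+n)$ on $\mathbb T$. A core for $\mathbf A$ is a subspace of $\mathcal D(\mathbf A)$ dense in $\mathcal D(\mathbf A)$ for the graph norm $\|\varphi\|_{L^2}+\|\mathbf A\varphi\|_{L^2}$. Functions are real-valued. *)

(* Defs.v *)
From HB Require Import structures.
From mathcomp Require Import all_boot all_order all_algebra.
From mathcomp Require Import all_classical all_reals all_analysis.

Set Implicit Arguments.
Unset Strict Implicit.
Unset Printing Implicit Defensive.

Import Order.TTheory GRing.Theory Num.Theory.
Import numFieldNormedType.Exports.

Local Open Scope classical_set_scope.
Local Open Scope ring_scope.

(* The circle T = R/Z.  A function on T is a 1-periodic function R -> R, and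
   integration over T is integration over the fundamental domain [0, 1[.
   Elements of L^p(T) are handled through Borel representatives, equality in
   L^p(T) being equality muT-almost everywhere. *)
Section circle.
Context {R : realType}.
Implicit Types (p : \bar R) (u g : R -> R).

Definition muT : {measure set (measurableTypeR R) -> \bar R} :=
  mrestr (@lebesgue_measure R) (measurable_itv `[0, 1[).

Definition LpT p : set (R -> R) :=
  [set u | periodic u 1 /\ u \in Lfun muT p].

Definition L2T : set (R -> R) := LpT 2%:E.

Definition LpTnorm p u : \bar R := 'N[muT]_p[EFin \o u]%E.

Definition L2norm u : \bar R := LpTnorm 2%:E u.

Definition smoothT : set (R -> R) :=
  [set f | periodic f 1 /\ forall n x, derivable (f^`(n))%classic x 1].

Definition weak_derivative u g : Prop :=
  [/\ LpT 1%E u, LpT 1%E g &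
      forall f, smoothT f ->
        \int[muT]_x (u x * (f^`())%classic x) = - \int[muT]_x (g x * f x)].

(* A representative of the weak derivative, which is unique up to equality
   almost everywhere; it is 0 when there is no weak derivative in L^1(T). *)
Definition wderiv u : R -> R := xget (cst 0) [set g | weak_derivative u g].

Definition W1T p : set (R -> R) :=
  [set u | LpT p u /\ exists2 g, LpT p g & weak_derivative u g].

Definition W1inftyT : set (R -> R) := W1T +oo%E.

Definition H1T : set (R -> R) := W1T 2%:E.

Definition H2T : set (R -> R) := [set u | H1T u /\ H1T (wderiv u)].

Definition H2norm u : \bar R :=
  ((L2norm u ^+ 2 + L2norm (wderiv u) ^+ 2
    + L2norm (wderiv (wderiv u)) ^+ 2) `^ 2^-1)%E.

End circle.

(* Operators on L^2(T), acting on representatives. *)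
Section operators.
Context {R : realType}.
Implicit Types (u v : R -> R) (T : (R -> R) -> R -> R) (D : set (R -> R)).

Definition opnorm T : \bar R :=
  ereal_sup [set L2norm (T u) | u in [set u | L2T u /\ (L2norm u <= 1)%E]].

(* Linearity and boundedness imply that T preserves equality almost
   everywhere, so that T induces a bounded operator on classes. *)
Definition bounded_operator T : Prop :=
  [/\ forall u, L2T u -> L2T (T u),
      forall (a : R) u v, L2T u -> L2T v ->
        T (a *: u + v) = a *: T u + T v %[ae muT] &
      (opnorm T < +oo)%E].

(* Possibly unbounded operators: only the values of [act] on [dom] matter. *)
Record operator := Operator {
  dom : set (R -> R) ;
  act :> (R -> R) -> R -> R }.

Implicit Type A : operator.

Definition C0_semigroup (S : R -> (R -> R) -> R -> R) : Prop :=
  [/\ forall t, 0 <= t -> bounded_operator (S t),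
      forall u, L2T u -> S 0 u = u %[ae muT],
      forall s t u, 0 <= s -> 0 <= t -> L2T u ->
        S (s + t) u = S s (S t u) %[ae muT] &
      forall u, L2T u -> L2norm (S t u - u) @[t --> 0^'+] --> 0%E].

(* The graph of the infinitesimal generator of S. *)
Definition generator_graph (S : R -> (R -> R) -> R -> R) u v : Prop :=
  [/\ L2T u, L2T v &
      L2norm (h^-1 *: (S h u - u) - v) @[h --> 0^'+] --> 0%E].

Definition generates A (S : R -> (R -> R) -> R -> R) : Prop :=
  C0_semigroup S /\
  forall u v, generator_graph S u v <->
    [/\ dom A u, L2T v & v = A u %[ae muT]].

Definition linear_subspace D : Prop :=
  D 0 /\ forall (a : R) u v, D u -> D v -> D (a *: u + v).

Definition dense_for (N : (R -> R) -> \bar R) D (E : set (R -> R)) : Prop :=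
  D `<=` E /\
  forall u, E u -> forall e : R, 0 < e ->
    exists2 f, D f & (N (u - f)%R < e%:E)%E.

Definition graph_norm A u : \bar R := (L2norm u + L2norm (A u))%E.

Definition core A D : Prop :=
  linear_subspace D /\ dense_for (graph_norm A) D (dom A).

End operators.

Section transport.
Context {R : realType}.
Implicit Types (b eta u h : R -> R) (eps : R).

(* The sum over Z of the positive parts minus that of the negative parts, i.e.
   the sum of the family wherever it is absolutely summable (almost everywhere
   for integrable h) and, through [fine], 0 elsewhere. *)
Definition periodization h : R -> R := fun x =>
  fine (\esum_(n in [set: int]) (EFin \o h)^\+%E (x + n%:~R)%R
        - \esum_(n in [set: int]) (EFin \o h)^\-%E (x + n%:~R)%R)%E.

Definition eta_eps eta eps : R -> R :=
  periodization (fun z => eps ^- 2 * eta (z / eps)).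

Definition D_eps eta eps u : R -> R := fun x =>
  \int[muT]_y (eta_eps eta eps (x - y) * u y).

Definition A_op b : operator :=
  Operator H1T (fun u x => - b x * wderiv u x).

Definition A_eps b eta eps : operator :=
  Operator L2T (fun u x => - b x * D_eps eta eps u x).

End transport.

(* Main.v *)
(* The operator A_eps is bounded on L^2(T) by Young's inequality, so it
   generates the semigroup S(t) given by the exponential series.  Since eta is
   odd, <u, b D_eps u> is half the integral of
   eps^-2 eta(z/eps) (b(x) - b(x - z)) u(x) u(x - z), which is at most
   omega |u|^2 because b is Lipschitz; hence
   |u + h A_eps u|^2 <= (1 + 2 omega h + K^2 h^2) |u|^2, and S(t) = S(t/n)^n
   yields |S(t)| <= e^(omega t).

   One takes D_0 = H^2(T).  By the moment conditions on eta, D_eps phi - phi'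
   at x is the integral of eps^-2 eta(z/eps) against the Taylor remainder
   phi(x - z) - phi(x) + z phi'(x), which is at most |z| times the integral of
   |phi''| over [x - |z|, x + |z|]; Young's inequality then gives O(eps).

   For the core property, the derivative of a function of H^1(T) is truncated,
   replaced by a Steklov mean (Lebesgue differentiation and dominated
   convergence), made mean free, and integrated. *)
Require Import Defs.
From HB Require Import structures.
From mathcomp Require Import all_boot all_order all_algebra.
From mathcomp Require Import all_classical all_reals all_analysis.
From mathcomp Require Import measurable_realfun ess_sup_inf.
From mathcomp Require Import ring lra.

Set Implicit Arguments.
Unset Strict Implicit.
Unset Printing Implicit Defensive.

Import Order.TTheory GRing.Theory Num.Theory.
Import numFieldNormedType.Exports.

Local Open Scope classical_set_scope.
Local Open Scope ring_scope.

(** * Lebesgue integration on the circle *)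

(** Operators act on Borel representatives, so linearity, the semigroup law and the generator
    identity are almost-everywhere statements; they are read off from [l2 (u - v) = 0], and the
    exponential series has to be summed pointwise. Two scalings govern the constants. The bound K
    used for [A_eps] is a multiple of 1/eps, yet it enters the one-step estimate only at order h^2,
    so the error of n steps of length t/n is O(1/n) and K leaves the exponent; this is what makes M
    = 1 possible. The first absolute moment of eps^-2 eta(z/eps) does not depend on eps, which makes
    omega uniform, and the second is eps times that of eta, which is the rate. On the Sobolev side,
    [wderiv] is merely a chosen representative; the workable description is that u has weak
    derivative g exactly when g has mean zero and u is almost everywhere a constant plus the
    primitive of g. One direction rests on the fundamental lemma of the calculus of variations, for
    which enough smooth periodic functions must be exhibited. The Lipschitz form of b, Taylor's
    formula and the core all use this description. *)

Section finite_muT.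
Context {R : realType}.

(** The same measure as [muT], restated as a bare function so that a finite-measure structure can be
    attached to it; Fubini and Tonelli on products involving the circle go through [circ]. *)
Definition circ : set (measurableTypeR R) -> \bar R :=
  mrestr (@lebesgue_measure R) (measurable_itv `[0, 1[).

HB.instance Definition _ := Measure.on circ.

Lemma muT_setT : @muT R setT = 1%E.
Proof.
by rewrite /muT/= /mrestr setTI lebesgue_measure_itv/= lte_fin ltr01 oppr0 adde0.
Qed.

Let circ_fin : fin_num_fun circ.
Proof.
move=> A mA; rewrite ge0_fin_numE//.
rewrite (@le_lt_trans _ _ (@muT R setT))//; last by rewrite muT_setT ltry.
by apply: (@le_measure _ _ _ (@muT R)) => //; rewrite inE.
Qed.

HB.instance Definition _ := Measure_isFinite.Build _ _ _ circ circ_fin.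

Lemma tonelliT (f : R -> R -> \bar R) :
  measurable_fun [set: measurableTypeR R * measurableTypeR R] (fun p => f p.1 p.2) ->
  (forall x y, (0 <= f x y)%E) ->
  (\int[muT]_x \int[lebesgue_measure]_y f x y =
   \int[lebesgue_measure]_y \int[muT]_x f x y)%E.
Proof.
move=> mf f0.
exact: (@fubini_tonelli _ _ _ _ _ circ lebesgue_measure (fun p => f p.1 p.2)).
Qed.
End finite_muT.

Section affine.
Context {R : realType}.
Local Notation mu := (@lebesgue_measure R).
Local Open Scope ereal_scope.

Lemma measurable_affine (k a : R) : measurable_fun [set: R] (fun x => k * x + a)%R.
Proof. by apply: measurable_funD => //; apply: measurable_funM. Qed.

(** Multiplied by k, the pushforward of Lebesgue measure under the affine map gives each interval
    ]c, d] its length, so uniqueness of Lebesgue measure identifies the two. *)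
Lemma lebesgue_measure_affine (k a : R) (A : set R) : (0 < k)%R -> measurable A ->
  mu ((fun x => k * x + a)%R @^-1` A) = (k^-1)%:E * mu A.
Proof.
move=> k0 mA.
pose phi : measurableTypeR R -> measurableTypeR R := (fun x => k * x + a)%R.
have kn : (0 <= k)%R by exact: ltW.
have mphi : measurable_fun [set: measurableTypeR R] phi.
  exact: measurable_affine.
pose nu : {measure set (measurableTypeR R) -> \bar R} := mscale (NngNum kn)
  (measure_function_pushforward__canonical__measure_function_Measure mu mphi).
suff -> : mu A = k%:E * mu (phi @^-1` A).
  by rewrite muleA -EFinM mulVf ?gt_eqF// mul1e.
rewrite -[RHS]/(nu A).
apply: lebesgue_measure_unique => //= _ [[c d]] _ <-.
rewrite /mscale/= /pushforward.
have -> : phi @^-1` `]c, d]%classic = `]((c - a) / k)%R, ((d - a) / k)%R]%classic.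
  apply/seteqP; split => x; rewrite /phi /= !in_itv/= ltr_pdivrMr// ler_pdivlMr//;
  by rewrite ltrBlDr lerBrDr mulrC.
rewrite !lebesgue_measure_itv/= !lte_fin ltr_pM2r ?invr_gt0// ltrD2r.
case: ifPn => _; last by rewrite mule0.
rewrite -EFinM; congr EFin. field. by rewrite gt_eqF.
Qed.

Lemma ge0_integral_affine (k a : R) (f : R -> \bar R) : (0 < k)%R ->
  measurable_fun [set: R] f -> (forall x, 0 <= f x) ->
  \int[mu]_x f (k * x + a)%R = (k^-1)%:E * \int[mu]_x f x.
Proof.
move=> k0 mf f0.
pose phi : measurableTypeR R -> measurableTypeR R := (fun x => k * x + a)%R.
have mphi : measurable_fun [set: measurableTypeR R] phi.
  exact: measurable_affine.
have kn : (0 <= k^-1)%R by rewrite invr_ge0 ltW.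
transitivity (\int[pushforward mu phi]_x f x).
  by rewrite ge0_integral_pushforward.
rewrite (@eq_measure_integral _ _ _ _ (mscale (NngNum kn) mu)); last first.
  by move=> A mA _; exact: lebesgue_measure_affine.
by rewrite ge0_integral_mscale.
Qed.

Lemma integral_shift (a : R) (f : R -> \bar R) :
  measurable_fun [set: R] f ->
  \int[mu]_x f (x + a)%R = \int[mu]_x f x.
Proof.
move=> mf.
have H (g : R -> \bar R) : measurable_fun [set: R] g -> (forall x, 0 <= g x) ->
    \int[mu]_x g (x + a)%R = \int[mu]_x g x.
  move=> mg g0; have := ge0_integral_affine a ltr01 mg g0.
  by rewrite invr1 mul1e => <-; apply: eq_integral => x _; rewrite mul1r.
rewrite [LHS]integralE [RHS]integralE; congr (_ - _).
  rewrite -[RHS](H _ (measurable_funepos mf)) ?funepos_ge0//.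
  by apply: eq_integral => x _; rewrite !funeposE.
rewrite -[RHS](H _ (measurable_funeneg mf)) ?funeneg_ge0//.
by apply: eq_integral => x _; rewrite !funenegE.
Qed.

Lemma integral_reflect0 (f : R -> \bar R) :
  measurable_fun [set: R] f ->
  \int[mu]_x f (- x)%R = \int[mu]_x f x.
Proof.
move=> mf.
have H (g : R -> \bar R) : measurable_fun [set: R] g -> (forall x, 0 <= g x) ->
    \int[mu]_x g (- x)%R = \int[mu]_x g x.
  move=> mg g0.
  transitivity (\int[pushforward mu (-%R : measurableTypeR R -> measurableTypeR R)]_x g x).
    by rewrite ge0_integral_pushforward.
  by apply: eq_measure_integral => A mA _; exact: lebesgue_measureN.
rewrite [LHS]integralE [RHS]integralE; congr (_ - _).
  rewrite -[RHS](H _ (measurable_funepos mf)) ?funepos_ge0//.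
  by apply: eq_integral => x _; rewrite !funeposE.
rewrite -[RHS](H _ (measurable_funeneg mf)) ?funeneg_ge0//.
by apply: eq_integral => x _; rewrite !funenegE.
Qed.

Lemma ae_affine (k a : R) (P : R -> Prop) : (0 < k)%R ->
  {ae mu, forall x, P x} -> {ae mu, forall x, P (k * x + a)%R}.
Proof.
move=> k0 [N [mN N0 subN]].
exists ((fun x => k * x + a)%R @^-1` N); split.
- rewrite -[X in measurable X]setTI; exact: measurable_affine.
- by have := lebesgue_measure_affine a k0 mN; rewrite N0 mule0.
- by move=> x /= Px; apply: subN.
Qed.

Lemma ae_shift (a : R) (P : R -> Prop) :
  {ae mu, forall x, P x} -> {ae mu, forall x, P (x + a)%R}.
Proof.
move=> /(ae_affine a ltr01); apply: (@filterS _ _ (ae_filter_ringOfSetsType _)).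
by move=> x /=; rewrite mul1r.
Qed.

Lemma ae_opp (P : R -> Prop) :
  {ae mu, forall x, P x} -> {ae mu, forall x, P (- x)%R}.
Proof.
move=> [N [mN N0 subN]].
exists ((-%R : measurableTypeR R -> measurableTypeR R) @^-1` N); split.
- by rewrite -[X in measurable X]setTI; exact: (@oppr_measurable R setT).
- by have := lebesgue_measureN mN; rewrite N0.
- by move=> x /= Px; apply: subN.
Qed.

End affine.

(** * Unfolding integrals over the line into integrals over the circle *)

Section unfolding.
Context {R : realType}.
Local Notation mu := (@lebesgue_measure R).
Local Open Scope ereal_scope.

Lemma integral_muT (f : R -> \bar R) : measurable_fun [set: R] f ->
  \int[muT]_x f x = \int[mu]_(x in `[0%R, 1%R[%classic) f x.
Proof.
move=> mf; have mI : measurable (`[0%R, 1%R[%classic : set (measurableTypeR R)).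
  exact: measurable_itv.
transitivity (\int[muT]_(x in `[0%R, 1%R[%classic) f x); last first.
  apply: eq_measure_integral => A mA AI.
  by rewrite /muT/= /mrestr setIidl.
rewrite -[X in integral _ X _](setUv `[0%R, 1%R[%classic) integral_setU//.
- rewrite [X in _ + X](_ : _ = 0) ?adde0//.
  rewrite (ae_eq_integral (cst 0))//; first by rewrite integral0.
  + exact: measurableC.
  + exact: measurable_funTS.
  + apply: ae_eq0; first exact: measurableC.
    by rewrite /muT/= /mrestr setICl measure0.
- exact: measurableC.
- by rewrite setUv.
- exact/disj_setPCl.
Qed.

Lemma ae_muT (P : R -> Prop) :
  {ae muT, forall x, P x} <-> {ae mu, forall x, (0 <= x < 1)%R -> P x}.
Proof.
have mI : measurable (`[0%R, 1%R[%classic : set (measurableTypeR R)).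
  exact: measurable_itv.
split=> -[N [mN N0 subN]].
- exists (N `&` `[0%R, 1%R[%classic); split => //; first exact: measurableI.
  move=> x /= /not_implyP[x01 Px]; split; first exact: subN.
  by rewrite in_itv.
- exists (N `|` ~` `[0%R, 1%R[%classic); split => //.
  + by apply: measurableU => //; exact: measurableC.
  + rewrite /muT/= /mrestr setIUl setICl setU0; apply/eqP.
    by rewrite -measure_le0 -N0 le_measure// ?inE//; exact: measurableI.
  + move=> x /= Px; have [x01|x01] := pselect (`[0%R, 1%R[%classic x); last by right.
    by left; apply: subN => /= H; apply: Px; apply: H; rewrite /= in_itv in x01.
Qed.

(** Turns sums over the integers into series over [nat], where measurability and exchange with the
    integral are available. [Negz k] is -(k + 1), so 0 is reached only by the even branch. *)
Definition enum_int (n : nat) : int := if odd n then Negz n./2 else Posz n./2.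

Lemma enum_int_bij : set_bij [set: nat] [set: int] enum_int.
Proof.
split=> //.
- move=> m n _ _; rewrite /enum_int.
  by case: ifP => om; case: ifP => on // -[h];
    rewrite -(odd_double_half m) -(odd_double_half n) om on h.
- move=> [m|m] _.
  + by exists m.*2 => //; rewrite /enum_int odd_double doubleK.
  + by exists m.*2.+1 => //; rewrite /enum_int/= odd_double/= uphalf_double.
Qed.

Lemma unit_itv_cover (x : R) : exists n : int, (n%:~R <= x < n%:~R + 1)%R.
Proof.
exists (Num.floor x).
by rewrite floor_le_tmp/= -[1%R]/(1%:~R) -intrD; exact: floorD1_gt.
Qed.

Lemma esum_int_measurable (h : int -> R -> \bar R) :
  (forall n, measurable_fun [set: R] (h n)) -> (forall n x, 0 <= h n x) ->
  measurable_fun [set: R] (fun x => \esum_(n in [set: int]) h n x).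
Proof.
move=> mh h0.
rewrite (_ : (fun _ => _) = (fun x => \sum_(0 <= k <oo) h (enum_int k) x)); last first.
  apply/funext => x.
  by rewrite (reindex_esum _ _ _ _ enum_int_bij) nneseries_esumT.
by apply: ge0_emeasurable_sum.
Qed.

(** The line is cut into the intervals [n, n + 1[, each translated back to [0, 1[; nonnegativity
    allows the exchange of sum and integral. Through this identity the hypotheses on eta, stated on
    the line, reach the periodized kernel. *)
Lemma integral_unfold (h : R -> \bar R) :
  measurable_fun [set: R] h -> (forall x, 0 <= h x) ->
  \int[mu]_x h x = \int[muT]_x \esum_(n in [set: int]) h (x + n%:~R)%R.
Proof.
move=> mh h0.
have mhn (m : R) : measurable_fun [set: R] (fun x => h (x + m)%R).
  by apply: measurableT_comp => //; exact: measurable_funD.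
under [RHS]eq_integral.
  move=> x _; rewrite (reindex_esum _ _ _ _ enum_int_bij) -nneseries_esumT//.
  over.
rewrite integral_nneseries//.
pose F k : set (measurableTypeR R) :=
  `[(enum_int k)%:~R, ((enum_int k)%:~R + 1)%R[%classic.
have mF k : measurable (F k) by exact: measurable_itv.
have FT : [set: R] = \bigcup_k F k.
  apply/seteqP; split=> // x _; have [n xn] := unit_itv_cover x.
  have [_ _ /(_ n)[]// k _ kn] := enum_int_bij.
  by exists k => //; rewrite /F/= kn in_itv.
rewrite [in LHS]FT ge0_integral_bigcup; [|exact: mF| |by move=> x _; exact: h0|].
- apply: eq_eseriesr => k _; rewrite integral_muT//.
  rewrite integral_mkcond [RHS]integral_mkcond.
  rewrite -(integral_shift (enum_int k)%:~R); last first.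
    by have [+ _] := measurable_restrictT h (mF k); apply; exact: measurable_funTS.
  apply: eq_integral => x _; rewrite /patch !mem_setE !in_itv/=.
  by rewrite lerDr [(x + _)%R]addrC ltrD2l.
- exact: measurable_funTS.
- move=> i j _ _ [x [/=]]; rewrite /F /= !in_itv/= => /andP[a1 a2] /andP[b1 b2].
  have H (m n : int) : (m%:~R <= x)%R -> (x < n%:~R + 1)%R -> (m <= n)%R.
    move=> h1 h2; have := le_lt_trans h1 h2.
    by rewrite -[1%R]/(1%:~R) -intrD ltr_int ltzD1.
  have e : enum_int i = enum_int j by apply/le_anti; rewrite !H.
  have [_ inj _] := enum_int_bij; exact: (inj i j (in_setT i) (in_setT j) e).
- by move=> k; exact: mhn.
Qed.

End unfolding.

Section periodic.
Context {R : realType}.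
Local Notation mu := (@lebesgue_measure R).

Lemma periodic_int (U : Type) (u : R -> U) (n : int) x :
  (forall y, u (y + 1) = u y) -> u (x + n%:~R) = u x.
Proof.
move=> pu; case: n => n; last rewrite NegzE.
  elim: n => [|n IH]; first by rewrite addr0.
  by rewrite -addn1 PoszD intrD addrA pu.
elim: n => [|n IH]; first by rewrite -[in RHS](subrK 1 x) pu.
by rewrite -[in LHS]pu -IH; congr u; rewrite !intrN -[in LHS]addn1 PoszD intrD; lra.
Qed.

Local Open Scope ereal_scope.

(** Exactly one integer translate of [x] falls into [0, 1[, so a single term of the sum survives. *)
Lemma esum_int_indic (x : R) (c : \bar R) : 0 <= c ->
  \esum_(n in [set: int])
    (if (0 <= x + n%:~R < 1)%R then c else 0) = c.
Proof.
move=> c0; have [m /andP[m1 m2]] := unit_itv_cover (- x)%R.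
(* [n0] is the ceiling of -x, computed from its floor [m]. *)
pose n0 : int := (if m%:~R == - x then m else m + 1)%R.
transitivity (\esum_(n in [set n0]) c); last by rewrite esum_set1.
rewrite [RHS]esum_mkcond; apply: eq_esum => n _.
suff -> : (0 <= x + n%:~R < 1)%R = (n \in [set n0]) by [].
apply/idP/idP; rewrite inE/= /n0.
- move=> /andP[h1 h2]; case: ifPn => [/eqP e|ne].
  + apply/eqP; rewrite eq_le -ltzD1 -[X in _ && X]ltzD1 -!(ltr_int R) !intrD.
    by apply/andP; split; lra.
  + apply/eqP; rewrite eq_le -ltzD1 -[X in _ && X](ltzD1) -!(ltr_int R) !intrD.
    have {}ne : (m%:~R < - x)%R by rewrite lt_neqAle ne.
    by apply/andP; split; lra.
- move=> ->; case: ifPn => [/eqP e|ne]; first by rewrite e; lra.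
  have {}ne : (m%:~R < - x)%R by rewrite lt_neqAle ne.
  by rewrite intrD; apply/andP; split; lra.
Qed.

(** The integral over [0, 1[ is written on the whole line, where translation by [a] is free, and
    unfolded again: for each [x] only one translate meets the moved unit interval, and by
    periodicity it contributes [v x]. *)
Lemma ge0_integral_muT_shift (a : R) (v : R -> \bar R) :
  (forall y, v (y + 1)%R = v y) -> measurable_fun [set: R] v ->
  (forall x, 0 <= v x) ->
  \int[muT]_x v (x + a)%R = \int[muT]_x v x.
Proof.
move=> pv mv v0.
have mI : measurable (`[0%R, 1%R[%classic : set (measurableTypeR R)).
  exact: measurable_itv.
have mva : measurable_fun [set: R] (fun x => v (x + a)%R).
  by apply: measurableT_comp => //; exact: measurable_funD.
rewrite integral_muT// integral_mkcond.
have mf : measurable_fun [set: R]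
    ((fun x => v (x + a)%R) \_ (`[0%R, 1%R[%classic : set (measurableTypeR R))).
  have [+ _] := @measurable_restrictT _ _ _ _ _ (fun x : measurableTypeR R => v (x + a)%R) mI.
  by apply; exact: measurable_funTS.
rewrite -(integral_shift (- a)%R)// integral_unfold.
- apply: eq_integral => x _.
  rewrite -[RHS](esum_int_indic (x - a)%R (v0 x)); apply: eq_esum => n _.
  rewrite /patch mem_setE in_itv/=.
  have -> : (x + n%:~R - a = x - a + n%:~R)%R by rewrite addrAC.
  case: ifP => // _; rewrite -[RHS](periodic_int n x pv); congr v; lra.
- by apply: measurableT_comp => //; exact: measurable_funD.
- by move=> x; rewrite /patch; case: ifP.
Qed.

Lemma integral_muT_shift (a : R) (v : R -> \bar R) :
  (forall y, v (y + 1)%R = v y) -> measurable_fun [set: R] v ->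
  \int[muT]_x v (x + a)%R = \int[muT]_x v x.
Proof.
move=> pv mv; rewrite [LHS]integralE [RHS]integralE; congr (_ - _).
- rewrite -[RHS](ge0_integral_muT_shift a _ (measurable_funepos mv)) ?funepos_ge0//.
  + by apply: eq_integral => x _; rewrite !funeposE.
  + by move=> y; rewrite !funeposE pv.
- rewrite -[RHS](ge0_integral_muT_shift a _ (measurable_funeneg mv)) ?funeneg_ge0//.
  + by apply: eq_integral => x _; rewrite !funenegE.
  + by move=> y; rewrite !funenegE pv.
Qed.

End periodic.

(** * The space L^2(T) *)

Section L2_generic.
Context d (T : measurableType d) (R : realType) (m : {measure set T -> \bar R}).
Local Open Scope ereal_scope.

Lemma Lnorm2_sqr (f : T -> R) :
  'N[m]_2%:E[EFin \o f] ^+ 2 = \int[m]_x (f x ^+ 2)%:E.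
Proof.
have -> : 'N[m]_2%:E[EFin \o f] ^+ 2 = 'N[m]_2%:E[EFin \o f] `^ 2.
  have := Lnorm_ge0 m 2%:E (EFin \o f); case: ('N[m]_2%:E[EFin \o f]) => [r| |]//.
  - by rewrite lee_fin => r0; rewrite poweR_EFin powR_mulrn.
  - by rewrite poweRyr.
rewrite poweR_Lnorm//; apply: eq_integral => x _ /=.
by rewrite powR_mulrn// real_normK// num_real.
Qed.

(** Hölder for [Num.sqrt w] and [Num.sqrt w * g]. It is kept in the extended reals so that it can be
    applied pointwise in Young's inequality, before any of these integrals is known to be finite. *)
Lemma cauchy_schwarz (w g : T -> R) :
  measurable_fun [set: T] w -> measurable_fun [set: T] g ->
  (forall x, (0 <= w x)%R) -> (forall x, (0 <= g x)%R) ->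
  (\int[m]_x (w x * g x)%:E) ^+ 2 <=
  (\int[m]_x (w x)%:E) * \int[m]_x (w x * g x ^+ 2)%:E.
Proof.
move=> mw mg w0 g0.
pose s := (fun x => Num.sqrt (w x)).
have ms : measurable_fun [set: T] s.
  exact: (measurableT_comp (continuous_measurable_fun (@sqrt_continuous R))).
have := @hoelder _ _ _ m s (s \* g)%R 2 2 ms (measurable_funM ms mg) _ _ _.
have half : (2^-1 + 2^-1 = 1 :> R)%R by lra.
move=> /(_ (ltr0Sn _ 1) (ltr0Sn _ 1) half).
rewrite -lee_sqr ?Lnorm_ge0 ?mule_ge0 ?Lnorm_ge0//.
rewrite [X in _ <= X](_ : _ = 'N[m]_2%:E[EFin \o s] ^+ 2
    * 'N[m]_2%:E[EFin \o (s \* g)%R] ^+ 2); last by rewrite !expe2 muleACA.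
rewrite !Lnorm2_sqr Lnorm1.
have sE x : (s x ^+ 2 = w x)%R by rewrite sqr_sqrtr.
congr (_ ^+ 2 <= _ * _); apply: eq_integral => x _ /=; congr EFin.
- by rewrite mulrA -expr2 sE ger0_norm// mulr_ge0.
- by rewrite sE.
- by rewrite exprMn sE.
Qed.

End L2_generic.

(** * Young's inequality for a kernel on the line and a function on the circle *)

Section young.
Context {R : realType}.
Local Notation mu := (@lebesgue_measure R).
Local Open Scope ereal_scope.

Lemma measurable_conv_integrand (w v : R -> R) :
  measurable_fun [set: R] w -> measurable_fun [set: R] v ->
  measurable_fun [set: measurableTypeR R * measurableTypeR R]
    (fun p => w p.2 * v (p.1 - p.2))%R.
Proof.
move=> mw mv; apply: measurable_funM.
  exact: (measurableT_comp mw measurable_snd).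
apply: (measurableT_comp mv); apply: measurable_funB => //.
Qed.

Lemma measurable_integral_snd (F : R -> R -> \bar R) :
  measurable_fun [set: measurableTypeR R * measurableTypeR R]
    (fun p => F p.1 p.2) -> (forall x z, 0 <= F x z) ->
  measurable_fun [set: R] (fun x => \int[mu]_z F x z).
Proof.
move=> mF F0.
exact: (@measurable_fun_fubini_tonelli_F _ _ (measurableTypeR R)
  (measurableTypeR R) R mu (fun p => F p.1 p.2) mF (fun p => F0 p.1 p.2)).
Qed.

Lemma measurable_integral_muT (F : R -> R -> \bar R) :
  measurable_fun [set: measurableTypeR R * measurableTypeR R]
    (fun p => F p.1 p.2) -> (forall x z, 0 <= F x z) ->
  measurable_fun [set: R] (fun x => \int[muT]_z F x z).
Proof.
move=> mF F0.
exact: (@measurable_fun_fubini_tonelli_F _ _ (measurableTypeR R)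
  (measurableTypeR R) R circ (fun p => F p.1 p.2) mF (fun p => F0 p.1 p.2)).
Qed.

(* Cauchy-Schwarz for the measure [w z dz], then Tonelli and the translation
   invariance of the integral over the circle. *)
Lemma young_L2 (w v : R -> R) :
  measurable_fun [set: R] w -> (forall z, (0 <= w z)%R) ->
  (forall y, v (y + 1) = v y)%R -> measurable_fun [set: R] v ->
  \int[muT]_x ((\int[mu]_z (w z * `|v (x - z)|)%:E) ^+ 2) <=
  (\int[mu]_z (w z)%:E) ^+ 2 * \int[muT]_x (v x ^+ 2)%:E.
Proof.
move=> mw w0 pv mv.
have mav : measurable_fun [set: R] (fun x => `|v x|)%R.
  exact: measurableT_comp.
have msv : measurable_fun [set: R] (fun x => v x ^+ 2)%R by exact: measurable_funX.
have mshift (g : R -> R) x : measurable_fun [set: R] g ->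
    measurable_fun [set: R] (fun z => g (x - z)%R).
  by move=> mg; apply: (measurableT_comp mg); exact: measurable_funB.
have h0 : 0 <= \int[mu]_z (w z)%:E by apply: integral_ge0 => z _; rewrite lee_fin.
have mF2 := measurable_conv_integrand mw msv.
have mF1 := measurable_conv_integrand mw mav.
apply: (@le_trans _ _ (\int[muT]_x
   ((\int[mu]_z (w z)%:E) * \int[mu]_z (w z * v (x - z) ^+ 2)%:E))).
  apply: ge0_le_integral => //.
  - by move=> x _; rewrite expe2 mule_ge0// integral_ge0// => z _; rewrite lee_fin mulr_ge0.
  - by apply: emeasurable_funM; apply: measurable_integral_snd => //;
      [exact/measurable_EFinP|move=> x z; rewrite lee_fin mulr_ge0
      |exact/measurable_EFinP|move=> x z; rewrite lee_fin mulr_ge0].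
  - apply: measurable_funeM; apply: measurable_integral_snd => //.
      exact/measurable_EFinP.
    by move=> x z; rewrite lee_fin mulr_ge0// sqr_ge0.
  - move=> x _.
    have := cauchy_schwarz mu mw (mshift _ x mav) w0 (fun z => normr_ge0 (v (x - z)%R)).
    by under [X in _ <= _ * X -> _]eq_integral do rewrite real_normK ?num_real//.
have m2 : measurable_fun [set: R] (fun x => \int[mu]_z (w z * v (x - z) ^+ 2)%:E).
  apply: measurable_integral_snd; first exact/measurable_EFinP.
  by move=> x z; rewrite lee_fin mulr_ge0// sqr_ge0.
rewrite ge0_integralZl//; last first.
  by move=> x _; apply: integral_ge0 => z _; rewrite lee_fin mulr_ge0// sqr_ge0.
rewrite expe2 -muleA; apply: lee_wpmul2l => //.
have E z : \int[muT]_x (w z * v (x - z) ^+ 2)%:E = (w z)%:E * \int[muT]_x (v x ^+ 2)%:E.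
  under eq_integral do rewrite EFinM.
  rewrite ge0_integralZl//.
  - rewrite (@ge0_integral_muT_shift R (- z)%R (fun x => (v x ^+ 2)%:E))//.
    + by move=> y; rewrite pv.
    + exact/measurable_EFinP.
    + by move=> x; rewrite lee_fin sqr_ge0.
  - apply/measurable_EFinP; apply: (measurableT_comp msv).
    exact: measurable_funB.
  - by move=> x _; rewrite lee_fin sqr_ge0.
  - by rewrite lee_fin.
rewrite [X in X <= _](_ : _ = \int[mu]_z \int[muT]_x (w z * v (x - z) ^+ 2)%:E); last first.
  apply: (@tonelliT R (fun x z => (w z * v (x - z) ^+ 2)%:E)).
    exact/measurable_EFinP.
  by move=> x z; rewrite lee_fin mulr_ge0// sqr_ge0.
under eq_integral do rewrite E.
rewrite ge0_integralZr//; first exact/measurable_EFinP.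
  by move=> z _; rewrite lee_fin.
by apply: integral_ge0 => x _; rewrite lee_fin sqr_ge0.
Qed.

End young.

Section ae_helpers.
Context {R : realType} (m : {measure set (measurableTypeR R) -> \bar R}).

Lemma ae_imp (P Q : R -> Prop) : (forall x, P x -> Q x) ->
  {ae m, forall x, P x} -> {ae m, forall x, Q x}.
Proof. by apply: (@filterS _ _ (ae_filter_ringOfSetsType m)). Qed.

Lemma ae_imp2 (P Q S : R -> Prop) : (forall x, P x -> Q x -> S x) ->
  {ae m, forall x, P x} -> {ae m, forall x, Q x} -> {ae m, forall x, S x}.
Proof. by apply: (@filterS2 _ _ (ae_filter_ringOfSetsType m)). Qed.

End ae_helpers.

Section L2T_theory.
Context {R : realType}.
Implicit Types u v : R -> R.

Lemma L2T_periodic u : L2T u -> forall y, u (y + 1) = u y.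
Proof. by case. Qed.

Lemma LpT_measurable p u : LpT p u -> measurable_fun [set: R] u.
Proof. by move=> [_]; rewrite inE => /andP[/[!inE]]. Qed.

Lemma L2T_measurable u : L2T u -> measurable_fun [set: R] u.
Proof. exact: LpT_measurable. Qed.

Lemma measurable_sqr_EFin u : measurable_fun [set: R] u ->
  measurable_fun [set: R] (fun x => (u x ^+ 2)%:E).
Proof. by move=> mu; apply/measurable_EFinP; exact: measurable_funX. Qed.

Lemma LpT_intro p u : periodic u 1 -> measurable_fun [set: R] u ->
  (LpTnorm p u < +oo)%E -> LpT p u.
Proof.
move=> pu mu fu; split => //; rewrite inE; apply/andP; split; rewrite inE//.
Qed.

Lemma L2norm_ge0 u : (0 <= L2norm u)%E.
Proof. exact: Lnorm_ge0. Qed.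

Lemma L2norm_sqr u : (L2norm u ^+ 2 = \int[muT]_x (u x ^+ 2)%:E)%E.
Proof. exact: Lnorm2_sqr. Qed.

Lemma L2T_intro u : periodic u 1 -> measurable_fun [set: R] u ->
  (\int[muT]_x (u x ^+ 2)%:E < +oo)%E -> L2T u.
Proof.
move=> pu mu fu; apply: LpT_intro => //.
rewrite ltey; apply: contraTneq fu => e.
by rewrite -L2norm_sqr /L2norm e.
Qed.

(** A real number, so that ring and order reasoning apply; it carries the norm only for [u] in
    [L2T], since [fine] sends an infinite norm to 0. *)
Definition l2 u : R := fine (L2norm u).

Lemma l2_ge0 u : 0 <= l2 u.
Proof. by rewrite fine_ge0// L2norm_ge0. Qed.

Lemma L2norm_fin u : L2T u -> L2norm u = (l2 u)%:E.
Proof.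
move=> [_]; rewrite inE => /andP[_ /[!inE]] uoo.
by rewrite fineK// ge0_fin_numE ?L2norm_ge0.
Qed.

Lemma l2_sqr u : L2T u -> ((l2 u ^+ 2)%:E = \int[muT]_x (u x ^+ 2)%:E)%E.
Proof. by move=> Lu; rewrite -L2norm_sqr (L2norm_fin Lu). Qed.

Lemma L2T_lin (a : R) u v : L2T u -> L2T v -> L2T (a *: u + v).
Proof.
move=> [pu Lu] [pv Lv]; split.
  by move=> x; rewrite /= !fctE pu pv.
have L1 : (1 <= 2%:E :> \bar R)%E by rewrite lee_fin ler1n.
by apply: (@Lfun_submod_closed _ _ R muT 2%:E L1).2.
Qed.

Lemma L2T0 : L2T (0 : R -> R).
Proof.
apply: L2T_intro; [by []|exact: measurable_cst|]; under eq_integral => x _ do rewrite expr0n.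
by rewrite integral0.
Qed.

Lemma L2TD u v : L2T u -> L2T v -> L2T (u + v).
Proof. by move=> Lu Lv; have := L2T_lin 1 Lu Lv; rewrite scale1r. Qed.

Lemma L2TZ (a : R) u : L2T u -> L2T (a *: u).
Proof. by move=> Lu; have := L2T_lin a Lu L2T0; rewrite addr0. Qed.

Lemma L2TB u v : L2T u -> L2T v -> L2T (u - v).
Proof. by move=> Lu Lv; have := L2T_lin (-1) Lv Lu; rewrite scaleN1r addrC. Qed.

Lemma L2T_sum (I : Type) (r : seq I) (P : pred I) (F : I -> R -> R) :
  (forall i, P i -> L2T (F i)) -> L2T (\sum_(i <- r | P i) F i).
Proof.
move=> LF; elim/big_ind : _ => //; first exact: L2T0.
exact: L2TD.
Qed.

Lemma l2Z (a : R) u : L2T u -> l2 (a *: u) = `|a| * l2 u.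
Proof.
move=> Lu; apply/eqP; rewrite -(@eqrXn2 _ 2) ?mulr_ge0 ?l2_ge0//; apply/eqP.
apply: EFin_inj; rewrite exprMn real_normK ?num_real// [RHS]EFinM !l2_sqr//; last exact: L2TZ.
rewrite -ge0_integralZl//.
- by apply: eq_integral => x _; rewrite !fctE exprMn [LHS]EFinM.
- apply: measurable_sqr_EFin; exact: L2T_measurable.
- by move=> x _; rewrite lee_fin sqr_ge0.
- by rewrite lee_fin sqr_ge0.
Qed.

Lemma l2D u v : L2T u -> L2T v -> l2 (u + v) <= l2 u + l2 v.
Proof.
move=> Lu Lv; rewrite -lee_fin EFinD -!L2norm_fin//; last exact: L2TD.
apply: minkowski_EFin; [exact: L2T_measurable|exact: L2T_measurable|].
by rewrite ler1n.
Qed.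

Lemma l2N u : L2T u -> l2 (- u) = l2 u.
Proof. by move=> Lu; rewrite -scaleN1r l2Z// normrN1 mul1r. Qed.

Lemma l2_0 : l2 (0 : R -> R) = 0.
Proof. by rewrite -(scale0r (0 : R -> R)) l2Z ?normr0 ?mul0r//; exact: L2T0. Qed.

Lemma l2_sum (I : Type) (r : seq I) (P : pred I) (F : I -> R -> R) :
  (forall i, P i -> L2T (F i)) ->
  l2 (\sum_(i <- r | P i) F i) <= \sum_(i <- r | P i) l2 (F i).
Proof.
move=> LF.
suff [] : L2T (\sum_(i <- r | P i) F i) /\
  l2 (\sum_(i <- r | P i) F i) <= \sum_(i <- r | P i) l2 (F i) by [].
elim/big_rec2 : _ => [|i x y Pi [Lx xy]]; first by rewrite l2_0; split => //; exact: L2T0.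
split; first by apply: L2TD => //; exact: LF.
by apply: le_trans (l2D (LF _ Pi) Lx) _; rewrite lerD2l.
Qed.

Lemma l2_le u (c : R) : L2T u -> 0 <= c ->
  (\int[muT]_x (u x ^+ 2)%:E <= (c ^+ 2)%:E)%E -> l2 u <= c.
Proof. by move=> Lu c0; rewrite -l2_sqr// lee_fin ler_sqr// nnegrE l2_ge0. Qed.

Lemma l2_ae_eq u v : L2T u -> L2T v -> u = v %[ae muT] -> l2 u = l2 v.
Proof.
move=> Lu Lv uv; apply/eqP; rewrite -(@eqrXn2 _ 2) ?l2_ge0//; apply/eqP.
apply: EFin_inj; rewrite !l2_sqr//; apply: ae_eq_integral => //.
- apply: measurable_sqr_EFin; exact: L2T_measurable.
- apply: measurable_sqr_EFin; exact: L2T_measurable.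
- by apply: (ae_imp _ uv) => x /(_ I) + _ => /= ->.
Qed.

Lemma l2_eq0 u : L2T u -> l2 u = 0 -> u = 0 %[ae muT].
Proof.
move=> Lu u0.
have := @Lnorm_eq0_eq0 _ _ _ muT (EFin \o u) 2%:E.
move=> /(_ _ _ _)[].
- by apply/measurable_EFinP; exact: (L2T_measurable Lu).
- by rewrite lte_fin.
- by have := L2norm_fin Lu; rewrite u0.
- move=> N [mN N0 sN]; exists N; split => // x /= Hx; apply: sN => /= H; apply: Hx => _.
  by have [] := H I.
Qed.

(** The bridge between norm estimates and almost-everywhere identities: identities between limits of
    operators are obtained by letting a bound on [l2 (u - v)] tend to 0. *)
Lemma l2B_eq0 u v : L2T u -> L2T v -> u = v %[ae muT] <-> l2 (u - v) = 0.
Proof.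
move=> Lu Lv; split => [uv|/(l2_eq0 (L2TB Lu Lv))].
- rewrite -l2_0; apply: l2_ae_eq; [exact: L2TB|exact: L2T0|].
  by apply: (ae_imp _ uv) => x /(_ I) e _; rewrite !fctE e subrr.
- by apply: ae_imp => x /(_ I) + _; rewrite !fctE => /eqP; rewrite subr_eq0 => /eqP.
Qed.

End L2T_theory.

(** * Normally convergent series in L^2(T), summed pointwise *)

Section L2_series.
Context {R : realType}.
Implicit Types u : nat -> R -> R.

Lemma L2T_abs (f : R -> R) : L2T f -> L2T (fun x => `|f x|).
Proof.
move=> Lf; apply: L2T_intro.
- by move=> x /=; rewrite L2T_periodic.
- apply: (measurableT_comp (@normr_measurable R setT)); exact: L2T_measurable.
- under eq_integral => x _ do rewrite real_normK ?num_real//.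
  by rewrite -l2_sqr// ltry.
Qed.

Lemma l2_abs (f : R -> R) : L2T f -> l2 (fun x => `|f x|) = l2 f.
Proof.
move=> Lf; apply/eqP; rewrite -(@eqrXn2 _ 2) ?l2_ge0//; apply/eqP.
apply: EFin_inj; rewrite !l2_sqr//; last exact: L2T_abs.
by apply: eq_integral => x _; rewrite real_normK ?num_real.
Qed.

(** The estimate behind completeness of L^2: Minkowski bounds every partial sum of the absolute
    values, and monotone convergence carries the bound to the square of the full sum, which may be
    infinite at some points. *)
Lemma L2_abs_series u (c : R) : (forall k, L2T (u k)) -> 0 <= c ->
  (forall n, \sum_(k < n) l2 (u k) <= c) ->
  (\int[muT]_x ((\sum_(0 <= k <oo) `|u k x|%:E) ^+ 2) <= (c ^+ 2)%:E)%E.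
Proof.
move=> Lu c0 uc.
pose g n x := ((\sum_(0 <= k < n) `|u k x|%:E) ^+ 2)%E.
have gE n x : g n x = (((\sum_(k < n) (fun x => `|u k x|)) x) ^+ 2)%:E.
  by rewrite /g sumEFin big_mkord expe2 -EFinM -expr2 fct_sumE.
have Lsum n : L2T (\sum_(k < n) (fun x => `|u k x|)).
  by apply: L2T_sum => k _; exact: L2T_abs.
(* Squaring commutes with the limit of the partial sums; the product of the limits is well defined
   because an infinite limit is not zero. *)
rewrite (_ : (fun x => _) = (fun x => limn (g ^~ x))); last first.
{ apply/funext => x; rewrite expe2 -limeM.
  - by [].
  - by apply: is_cvg_nneseries => k _ _; rewrite lee_fin.
  - by apply: is_cvg_nneseries => k _ _; rewrite lee_fin.
  - set l := limn _; have [lf|lf] := boolP (l \is a fin_num).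
      exact: mule_def_fin.
    by apply: mule_def_infty_neq0 => //; apply: contraNneq lf => ->; rewrite fin_numE. }
have gle n x m : (n <= m)%N -> (g n x <= g m x)%E.
  move=> nm; have s0 p : (0 <= \sum_(0 <= k < p) `|u k x|%:E)%E.
    by apply: sume_ge0 => k _; rewrite lee_fin.
  rewrite lee_sqr//.
  by apply: lee_sum_nneg_natr => // k _ _; rewrite lee_fin.
have mg n : measurable_fun [set: R] (g n).
  rewrite (_ : g n = (fun x => (((\sum_(k < n) (fun x => `|u k x|)) x) ^+ 2)%:E)); last first.
    by apply/funext => x; rewrite gE.
  by apply: measurable_sqr_EFin; exact: L2T_measurable.
rewrite monotone_convergence//.
- apply: lime_le.
  + apply: ereal_nondecreasing_is_cvgn => n m nm.
    apply: ge0_le_integral => //; [|exact: mg|exact: mg|].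
    * by move=> x _; rewrite gE lee_fin sqr_ge0.
    * by move=> x _; exact: gle.
  + apply: nearW => n.
    under eq_integral => x _ do rewrite gE.
    rewrite -l2_sqr// lee_fin ler_sqr ?nnegrE ?l2_ge0//.
    apply: le_trans _ (uc n). 
    apply: (@le_trans _ _ (\sum_(k < n) l2 (fun x => `|u k x|))).
      by apply: l2_sum => k _; exact: L2T_abs.
    by apply: ler_sum => k _; rewrite l2_abs.
- by move=> n x _; rewrite gE lee_fin sqr_ge0.
- by move=> x _ n m; exact: gle.
Qed.

Lemma norm_max (r : R) : `|r| = Num.max r 0 + Num.max (- r) 0.
Proof.
have /orP[r0|r0] := le_total 0 r.
  by rewrite ger0_norm// max_l// max_r ?addr0// oppr_le0.
by rewrite ler0_norm// max_r// max_l ?add0r// oppr_ge0.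
Qed.

Lemma sub_max (r : R) : r = Num.max r 0 - Num.max (- r) 0.
Proof.
have /orP[r0|r0] := le_total 0 r.
  by rewrite max_l// max_r ?subr0// oppr_le0.
by rewrite max_r// max_l ?sub0r ?opprK// oppr_ge0.
Qed.

Definition pseries u x : \bar R := (\sum_(0 <= k <oo) (Num.max (u k x) 0)%:E)%E.
(* Splitting into positive and negative parts makes the sum measurable and
   periodic everywhere, including where the series diverges. *)
Definition sumT u : R -> R := fun x =>
  fine (pseries u x) - fine (pseries (fun k => - u k) x).

Lemma pseries_ge0 u x : (0 <= pseries u x)%E.
Proof. by apply: nneseries_ge0 => k _ _; rewrite lee_fin le_max lexx orbT. Qed.

Lemma pseries_abs u x :
  (\sum_(0 <= k <oo) `|u k x|%:E = pseries u x + pseries (fun k => - u k)%R x)%E.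
Proof.
rewrite /pseries -nneseriesD.
- apply: eq_eseriesr => k _; rewrite -EFinD fctE; congr EFin.
  exact: norm_max.
- by move=> k _ _; rewrite lee_fin le_max lexx orbT.
- by move=> k _ _; rewrite lee_fin le_max lexx orbT.
Qed.

Lemma measurable_pseries u : (forall k, measurable_fun [set: R] (u k)) ->
  measurable_fun [set: R] (pseries u).
Proof.
move=> mu; apply: ge0_emeasurable_sum.
- by move=> k x _ _; rewrite lee_fin le_max lexx orbT.
- move=> k _; apply/measurable_EFinP; apply: measurable_maxr => //.
Qed.

Lemma pseries_split n u x : pseries u x =
  ((\sum_(k < n) Num.max (u k x) 0)%:E + pseries (fun k => u (k + n)%N) x)%E.
Proof.
rewrite /pseries (nneseries_split 0 n); last first.
  by move=> k _; rewrite lee_fin le_max lexx orbT.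
by rewrite add0n sumEFin big_mkord -(nneseries_addn n)// => k; rewrite lee_fin le_max lexx orbT.
Qed.

(** Finiteness of both series is what makes this true: [fine] replaces an infinite sum by 0, and the
    splitting would then fail. *)
Lemma sumT_split n u x :
  (pseries u x < +oo)%E -> (pseries (fun k => - u k)%R x < +oo)%E ->
  sumT u x = \sum_(k < n) u k x + sumT (fun k => u (k + n)%N) x.
Proof.
move=> p1 p2; rewrite /sumT.
have fin (v : nat -> R -> R) : (pseries v x < +oo)%E ->
   pseries v x \is a fin_num by rewrite ge0_fin_numE ?pseries_ge0.
have H1 := pseries_split n u x; have H2 := pseries_split n (fun k => - u k) x.
have f1 : pseries (fun k => u (k + n)%N) x \is a fin_num.
  apply: fin; apply: le_lt_trans p1; rewrite H1 leeDr// lee_fin.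
  by apply: sumr_ge0 => k _; rewrite le_max lexx orbT.
have f2 : pseries (fun k => - u (k + n)%N)%R x \is a fin_num.
  apply: fin; apply: le_lt_trans p2; rewrite H2 leeDr// lee_fin.
  by apply: sumr_ge0 => k _; rewrite le_max lexx orbT.
rewrite H1 H2 !fineD//=.
have -> : \sum_(k < n) u k x =
   \sum_(k < n) Num.max (u k x) 0 - \sum_(k < n) Num.max ((- u k) x) 0.
  rewrite -sumrB; apply: eq_bigr => k _; rewrite fctE.
  exact: sub_max.
lra.
Qed.

Lemma sumT_abs u x : (pseries u x + pseries (fun k => - u k)%R x < +oo)%E ->
  (`|sumT u x|%:E <= pseries u x + pseries (fun k => - u k)%R x)%E.
Proof.
move=> h; have p1 : pseries u x \is a fin_num.
  rewrite ge0_fin_numE ?pseries_ge0//; apply: le_lt_trans h.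
  by rewrite leeDl// pseries_ge0.
have p2 : pseries (fun k => - u k)%R x \is a fin_num.
  rewrite ge0_fin_numE ?pseries_ge0//; apply: le_lt_trans h.
  by rewrite leeDr// pseries_ge0.
rewrite /sumT -(fineK p1) -(fineK p2) -EFinD lee_fin.
have := pseries_ge0 u x; have := pseries_ge0 (fun k => - u k) x.
rewrite -(fineK p1) -(fineK p2) !lee_fin /= => h1 h2.
by rewrite ler_norml; apply/andP; split; lra.
Qed.

Lemma sumT_measurable u : (forall k, measurable_fun [set: R] (u k)) ->
  measurable_fun [set: R] (sumT u).
Proof.
move=> mu; apply: measurable_funB; apply: (measurableT_comp (fine_measurable measurableT)).
- exact: measurable_pseries.
- by apply: measurable_pseries => k; exact: measurableT_comp.
Qed.

Lemma L2_sumT u (c : R) : (forall k, L2T (u k)) -> 0 <= c ->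
  (forall n, \sum_(k < n) l2 (u k) <= c) -> L2T (sumT u) /\ l2 (sumT u) <= c.
Proof.
move=> Lu c0 uc.
have H := L2_abs_series Lu c0 uc.
have mu k := L2T_measurable (Lu k).
have mabs : measurable_fun [set: R] (fun x => ((\sum_(0 <= k <oo) `|u k x|%:E) ^+ 2)%E).
  by apply: emeasurable_funM; apply: ge0_emeasurable_sum => // k _;
    apply/measurable_EFinP; apply: (measurableT_comp (@normr_measurable R setT)).
have H2 : (\int[muT]_x ((sumT u x) ^+ 2)%:E <= (c ^+ 2)%:E)%E.
  apply: le_trans H; apply: ge0_le_integral => //.
  - by move=> x _; rewrite lee_fin sqr_ge0.
  - by apply: measurable_sqr_EFin; exact: sumT_measurable.
  - move=> x _; rewrite pseries_abs.
    (* Where the absolute series diverges the right-hand side is +oo, so the value given to [sumT]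
       there is harmless. *)
    have [h|] := ltP (pseries u x + pseries (fun k => - u k)%R x)%E +oo%E; last first.
      by rewrite leye_eq => /eqP ->; rewrite expe2 mulyy leey.
    have h0 := sumT_abs h.
    rewrite (_ : (sumT u x ^+ 2)%:E = (`|sumT u x|%:E ^+ 2)%E).
      by rewrite lee_sqr// adde_ge0// pseries_ge0.
    by rewrite expe2 -EFinM -expr2 real_normK ?num_real.
have L : L2T (sumT u).
  apply: L2T_intro.
  - move=> x; rewrite /sumT /pseries; congr (fine _ - fine _);
    by apply: eq_eseriesr => k _; rewrite ?fctE (L2T_periodic (Lu k)).
  - exact: sumT_measurable.
  - by apply: le_lt_trans H2 _; rewrite ltry.
by split => //; exact: l2_le.
Qed.

(** The square of the absolute series is integrable, hence finite almost everywhere; at such points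
    the remainder is the [sumT] of the shifted sequence, whose norm the tail bound controls. *)
Lemma L2_sumT_tail u (c : R) : (forall k, L2T (u k)) -> 0 <= c ->
  (forall n, \sum_(k < n) l2 (u k) <= c) ->
  forall n (e : R), 0 <= e -> (forall m, \sum_(k < m) l2 (u (k + n)%N) <= e) ->
  l2 (sumT u - \sum_(k < n) u k) <= e.
Proof.
move=> Lu c0 uc n e e0 ue.
have [L1 _] := L2_sumT Lu c0 uc.
have Lun k : L2T (u (k + n)%N) by [].
have [L2 ?] := L2_sumT Lun e0 ue.
suff -> : l2 (sumT u - \sum_(k < n) u k) = l2 (sumT (fun k => u (k + n)%N)) by [].
apply: l2_ae_eq => //; first by apply: L2TB => //; apply: L2T_sum.
have H := L2_abs_series Lu c0 uc.
have mu k := L2T_measurable (Lu k).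
have mabs : measurable_fun [set: R] (fun x => ((\sum_(0 <= k <oo) `|u k x|%:E) ^+ 2)%E).
  by apply: emeasurable_funM; apply: ge0_emeasurable_sum => // k _;
    apply/measurable_EFinP; apply: (measurableT_comp (@normr_measurable R setT)).
have : muT.-integrable setT (fun x => ((\sum_(0 <= k <oo) `|u k x|%:E) ^+ 2)%E).
  apply/integrableP; split => //.
  under eq_integral => x _.
    rewrite gee0_abs; last first.
      by rewrite expe2 mule_ge0// nneseries_ge0// => k _ _; rewrite lee_fin.
    over.
  by apply: le_lt_trans H _; rewrite ltry.
move=> /(integrable_ae measurableT); apply: ae_imp => x /= /(_ I) Hx _.
have {Hx} : (pseries u x + pseries (fun k => - u k)%R x < +oo)%E.
  rewrite -pseries_abs ltey; apply: contraTneq Hx => ->.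
  by rewrite ?expe2 ?mulyy.
move=> h; have p1 : (pseries u x < +oo)%E.
  by apply: le_lt_trans h; rewrite leeDl// pseries_ge0.
have p2 : (pseries (fun k => - u k)%R x < +oo)%E.
  by apply: le_lt_trans h; rewrite leeDr// pseries_ge0.
by rewrite !fctE (sumT_split n p1 p2) fct_sumE addrAC subrr add0r.
Qed.

End L2_series.

(** * The exponential of a bounded operator *)

Section exp_sums.
Context {R : realType}.
Implicit Types x s t : R.

Definition expS n x : R := \sum_(0 <= k < n) x ^+ k / k`!%:R.

Lemma expS_cvg x : expS n x @[n --> \oo] --> expR x.
Proof. exact: (is_cvg_series_exp_coeff x). Qed.

Lemma exp_coef_ge0 x k : 0 <= x -> 0 <= x ^+ k / k`!%:R.
Proof. by move=> x0; rewrite divr_ge0// exprn_ge0. Qed.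

Lemma expS_le n m x : 0 <= x -> (n <= m)%N -> expS n x <= expS m x.
Proof.
move=> x0 nm; rewrite /expS (big_cat_nat _ nm)//= lerDl sumr_ge0// => k _.
exact: exp_coef_ge0.
Qed.

Lemma expS_le_exp n x : 0 <= x -> expS n x <= expR x.
Proof.
move=> x0; apply: nondecreasing_cvgn_le => [p q pq|]; first exact: expS_le.
exact: (is_cvg_series_exp_coeff x).
Qed.

Lemma exp_coef_add s t n :
  \sum_(0 <= i < n.+1) (s ^+ i / i`!%:R) * (t ^+ (n - i) / (n - i)`!%:R) =
  (s + t) ^+ n / n`!%:R.
Proof.
have f0 k : (k`!%:R : R) != 0 by rewrite pnatr_eq0 -lt0n fact_gt0.
rewrite addrC exprDn mulr_suml big_mkord; apply: eq_bigr => -[i /= ilt] _.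
rewrite -mulr_natr.
have -> : (n`!%:R : R) = 'C(n, i)%:R * (i`!%:R * (n - i)`!%:R).
  by rewrite -!natrM bin_fact.
have c0 : ('C(n, i)%:R : R) != 0 by rewrite pnatr_eq0 -lt0n bin_gt0.
field.
by rewrite c0 !f0.
Qed.

Lemma exp_sum_triangle (V : lmodType R) (c : nat -> V) s t n :
  \sum_(0 <= k < n) ((s + t) ^+ k / k`!%:R) *: c k =
  \sum_(0 <= i < n) \sum_(0 <= j < n - i)
    ((s ^+ i / i`!%:R) * (t ^+ j / j`!%:R)) *: c (i + j)%N.
Proof.
elim: n => [|n IH]; first by rewrite !big_geq.
rewrite big_nat_recr//= IH big_nat_recr//= subSn// subnn big_nat1 addn0.
rewrite -exp_coef_add big_nat_recr//= subnn scalerDl addrA; congr (_ + _).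
rewrite scaler_suml -big_split/=; apply: eq_big_nat => i /andP[_ ilt].
by rewrite subSn ?(ltnW ilt)// big_nat_recr//= subnKC// ltnW.
Qed.

(** Square minus triangle: multiplying two truncated exponentials leaves exactly the pairs with i +
    j >= n. Stating it in a module lets the same identity serve for the operator powers and for the
    scalar series that bounds them. *)
Lemma exp_sum_prod (V : lmodType R) (c : nat -> V) s t n :
  \sum_(0 <= i < n) \sum_(0 <= j < n)
    ((s ^+ i / i`!%:R) * (t ^+ j / j`!%:R)) *: c (i + j)%N
  - \sum_(0 <= k < n) ((s + t) ^+ k / k`!%:R) *: c k =
  \sum_(0 <= i < n) \sum_(n - i <= j < n)
    ((s ^+ i / i`!%:R) * (t ^+ j / j`!%:R)) *: c (i + j)%N.
Proof.
rewrite exp_sum_triangle -sumrB; apply: eq_bigr => i _.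
by rewrite (@big_cat_nat _ _ _ (n - i)%N)//= ?leq_subr// addrAC subrr add0r.
Qed.

Lemma expS_prod s t n :
  \sum_(0 <= i < n) \sum_(n - i <= j < n)
    (s ^+ i / i`!%:R) * (t ^+ j / j`!%:R) = expS n s * expS n t - expS n (s + t).
Proof.
have := @exp_sum_prod R^o (fun=> 1) s t n; rewrite /GRing.scale/=.
under [X in _ - X]eq_bigr do rewrite mulr1.
under eq_bigr do under eq_bigr do rewrite mulr1.
under [RHS]eq_bigr do under eq_bigr do rewrite mulr1.
move=> <-; congr (_ - _); rewrite /expS mulr_suml; apply: eq_bigr => i _.
by rewrite mulr_sumr.
Qed.

(** From e^(-x) >= 1 - x follows e^x (1 - x) <= 1, so e^x - 1 - x <= x^2 / (1 - x); the restriction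
    x <= 1/2 turns this into 2 x^2. *)
Lemma expR_tail2 x : 0 <= x <= 2^-1 -> expR x - expS 2 x <= 2 * x ^+ 2.
Proof.
move=> /andP[x0 x1].
have -> : expS 2 x = 1 + x.
  by rewrite /expS big_nat_recr//= big_nat1 !fact0 expr0 expr1 !divr1.
have h := expR_ge1Dx (- x).
have e0 := expR_gt0 x.
have : expR x * (1 - x) <= 1.
  by rewrite -[leRHS](expRxMexpNx_1 x) ler_pM2l.
nra.
Qed.

End exp_sums.

Section bounded_exponential.
Context {R : realType}.
Variables (B : (R -> R) -> R -> R) (K : R).
Hypothesis K0 : 0 <= K.
Hypothesis BL : forall u, L2T u -> L2T (B u).
Hypothesis Blin : forall (a : R) u v, L2T u -> L2T v ->
  B (a *: u + v) = a *: B u + B v %[ae muT].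
Hypothesis BK : forall u, L2T u -> l2 (B u) <= K * l2 u.
Implicit Types (u v : R -> R) (s t : R).

Local Notation "f ≡ g" := (f = g %[ae muT]) (at level 70).

Lemma aeT_trans u v (w : R -> R) : u ≡ v -> v ≡ w -> u ≡ w.
Proof. exact: ae_eq_trans. Qed.

Lemma aeT_sym u v : u ≡ v -> v ≡ u.
Proof. exact: ae_eq_sym. Qed.

Lemma aeT_refl u : u ≡ u.
Proof. exact: ae_eq_refl. Qed.

Lemma aeT_D u v (w z : R -> R) : u ≡ v -> w ≡ z -> u + w ≡ v + z.
Proof. by apply: ae_imp2 => x /(_ I) e1 /(_ I) e2 _; rewrite !fctE e1 e2. Qed.

Lemma aeT_Z (a : R) u v : u ≡ v -> a *: u ≡ a *: v.
Proof. by apply: ae_imp => x /(_ I) e1 _; rewrite !fctE e1. Qed.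

Lemma aeT_sum (I : Type) (r : seq I) (P : pred I) (F G : I -> R -> R) :
  (forall i, P i -> F i ≡ G i) ->
  \sum_(i <- r | P i) F i ≡ \sum_(i <- r | P i) G i.
Proof.
move=> H; elim/big_rec2 : _ => [|i x y Pi]; first exact: aeT_refl.
by apply: aeT_D; exact: H.
Qed.

Definition Bn k u := iter k B u.

Lemma BnL k u : L2T u -> L2T (Bn k u).
Proof. by move=> Lu; elim: k => //= k; exact: BL. Qed.

Lemma BnK k u : L2T u -> l2 (Bn k u) <= K ^+ k * l2 u.
Proof.
move=> Lu; elim: k => [|k IH] /=; first by rewrite expr0 mul1r.
apply: le_trans (BK (BnL k Lu)) _.
by rewrite exprS -mulrA; exact: ler_wpM2l.
Qed.

(** Linearity and the bound give [l2 (B (u - v)) <= K * l2 (u - v) = 0]. This lets almost-everywhere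
    identities pass through the iterates of [B]. *)
Lemma B_ae u v : L2T u -> L2T v -> u ≡ v -> B u ≡ B v.
Proof.
move=> Lu Lv uv; apply/(l2B_eq0 (BL Lu) (BL Lv)).
have h : l2 (B (u - v)) = 0.
  apply/eqP; rewrite eq_le l2_ge0 andbT.
  apply: le_trans (BK (L2TB Lu Lv)) _.
  by have /(l2B_eq0 Lu Lv) -> := uv; rewrite mulr0.
rewrite -h; apply: l2_ae_eq; [by apply: L2TB; exact: BL|by apply: BL; exact: L2TB|].
have := Blin (-1) Lv Lu; rewrite scaleN1r addrC scaleN1r [in X in _ -> X]addrC.
exact: aeT_sym.
Qed.

Lemma Bn_lin k (a : R) u v : L2T u -> L2T v ->
  Bn k (a *: u + v) ≡ a *: Bn k u + Bn k v.
Proof.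
move=> Lu Lv; elim: k => [|k IH] /=; first exact: aeT_refl.
apply: aeT_trans (Blin a (BnL k Lu) (BnL k Lv)).
by apply: B_ae IH; [apply: BnL|]; apply: L2T_lin => //; exact: BnL.
Qed.

Lemma Bn0 k : Bn k 0 ≡ 0.
Proof.
apply: l2_eq0; first exact: BnL L2T0.
apply/eqP; rewrite eq_le l2_ge0 andbT.
by apply: le_trans (BnK k L2T0) _; rewrite l2_0 mulr0.
Qed.

Lemma Bn_sum k (r : seq nat) (a : nat -> R) (F : nat -> R -> R) :
  (forall i, L2T (F i)) ->
  Bn k (\sum_(i <- r) a i *: F i) ≡ \sum_(i <- r) a i *: Bn k (F i).
Proof.
move=> LF; elim: r => [|i r IH]; first by rewrite !big_nil; exact: Bn0.
rewrite !big_cons.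
have Ls : L2T (\sum_(j <- r) a j *: F j) by apply: L2T_sum => j _; exact: L2TZ.
apply: aeT_trans (Bn_lin k (a i) (LF i) Ls) _.
by apply: aeT_D => //; exact: aeT_refl.
Qed.

Definition expT t u k : R -> R := (t ^+ k / k`!%:R) *: Bn k u.
Definition Pexp n t u : R -> R := \sum_(0 <= k < n) expT t u k.
Definition Sexp t u : R -> R := sumT (expT t u).

Lemma expTL t u k : L2T u -> L2T (expT t u k).
Proof. by move=> Lu; apply: L2TZ; exact: BnL. Qed.

Lemma PexpL n t u : L2T u -> L2T (Pexp n t u).
Proof. by move=> Lu; apply: L2T_sum => k _; exact: expTL. Qed.

Lemma l2_expT t u k : 0 <= t -> L2T u ->
  l2 (expT t u k) <= (K * t) ^+ k / k`!%:R * l2 u.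
Proof.
move=> t0 Lu; rewrite l2Z ?ger0_norm ?exp_coef_ge0//; last exact: BnL.
rewrite [X in _ <= X](_ : _ = (t ^+ k / k`!%:R) * (K ^+ k * l2 u)).
  by apply: ler_wpM2l; [exact: exp_coef_ge0|exact: BnK].
by rewrite exprMn; ring.
Qed.

Lemma l2_expT_sum t u n m : 0 <= t -> L2T u ->
  \sum_(k < m) l2 (expT t u (k + n)%N) <= (expR (K * t) - expS n (K * t)) * l2 u.
Proof.
move=> t0 Lu; have kt : 0 <= K * t by exact: mulr_ge0.
apply: (@le_trans _ _ (\sum_(k < m) (K * t) ^+ (k + n) / (k + n)`!%:R * l2 u)).
  by apply: ler_sum => k _; exact: l2_expT.
rewrite -mulr_suml; apply: ler_wpM2r; first exact: l2_ge0.
rewrite lerBrDl; apply: le_trans _ (expS_le_exp (m + n) kt).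
rewrite {2}/expS (@big_cat_nat _ _ _ n)//= ?leq_addl//.
by rewrite lerD2l -[X in index_iota X]add0n big_addn addnK big_mkord.
Qed.

Lemma l2_Pexp n t u : 0 <= t -> L2T u -> l2 (Pexp n t u) <= expS n (K * t) * l2 u.
Proof.
move=> t0 Lu; apply: (@le_trans _ _ (\sum_(0 <= k < n) l2 (expT t u k))).
  by apply: l2_sum => k _; exact: expTL.
by rewrite /expS mulr_suml; apply: ler_sum => k _; exact: l2_expT.
Qed.

Lemma Sexp_summable t u n : 0 <= t -> L2T u ->
  \sum_(k < n) l2 (expT t u k) <= expR (K * t) * l2 u.
Proof.
move=> t0 Lu; have := l2_expT_sum 0 n t0 Lu.
by under eq_bigr do rewrite addn0; rewrite /expS big_geq// subr0.
Qed.

Lemma SexpL t u : 0 <= t -> L2T u -> L2T (Sexp t u).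
Proof.
move=> t0 Lu; have [] // := @L2_sumT R (expT t u) (expR (K * t) * l2 u).
- by move=> k; exact: expTL.
- by rewrite mulr_ge0// ?expR_ge0// l2_ge0.
- by move=> n; exact: Sexp_summable.
Qed.

Lemma l2_Sexp t u : 0 <= t -> L2T u -> l2 (Sexp t u) <= expR (K * t) * l2 u.
Proof.
move=> t0 Lu; have [] // := @L2_sumT R (expT t u) (expR (K * t) * l2 u).
- by move=> k; exact: expTL.
- by rewrite mulr_ge0// ?expR_ge0// l2_ge0.
- by move=> n; exact: Sexp_summable.
Qed.

Lemma Sexp_tail n t u : 0 <= t -> L2T u ->
  l2 (Sexp t u - Pexp n t u) <= (expR (K * t) - expS n (K * t)) * l2 u.
Proof.
move=> t0 Lu; rewrite /Pexp big_mkord.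
apply: (@L2_sumT_tail R _ (expR (K * t) * l2 u)).
- by move=> k; exact: expTL.
- by rewrite mulr_ge0// ?expR_ge0// l2_ge0.
- by move=> m; exact: Sexp_summable.
- by rewrite mulr_ge0 ?l2_ge0// subr_ge0 expS_le_exp// mulr_ge0.
- by move=> m; exact: l2_expT_sum.
Qed.

Lemma Pexp_lin n t (a : R) u v : L2T u -> L2T v ->
  Pexp n t (a *: u + v) ≡ a *: Pexp n t u + Pexp n t v.
Proof.
move=> Lu Lv; rewrite /Pexp scaler_sumr -big_split/=.
apply: aeT_sum => k _; rewrite /expT; set c := _ / _.
have -> : a *: (c *: Bn k u) + c *: Bn k v = c *: (a *: Bn k u + Bn k v).
  by rewrite scalerDr !scalerA [c * a]mulrC.
by apply: aeT_Z; exact: Bn_lin.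
Qed.

Lemma Pexp_Pexp n s t u : L2T u -> Pexp n s (Pexp n t u) ≡
  \sum_(0 <= i < n) \sum_(0 <= j < n)
    ((s ^+ i / i`!%:R) * (t ^+ j / j`!%:R)) *: Bn (i + j) u.
Proof.
move=> Lu; apply: aeT_sum => i _.
under [X in _ ≡ X]eq_bigr do rewrite -scalerA.
rewrite -scaler_sumr; apply: aeT_Z.
rewrite /Pexp /expT.
apply: aeT_trans (Bn_sum i _ _ _) _; first by move=> j; exact: BnL.
apply: aeT_sum => j _; rewrite /Bn iterD; exact: aeT_refl.
Qed.

Lemma l2_triangle v u (w : R -> R) : L2T u -> L2T v -> L2T w ->
  l2 (u - w) <= l2 (u - v) + l2 (v - w).
Proof.
move=> Lu Lv Lw; rewrite [X in l2 X](_ : _ = (u - v) + (v - w)).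
  by apply: l2D; exact: L2TB.
by rewrite addrA subrK.
Qed.

Lemma l2BC u v : L2T u -> L2T v -> l2 (u - v) = l2 (v - u).
Proof. by move=> Lu Lv; rewrite -opprB l2N//; exact: L2TB. Qed.

(** Each surplus pair (i, j) costs at most its scalar counterpart for K s and K t, so the defect is
    bounded by the same defect for the numerical exponential, which tends to 0 by the functional
    equation of [expR]. *)
Lemma l2_Pexp_Pexp n s t u : 0 <= s -> 0 <= t -> L2T u ->
  l2 (Pexp n s (Pexp n t u) - Pexp n (s + t) u) <=
  (expS n (K * s) * expS n (K * t) - expS n (K * (s + t))) * l2 u.
Proof.
move=> s0 t0 Lu.
pose c i j := (s ^+ i / i`!%:R) * (t ^+ j / j`!%:R).
have Ls : L2T (\sum_(0 <= i < n) \sum_(n - i <= j < n) c i j *: Bn (i + j) u).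
  by apply: L2T_sum => i _; apply: L2T_sum => j _; apply: L2TZ; exact: BnL.
rewrite [X in X <= _](_ : _ =
   l2 (\sum_(0 <= i < n) \sum_(n - i <= j < n) c i j *: Bn (i + j) u)).
  rewrite [K * (s + t)]mulrDr -expS_prod mulr_suml.
  apply: (@le_trans _ _ (\sum_(0 <= i < n) l2 (\sum_(n - i <= j < n) c i j *: Bn (i + j) u))).
    by apply: l2_sum => i _; apply: L2T_sum => j _; apply: L2TZ; exact: BnL.
  apply: ler_sum => i _; rewrite mulr_suml.
  apply: (@le_trans _ _ (\sum_(n - i <= j < n) l2 (c i j *: Bn (i + j) u))).
    by apply: l2_sum => j _; apply: L2TZ; exact: BnL.
  apply: ler_sum => j _; rewrite l2Z; last exact: BnL.
  have c0 : 0 <= c i j by apply: mulr_ge0; exact: exp_coef_ge0.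
  rewrite ger0_norm// [X in _ <= X](_ : _ = c i j * (K ^+ (i + j) * l2 u)).
    by apply: ler_wpM2l => //; exact: BnK.
  by rewrite /c !exprMn exprD; ring.
apply: l2_ae_eq => //; first by apply: L2TB; do ?apply: PexpL.
rewrite /c -exp_sum_prod.
have := Pexp_Pexp n s t Lu.
by apply: ae_imp => x /(_ I) e _; rewrite !fctE e.
Qed.

Lemma Sexp_add s t u : 0 <= s -> 0 <= t -> L2T u ->
  Sexp (s + t) u ≡ Sexp s (Sexp t u).
Proof.
move=> s0 t0 Lu; have st0 : 0 <= s + t by exact: addr_ge0.
have L1 := SexpL st0 Lu; have L2 := SexpL t0 Lu; have L3 := SexpL s0 L2.
apply/(l2B_eq0 L1 L3); apply/eqP; rewrite eq_le l2_ge0 andbT.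
pose r n x := expR (K * x) - expS n (K * x).
(* One summand for each link of the chain from Sexp (s + t) u to Pexp (s + t) u, to Pexp s (Pexp t
   u), to Pexp s (Sexp t u), to Sexp s (Sexp t u). *)
pose bnd n := r n (s + t) * l2 u +
  ((expS n (K * s) * expS n (K * t) - expS n (K * (s + t))) * l2 u
  + (expS n (K * s) * (r n t * l2 u) + r n s * l2 (Sexp t u))).
have rcvg x : r n x @[n --> \oo] --> (0 : R).
  by rewrite -(subrr (expR (K * x))); apply: cvgB; [exact: cvg_cst|exact: expS_cvg].
have : bnd n @[n --> \oo] --> (0 : R).
  rewrite [X in _ --> X](_ : _ = 0 * l2 u + ((expR (K * s) * expR (K * t) - expR (K * (s + t))) * l2 u
    + (expR (K * s) * (0 * l2 u) + 0 * l2 (Sexp t u)))); last first.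
    by rewrite mulrDr expRD; ring.
  apply: cvgD; first by apply: cvgM => //; exact: cvg_cst.
  apply: cvgD; last first.
    apply: cvgD; last by apply: cvgM => //; exact: cvg_cst.
    by apply: cvgM; [exact: expS_cvg|apply: cvgM => //; exact: cvg_cst].
  apply: cvgM; last exact: cvg_cst.
  by apply: cvgB; [apply: cvgM; exact: expS_cvg|exact: expS_cvg].
move=> /cvgr_to_ge; apply; apply: nearW => n.
have P1 := PexpL n (s + t) Lu; have P2 := PexpL n t Lu.
have P3 := PexpL n s P2; have P4 := PexpL n s L2.
apply: le_trans (l2_triangle L1 P1 L3) _; rewrite /bnd.
apply: lerD; first exact: Sexp_tail.
apply: le_trans (l2_triangle P1 P3 L3) _.
apply: lerD; first by rewrite l2BC//; exact: l2_Pexp_Pexp.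
apply: le_trans (l2_triangle P3 P4 L3) _.
apply: lerD; last by rewrite l2BC//; exact: Sexp_tail.
rewrite (@l2_ae_eq _ _ (Pexp n s (Pexp n t u - Sexp t u))); last 3 first.
- exact: L2TB.
- by apply: PexpL; exact: L2TB.
- have := Pexp_lin n s (-1) L2 P2; rewrite !scaleN1r addrC [in X in _ ≡ X -> _]addrC.
  exact: aeT_sym.
apply: le_trans (l2_Pexp n s0 (L2TB P2 L2)) _.
apply: ler_wpM2l; first by rewrite /expS sumr_ge0// => k _; rewrite exp_coef_ge0// mulr_ge0.
by rewrite l2BC//; exact: Sexp_tail.
Qed.

Lemma lincomb_sub (V : lmodType R) (a : R) (p q r x : V) :
  a *: p + q - (a *: r + x) = a *: (p - r) + (q - x).
Proof. by rewrite scalerBr opprD addrACA. Qed.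

Lemma Sexp_lin t (a : R) u v : 0 <= t -> L2T u -> L2T v ->
  Sexp t (a *: u + v) ≡ a *: Sexp t u + Sexp t v.
Proof.
move=> t0 Lu Lv; have Lw := L2T_lin a Lu Lv.
have L1 := SexpL t0 Lw; have Su := SexpL t0 Lu; have Sv := SexpL t0 Lv.
have L2 := L2T_lin a Su Sv.
apply/(l2B_eq0 L1 L2); apply/eqP; rewrite eq_le l2_ge0 andbT.
pose r n := expR (K * t) - expS n (K * t).
pose bnd n := r n * (l2 (a *: u + v) + (`|a| * l2 u + l2 v)).
have : bnd n @[n --> \oo] --> (0 : R).
  rewrite [X in _ --> X](_ : _ = 0 * (l2 (a *: u + v) + (`|a| * l2 u + l2 v))); last by rewrite mul0r.
  apply: cvgM; last exact: cvg_cst.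
  by rewrite -(subrr (expR (K * t))); apply: cvgB; [exact: cvg_cst|exact: expS_cvg].
move=> /cvgr_to_ge; apply; apply: nearW => n.
have P1 := PexpL n t Lw; have Pu := PexpL n t Lu; have Pv := PexpL n t Lv.
have P2 := L2T_lin a Pu Pv.
apply: le_trans (l2_triangle L1 P1 L2) _; rewrite /bnd mulrDr.
apply: lerD; first exact: Sexp_tail.
apply: le_trans (l2_triangle P1 P2 L2) _.
have /(l2B_eq0 P1 P2) -> := Pexp_lin n t a Lu Lv; rewrite add0r.
rewrite [X in l2 X](_ : _ = a *: (Pexp n t u - Sexp t u) + (Pexp n t v - Sexp t v)).
  apply: le_trans (l2D _ _) _; [by apply: L2TZ; exact: L2TB|exact: L2TB|].
  rewrite mulrDr; apply: lerD; last by rewrite l2BC//; exact: Sexp_tail.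
  rewrite l2Z; last exact: L2TB.
  by rewrite mulrCA; apply: ler_wpM2l => //; rewrite l2BC//; exact: Sexp_tail.
exact: lincomb_sub.
Qed.

Lemma opnorm_le (T : (R -> R) -> R -> R) (c : R) : 0 <= c ->
  (forall u, L2T u -> L2T (T u)) ->
  (forall u, L2T u -> l2 (T u) <= c * l2 u) -> (opnorm T <= c%:E)%E.
Proof.
move=> c0 TL Tc; apply: ge_ereal_sup => _ [u [Lu u1] <-].
rewrite (L2norm_fin (TL _ Lu)) lee_fin.
apply: le_trans (Tc _ Lu) _; move: u1; rewrite (L2norm_fin Lu) lee_fin => u1.
by rewrite -[leRHS]mulr1; exact: ler_wpM2l.
Qed.

Lemma L2norm_cvg0 (f : R -> R -> R) (g : R -> R) :
  (\forall t \near 0^'+, L2T (f t) /\ l2 (f t) <= g t) ->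
  g t @[t --> 0^'+] --> (0 : R) -> L2norm (f t) @[t --> 0^'+] --> 0%E.
Proof.
move=> H g0.
have l0 : l2 (f t) @[t --> 0^'+] --> (0 : R).
  apply: (@squeeze_cvgr _ _ _ _ (fun=> 0) g) => //; last exact: cvg_cst.
  by near=> t; rewrite l2_ge0/=; have [] // : L2T (f t) /\ l2 (f t) <= g t by near: t.
apply/fine_cvgP; split => //.
near=> t; have [Lt _] : L2T (f t) /\ l2 (f t) <= g t by near: t.
by rewrite L2norm_fin.
Unshelve. all: by end_near. Qed.

Lemma cvg0_L2norm (f : R -> R -> R) :
  L2norm (f t) @[t --> 0^'+] --> 0%E -> l2 (f t) @[t --> 0^'+] --> (0 : R).
Proof. by move=> /fine_cvgP[]. Qed.

Lemma near0_lt (c : R) : 0 < c -> \forall t \near 0^'+, 0 < t < c.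
Proof.
move=> c0; near=> t; apply/andP; split.
  by near: t; exact: nbhs_right_gt.
by near: t; exact: nbhs_right_lt.
Unshelve. all: by end_near. Qed.

Lemma Sexp_Pexp1 t u : 0 <= t -> L2T u -> l2 (Sexp t u - u) <= (expR (K * t) - 1) * l2 u.
Proof.
move=> t0 Lu; have := Sexp_tail 1 t0 Lu.
by rewrite /Pexp /expS !big_nat1 /expT !expr0 fact0 divr1 scale1r.
Qed.

Lemma Sexp0 u : L2T u -> Sexp 0 u ≡ u.
Proof.
move=> Lu; apply/(l2B_eq0 (SexpL (lexx 0) Lu) Lu).
apply/eqP; rewrite eq_le l2_ge0 andbT; apply: le_trans (Sexp_Pexp1 (lexx 0) Lu) _.
by rewrite mulr0 expR0 subrr mul0r.
Qed.

Lemma Sexp_C0 : C0_semigroup Sexp.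
Proof.
split.
- move=> t t0; split.
  + by move=> u; exact: SexpL.
  + by move=> a u v Lu Lv; exact: Sexp_lin.
  + apply: (@le_lt_trans _ _ (expR (K * t))%:E); last exact: ltry.
    apply: opnorm_le; [exact: expR_ge0| |]; move=> u Lu; first exact: SexpL.
    exact: l2_Sexp.
- exact: Sexp0.
- by move=> t s u s0 t0 Lu; exact: Sexp_add.
- move=> u Lu; apply: (@L2norm_cvg0 _ (fun t => (expR (K * t) - 1) * l2 u)).
    near=> t; have t0 : 0 <= t by apply: ltW; near: t; exact: nbhs_right_gt.
    by split; [apply: L2TB => //; exact: SexpL|exact: Sexp_Pexp1].
  rewrite [X in _ --> X](_ : _ = (1 - 1) * l2 u); last by rewrite subrr mul0r.
  apply: cvgM; last exact: cvg_cst.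
  apply: cvgB; last exact: cvg_cst.
  rewrite -[X in _ --> X]expR0.
  apply: (@continuous_cvg _ _ _ _ _ _ expR); first exact: continuous_expR.
  rewrite -[X in _ --> X](mulr0 K); apply: cvgM; first exact: cvg_cst.
  by apply: cvg_at_right_filter; exact: cvg_id.
Unshelve. all: by end_near. Qed.

(** After division by h, what remains is the tail of the series from order 2, of norm at most 2 (K
    h)^2 / h times that of [u]. *)
Lemma Sexp_quotient h u : 0 < h -> K * h <= 2^-1 -> L2T u ->
  l2 (h^-1 *: (Sexp h u - u) - B u) <= 2 * K ^+ 2 * l2 u * h.
Proof.
move=> h0 kh Lu; have hn := ltW h0.
have -> : h^-1 *: (Sexp h u - u) - B u = h^-1 *: (Sexp h u - Pexp 2 h u).
  rewrite /Pexp big_nat_recr//= big_nat1 /expT expr0 expr1 !fact0 !divr1 scale1r.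
  rewrite opprD addrA [in RHS]scalerBr scalerA mulVf ?gt_eqF//.
  by rewrite scale1r.
rewrite l2Z; last by apply: L2TB; [exact: SexpL|exact: PexpL].
rewrite gtr0_norm ?invr_gt0// ler_pdivrMl//.
apply: le_trans (Sexp_tail 2 hn Lu) _.
rewrite [X in _ <= X](_ : _ = 2 * (K * h) ^+ 2 * l2 u); last by ring.
apply: ler_wpM2r; first exact: l2_ge0.
by apply: expR_tail2; rewrite mulr_ge0.
Qed.

Lemma near_small : \forall h \near 0^'+, 0 < h /\ K * h <= 2^-1.
Proof.
have K2 : 0 < 2 * (K + 1) by have := K0; lra.
have K1 : 0 < (2 * (K + 1))^-1 by rewrite invr_gt0.
near=> h; have /andP[h0 hK] : 0 < h < (2 * (K + 1))^-1.
  by near: h; exact: near0_lt.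
split => //; rewrite -[leRHS]mul1r ler_pdivlMr//.
have : h * (2 * (K + 1)) < 1 by rewrite -ltr_pdivlMr// mul1r.
nra.
Unshelve. all: by end_near. Qed.

Lemma Sexp_quotient_cvg u : L2T u ->
  l2 (h^-1 *: (Sexp h u - u) - B u) @[h --> 0^'+] --> (0 : R).
Proof.
move=> Lu.
apply: (@squeeze_cvgr _ _ _ _ (fun=> 0) (fun h => 2 * K ^+ 2 * l2 u * h)).
- near=> h; rewrite l2_ge0/=.
  have [h0 kh] : 0 < h /\ K * h <= 2^-1 by near: h; exact: near_small.
  exact: Sexp_quotient.
- exact: cvg_cst.
- apply: cvg_at_right_filter; rewrite -[X in _ --> X](mulr0 (2 * K ^+ 2 * l2 u)).
  by apply: cvgM; [exact: cvg_cst|exact: cvg_id].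
Unshelve. all: by end_near. Qed.

(** Forwards, [v] and [B u] are limits of the same difference quotients, hence agree almost
    everywhere. Backwards, the quotients converge for every [u] in L^2, since [B] is bounded. *)
Lemma Sexp_generator u v :
  generator_graph Sexp u v <-> [/\ L2T u, L2T v & v ≡ B u].
Proof.
split=> -[Lu Lv H]; split => //.
- apply/(l2B_eq0 Lv (BL Lu)); apply/eqP; rewrite eq_le l2_ge0 andbT.
  have Hs : l2 (h^-1 *: (Sexp h u - u) - v) + l2 (h^-1 *: (Sexp h u - u) - B u)
      @[h --> 0^'+] --> (0 + 0 : R).
    by apply: cvgD; [exact: cvg0_L2norm|exact: Sexp_quotient_cvg].
  rewrite -[leRHS]addr0; apply: (cvgr_to_ge Hs); near=> h.
  have h0 : 0 < h by near: h; exact: nbhs_right_gt.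
  have Lq : L2T (h^-1 *: (Sexp h u - u)).
    by apply: L2TZ; apply: L2TB => //; apply: SexpL => //; exact: ltW.
  rewrite /= [X in _ <= X + _]l2BC//; exact: l2_triangle (BL Lu).
- apply: (@L2norm_cvg0 _ (fun h => l2 (h^-1 *: (Sexp h u - u) - B u))).
    near=> h; have h0 : 0 < h by near: h; exact: nbhs_right_gt.
    have Lq : L2T (h^-1 *: (Sexp h u - u)).
      by apply: L2TZ; apply: L2TB => //; apply: SexpL => //; exact: ltW.
    split; first exact: L2TB.
    rewrite le_eqVlt; apply/orP; left; apply/eqP.
    apply: l2_ae_eq; [exact: L2TB|by apply: L2TB => //; exact: BL|].
    by apply: ae_imp H => x /(_ I) e _; rewrite !fctE e.
  exact: Sexp_quotient_cvg.
Unshelve. all: by end_near. Qed.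

(** * The sharp growth bound from a one-step energy estimate *)

Section growth.
Variable w : R.
Hypothesis w0 : 0 <= w.
Hypothesis dissip : forall u h, L2T u -> 0 <= h ->
  l2 (u + h *: B u) ^+ 2 <= (1 + 2 * w * h + K ^+ 2 * h ^+ 2) * l2 u ^+ 2.

(** In 3 = 1 + 2, the 1 comes from (1 + 2 w h + K^2 h^2) <= (1 + w h + K^2 h^2)^2 for the
    first-order part [u + h *: B u], and the 2 from the exponential tail of order 2. Finally 1 + x
    <= e^x. *)
Lemma Sexp_small h u : 0 <= h -> K * h <= 2^-1 -> L2T u ->
  l2 (Sexp h u) <= expR (w * h + 3 * K ^+ 2 * h ^+ 2) * l2 u.
Proof.
move=> h0 kh Lu.
have P2 : Pexp 2 h u = u + h *: B u.
  by rewrite /Pexp big_nat_recr//= big_nat1 /expT expr0 expr1 !fact0 !divr1 scale1r.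
have LP : L2T (u + h *: B u) by apply: L2TD => //; apply: L2TZ; exact: BL.
have LS := SexpL h0 Lu.
have -> : Sexp h u = (Sexp h u - Pexp 2 h u) + (u + h *: B u) by rewrite P2 subrK.
apply: le_trans (l2D _ LP) _; first by apply: L2TB => //; exact: PexpL.
have H1 : l2 (u + h *: B u) <= (1 + w * h + K ^+ 2 * h ^+ 2) * l2 u.
  have c0 : 0 <= 1 + w * h + K ^+ 2 * h ^+ 2 by rewrite !addr_ge0 ?mulr_ge0 ?sqr_ge0.
  rewrite -ler_sqr ?nnegrE ?l2_ge0 ?mulr_ge0 ?l2_ge0//.
  apply: le_trans (dissip Lu h0) _; rewrite exprMn; apply: ler_wpM2r; first exact: sqr_ge0.
  have : 0 <= (w * h + K ^+ 2 * h ^+ 2) ^+ 2 by exact: sqr_ge0.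
  have : 0 <= K ^+ 2 * h ^+ 2 by rewrite mulr_ge0 ?sqr_ge0.
  nra.
apply: le_trans (lerD (Sexp_tail 2 h0 Lu) H1) _; rewrite -mulrDl.
apply: ler_wpM2r; first exact: l2_ge0.
have := expR_ge1Dx (w * h + 3 * K ^+ 2 * h ^+ 2).
have : expR (K * h) - expS 2 (K * h) <= 2 * (K * h) ^+ 2.
  by apply: expR_tail2; rewrite mulr_ge0.
rewrite exprMn; lra.
Qed.

Lemma Sexp_iter h n u : 0 <= h -> K * h <= 2^-1 -> L2T u ->
  l2 (Sexp (n%:R * h) u) <= expR (n%:R * (w * h + 3 * K ^+ 2 * h ^+ 2)) * l2 u.
Proof.
move=> h0 kh Lu; elim: n => [|n IH].
  rewrite !mul0r expR0 mul1r; rewrite (l2_ae_eq _ _ (Sexp0 Lu))//; exact: SexpL.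
have nh : 0 <= n%:R * h by rewrite mulr_ge0.
have LS := SexpL nh Lu.
rewrite -nat1r mulrDl mul1r (l2_ae_eq _ _ (Sexp_add h0 nh Lu)).
- have := Sexp_small h0 kh LS.
  move: IH; set X := w * h + _; move: X => X IH /le_trans; apply.
  rewrite [Y in _ <= expR Y * _](_ : _ = X + n%:R * X); last by rewrite mulrDl mul1r.
  by rewrite expRD -mulrA; apply: ler_wpM2l => //; exact: expR_ge0.
- by apply: SexpL => //; exact: addr_ge0.
- exact: SexpL.
Qed.

(** With n + 1 steps of length t/(n + 1), the quadratic errors add up to 3 K^2 t^2 / (n + 1), whence
    [harmonic n]; in the limit the exponent keeps only w t. Large n also ensures the smallness K h
    <= 1/2. *)
Lemma Sexp_growth t u : 0 <= t -> L2T u -> l2 (Sexp t u) <= expR (w * t) * l2 u.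
Proof.
move=> t0 Lu.
have : expR (w * t + 3 * K ^+ 2 * t ^+ 2 * harmonic n) * l2 u @[n --> \oo]
    --> expR (w * t) * l2 u.
  apply: cvgM; last exact: cvg_cst.
  apply: (@continuous_cvg _ _ _ _ _ _ expR); first exact: continuous_expR.
  rewrite -[X in _ --> X]addr0; apply: cvgD; first exact: cvg_cst.
  rewrite -[X in _ --> X](mulr0 (3 * K ^+ 2 * t ^+ 2)); apply: cvgM; first exact: cvg_cst.
  exact: cvg_harmonic.
move=> /cvgr_to_ge; apply; near=> n.
pose h := t / n.+1%:R.
have h0 : 0 <= h by rewrite divr_ge0.
have n0 : (0 : R) < n.+1%:R by rewrite ltr0n.
have kh : K * h <= 2^-1.
  rewrite /h mulrA ler_pdivrMr// ler_pdivlMl//.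
  have : 2 * (K * t) <= n%:R by near: n; exact: nbhs_infty_ger.
  by move=> /le_trans; apply; rewrite ler_nat.
have := Sexp_iter n.+1 h0 kh Lu.
have -> : n.+1%:R * h = t by rewrite /h mulrC divfK// gt_eqF.
suff -> : n.+1%:R * (w * h + 3 * K ^+ 2 * h ^+ 2) =
  w * t + 3 * K ^+ 2 * t ^+ 2 * harmonic n by [].
by rewrite /h /harmonic/=; field; rewrite gt_eqF.
Unshelve. all: by end_near. Qed.

Lemma opnorm_Sexp t : 0 <= t -> (opnorm (Sexp t) <= (expR (w * t))%:E)%E.
Proof.
move=> t0; apply: opnorm_le; [exact: expR_ge0| |] => u Lu; first exact: SexpL.
exact: Sexp_growth.
Qed.

End growth.

End bounded_exponential.

(** * Periodization and convolution *)

Section periodization_theory.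
Context {R : realType}.
Local Notation mu := (@lebesgue_measure R).
Implicit Types h u G : R -> R.

Lemma periodization_ext h G x y :
  (forall n : int, h (x + n%:~R) = G (y + n%:~R)) ->
  periodization h x = periodization G y.
Proof.
move=> H; rewrite /periodization; congr (fine (_ - _)); apply: eq_esum => n _;
by rewrite ?funeposE ?funenegE /= H.
Qed.

Lemma reindex_esum_int (a : int -> \bar R) (e : int -> int) : bijective e ->
  (\esum_(n in [set: int]) a n = \esum_(n in [set: int]) a (e n))%E.
Proof.
move=> [f ef fe]; apply: reindex_esum; split => //.
- by move=> m n _ _ /(congr1 f); rewrite !ef.
- by move=> m _; exists (f m); rewrite ?fe.
Qed.

Lemma periodization_periodic h x : periodization h (x + 1) = periodization h x.
Proof.
rewrite /periodization; congr (fine (_ - _)).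
- rewrite [RHS](@reindex_esum_int _ (fun n => 1 + n)); last first.
    by exists (fun n => n - 1) => n /=; ring.
  by apply: eq_esum => n _; rewrite intrD addrA.
- rewrite [RHS](@reindex_esum_int _ (fun n => 1 + n)); last first.
    by exists (fun n => n - 1) => n /=; ring.
  by apply: eq_esum => n _; rewrite intrD addrA.
Qed.

Lemma oppz_bij : bijective (fun n : int => - n).
Proof. by exists (fun n => - n) => n; rewrite opprK. Qed.

Lemma periodization_refl h x y :
  periodization (fun t => h (x - t)) y = periodization h (x - y).
Proof.
rewrite /periodization; congr (fine (_ - _)).
- rewrite [RHS](reindex_esum_int _ oppz_bij); apply: eq_esum => n _.
  by rewrite !funeposE/= intrN opprD addrA.
- rewrite [RHS](reindex_esum_int _ oppz_bij); apply: eq_esum => n _.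
  by rewrite !funenegE/= intrN opprD addrA.
Qed.

Lemma esum_intZ (c : R) (a : int -> \bar R) : 0 <= c -> (forall n, 0 <= a n)%E ->
  (\esum_(n in [set: int]) (c%:E * a n) = c%:E * \esum_(n in [set: int]) a n)%E.
Proof.
move=> c0 a0.
rewrite !(reindex_esum _ _ _ _ enum_int_bij) -!nneseries_esumT//.
- by rewrite -nneseriesZl.
- by move=> n; rewrite mule_ge0.
Qed.

(** For c > 0, an infinite argument makes the difference infinite on both sides, and [fine] sends
    both to 0. This makes [periodization] homogeneous everywhere, including where the family is not
    summable. *)
Lemma fine_scale (c : R) (x y : \bar R) : 0 <= c -> (0 <= x)%E -> (0 <= y)%E ->
  fine (c%:E * x - c%:E * y) = c * fine (x - y).
Proof.
rewrite le_eqVlt => /predU1P[<-|c0] x0 y0.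
  by rewrite !mul0e oppe0 adde0 mul0r.
move: x y x0 y0 => [x| |] [y| |] //= _ _; rewrite ?gt0_muley ?lte_fin//= ?mulr0//.
by rewrite mulrBr.
Qed.

Lemma periodization_ge0Z (c : R) h x : 0 <= c ->
  periodization (fun z => c * h z) x = c * periodization h x.
Proof.
move=> c0; rewrite /periodization -fine_scale//; last 2 first.
- by apply: esum_ge0 => n _; exact: funepos_ge0.
- by apply: esum_ge0 => n _; exact: funeneg_ge0.
rewrite -!esum_intZ//.
congr (fine (_ - _)); apply: eq_esum => n _.
- by rewrite !funeposE/= -!EFin_max -EFinM maxr_pMr// mulr0.
- by rewrite !funenegE/= -!EFin_max -EFinM maxr_pMr// mulr0 mulrN.
Qed.

Lemma periodization_fin_opp (x y : \bar R) : (0 <= x)%E -> (0 <= y)%E ->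
  fine (y - x) = - fine (x - y).
Proof.
by move: x y => [x| |] [y| |]//= _ _; rewrite ?oppr0// opprB.
Qed.

Lemma periodizationN h x : periodization (fun z => - h z) x = - periodization h x.
Proof.
rewrite /periodization -periodization_fin_opp; last 2 first.
- by apply: esum_ge0 => n _; exact: funepos_ge0.
- by apply: esum_ge0 => n _; exact: funeneg_ge0.
by congr (fine (_ - _)); apply: eq_esum => n _; rewrite !funeposE !funenegE /= ?oppeK// opprK.
Qed.

Lemma periodizationZ (c : R) h x :
  periodization (fun z => c * h z) x = c * periodization h x.
Proof.
have /orP[c0|c0] := le_total 0 c; first exact: periodization_ge0Z.
have -> : (fun z => c * h z) = (fun z => - ((- c) * h z)).
  by apply/funext => z; rewrite mulNr opprK.
by rewrite periodizationN periodization_ge0Z ?oppr_ge0// mulNr opprK.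
Qed.

Lemma measurable_periodization h : measurable_fun [set: R] h ->
  measurable_fun [set: R] (periodization h).
Proof.
move=> mh; apply: (measurableT_comp (fine_measurable measurableT)).
have mhn (n : int) : measurable_fun [set: R] (fun x => (h (x + n%:~R))%:E).
  apply/measurable_EFinP; apply: (measurableT_comp mh).
  exact: measurable_funD.
apply: emeasurable_funB; apply: esum_int_measurable => n.
- rewrite (_ : (fun _ => _) = (fun x => (h (x + n%:~R))%:E)^\+)%E.
    exact: measurable_funepos.
  by apply/funext => x; rewrite !funeposE.
- by move=> x; exact: funepos_ge0.
- rewrite (_ : (fun _ => _) = (fun x => (h (x + n%:~R))%:E)^\-)%E.
    exact: measurable_funeneg.
  by apply/funext => x; rewrite !funenegE.
- by move=> x; exact: funeneg_ge0.
Qed.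

(** Positive and negative parts unfold separately. Their periodizations are integrable, hence finite
    almost everywhere, and at such points [fine] loses nothing. *)
Lemma integral_periodization G : mu.-integrable setT (EFin \o G) ->
  \int[mu]_x G x = \int[muT]_x periodization G x.
Proof.
move=> iG; have mG := measurable_int _ iG.
pose P (x : R) : \bar R := (\esum_(n in [set: int]) (EFin \o G)^\+ (x + n%:~R)%R)%E.
pose N (x : R) : \bar R := (\esum_(n in [set: int]) (EFin \o G)^\- (x + n%:~R)%R)%E.
have P0 x : (0 <= P x)%E by apply: esum_ge0 => n _; exact: funepos_ge0.
have N0 x : (0 <= N x)%E by apply: esum_ge0 => n _; exact: funeneg_ge0.
have mp : measurable_fun [set: R] (EFin \o G)^\+%E by exact: measurable_funepos.
have mn : measurable_fun [set: R] (EFin \o G)^\-%E by exact: measurable_funeneg.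
have mP : measurable_fun [set: R] P.
  apply: esum_int_measurable => n; last by move=> x; exact: funepos_ge0.
  by apply: (measurableT_comp mp); exact: measurable_funD.
have mN : measurable_fun [set: R] N.
  apply: esum_int_measurable => n; last by move=> x; exact: funeneg_ge0.
  by apply: (measurableT_comp mn); exact: measurable_funD.
have EP : (\int[mu]_x (EFin \o G)^\+ x = \int[muT]_x P x)%E.
  by rewrite integral_unfold.
have EN : (\int[mu]_x (EFin \o G)^\- x = \int[muT]_x N x)%E.
  by rewrite integral_unfold.
have iP : muT.-integrable setT P.
  apply/integrableP; split => //; under eq_integral do rewrite gee0_abs//.
  by rewrite -EP; exact: integral_funepos_lt_pinfty.
have iN : muT.-integrable setT N.
  apply/integrableP; split => //; under eq_integral do rewrite gee0_abs//.
  by rewrite -EN; exact: integral_funeneg_lt_pinfty.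
rewrite /Rintegral integralE EP EN -integralB//; congr fine.
apply: ae_eq_integral => //.
- exact: emeasurable_funB.
- by apply/measurable_EFinP; apply: measurable_periodization; exact/measurable_EFinP.
have := integrable_ae measurableT iP; have := integrable_ae measurableT iN.
apply: ae_imp2 => x /(_ I) f1 /(_ I) f2 _ /=.
by rewrite /periodization fineK// fin_numB f1 f2.
Qed.

End periodization_theory.

(** * Convolution with a periodized kernel *)

Section convolution.
Context {R : realType}.
Local Notation mu := (@lebesgue_measure R).
Implicit Types h u v w G : R -> R.

Lemma measurable_reflect (g : R -> R) (x : R) : measurable_fun [set: R] g ->
  measurable_fun [set: R] (fun z => g (x - z)).
Proof. by move=> mg; apply: (measurableT_comp mg); exact: measurable_funB. Qed.

Lemma integral_reflect (x : R) (f : R -> \bar R) : measurable_fun [set: R] f ->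
  (\int[mu]_y f (x - y)%R = \int[mu]_y f y)%E.
Proof.
move=> mf; rewrite -(integral_shift x mf).
rewrite -[RHS]integral_reflect0; first by apply: eq_integral => y _; rewrite addrC.
by apply: (measurableT_comp mf); exact: measurable_funD.
Qed.

Lemma integrable_reflect (x : R) (f : R -> R) :
  mu.-integrable setT (EFin \o f) ->
  mu.-integrable setT (EFin \o (fun y => f (x - y))).
Proof.
move=> /integrableP[/measurable_EFinP mf f_oo]; apply/integrableP; split.
  by apply/measurable_EFinP; exact: measurable_reflect.
rewrite (integral_reflect x (f := fun y => `|(f y)%:E|%E))//.
by apply: measurableT_comp => //; exact/measurable_EFinP.
Qed.

Lemma measurable_Rintegral_muT (F : R -> R -> R) :
  measurable_fun [set: measurableTypeR R * measurableTypeR R]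
    (fun p => F p.1 p.2) ->
  measurable_fun [set: R] (fun x => \int[muT]_y F x y).
Proof.
move=> mF; apply: (measurableT_comp (fine_measurable measurableT)).
under eq_fun do rewrite integralE.
have mE : measurable_fun [set: measurableTypeR R * measurableTypeR R]
    (fun p => (F p.1 p.2)%:E) by exact/measurable_EFinP.
apply: emeasurable_funB.
- apply: (@measurable_integral_muT R (fun x y => (EFin \o F x)^\+%E y)).
    rewrite (_ : (fun _ => _) = (fun p : measurableTypeR R * measurableTypeR R => (F p.1 p.2)%:E)^\+%E).
      exact: measurable_funepos.
    by apply/funext => p; rewrite !funeposE.
  by move=> x y; exact: funepos_ge0.
- apply: (@measurable_integral_muT R (fun x y => (EFin \o F x)^\-%E y)).
    rewrite (_ : (fun _ => _) = (fun p : measurableTypeR R * measurableTypeR R => (F p.1 p.2)%:E)^\-%E).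
      exact: measurable_funeneg.
    by apply/funext => p; rewrite !funenegE.
  by move=> x y; exact: funeneg_ge0.
Qed.

(** For [h] equal to z |-> eps^-2 eta(z/eps) this unfolds to [D_eps eta eps u x]. *)
Definition convT h u x : R := \int[muT]_y (periodization h (x - y) * u y).

Lemma convT_periodic h u x : convT h u (x + 1) = convT h u x.
Proof.
apply: eq_Rintegral => y _; congr (_ * _).
by rewrite addrAC periodization_periodic.
Qed.

Lemma convT_measurable h u : measurable_fun [set: R] h ->
  measurable_fun [set: R] u -> measurable_fun [set: R] (convT h u).
Proof.
move=> mh mu_; apply: measurable_Rintegral_muT.
apply: measurable_funM; last exact: (measurableT_comp mu_ measurable_snd).
apply: (measurableT_comp (measurable_periodization mh)).
exact: measurable_funB.
Qed.

Definition conv_integrable h u x : Prop :=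
  mu.-integrable setT (EFin \o (fun z => h z * u (x - z))).

(** As [u] is periodic, [u y] can be carried into the sum over translates of [y], which makes the
    integrand the periodization of y |-> h (x - y) u y; unfolding and a reflection give an integral
    over the line. *)
Lemma convTE h u x : (forall y, u (y + 1) = u y) -> conv_integrable h u x ->
  convT h u x = \int[mu]_z (h z * u (x - z)).
Proof.
move=> pu H; have H' := integrable_reflect x H.
transitivity (\int[mu]_y (h (x - y) * u (x - (x - y)))).
  rewrite integral_periodization//; apply: eq_Rintegral => y _.
  rewrite -periodization_refl mulrC -periodizationZ.
  apply: periodization_ext => n; rewrite mulrC; congr (_ * _).
  by rewrite subKr (periodic_int n y pu).
congr fine; apply: (integral_reflect x (f := fun z => (h z * u (x - z))%:E)).
exact: (measurable_int _ H).
Qed.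

Lemma int_muT_sqr_fin u : L2T u -> (\int[muT]_x (u x ^+ 2)%:E < +oo)%E.
Proof. by move=> Lu; rewrite -l2_sqr// ltry. Qed.

Lemma ae_fin_of_sqr (F : R -> \bar R) : measurable_fun [set: R] F ->
  (forall x, 0 <= F x)%E -> (\int[muT]_x (F x ^+ 2) < +oo)%E ->
  {ae muT, forall x, (F x < +oo)%E}.
Proof.
move=> mF F0 Foo.
have : muT.-integrable setT (fun x => F x ^+ 2)%E.
  apply/integrableP; split; first exact: emeasurable_funM.
  under eq_integral => x _ do rewrite gee0_abs ?expe2 ?mule_ge0//.
  exact: Foo.
move=> /(integrable_ae measurableT); apply: ae_imp => x /(_ I) Hx.
by rewrite ltey; apply: contraTneq Hx => ->; rewrite ?expe2 ?mulyy.
Qed.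

Section dominated.
Variables (w v : R -> R) (W : R).
Hypothesis mw : measurable_fun [set: R] w.
Hypothesis w0 : forall z, 0 <= w z.
Hypothesis wW : (\int[mu]_z (w z)%:E = W%:E)%E.
Hypothesis Lv : L2T v.

Let F x := (\int[mu]_z (w z * `|v (x - z)|)%:E)%E.

Let mF : measurable_fun [set: R] F.
Proof.
apply: measurable_integral_snd; last first.
  by move=> x z; rewrite lee_fin mulr_ge0.
apply/measurable_EFinP.
apply: (@measurable_conv_integrand R w (fun x => `|v x|)) => //.
by apply: (measurableT_comp (@normr_measurable R setT)); exact: L2T_measurable.
Qed.

Let F0 x : (0 <= F x)%E.
Proof. by apply: integral_ge0 => z _; rewrite lee_fin mulr_ge0. Qed.

Lemma conv_mass_ge0 : 0 <= W.
Proof. by rewrite -lee_fin -wW; apply: integral_ge0 => z _; rewrite lee_fin. Qed.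

Lemma young_l2 : (\int[muT]_x (F x ^+ 2) <= ((W * l2 v) ^+ 2)%:E)%E.
Proof.
have := young_L2 mw w0 (L2T_periodic Lv) (L2T_measurable Lv).
by rewrite -l2_sqr// wW -EFin_expe -EFinM -exprMn.
Qed.

Lemma young_fin : {ae muT, forall x, (\int[mu]_z (w z * `|v (x - z)|)%:E < +oo)%E}.
Proof. by apply: ae_fin_of_sqr => //; apply: le_lt_trans young_l2 _; rewrite ltry. Qed.

(** Young's inequality in the form used twice: with [w] the absolute value of the kernel, to bound
    the convolution, and with [v] the second derivative, to bound the consistency error. *)
Lemma dominated_L2 (f : R -> R) : (forall x, f (x + 1) = f x) ->
  measurable_fun [set: R] f ->
  {ae muT, forall x, (`|f x|%:E <= \int[mu]_z (w z * `|v (x - z)|)%:E)%E} ->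
  L2T f /\ l2 f <= W * l2 v.
Proof.
move=> pf mf fF.
have H : (\int[muT]_x (f x ^+ 2)%:E <= ((W * l2 v) ^+ 2)%:E)%E.
  apply: le_trans young_l2; apply: ae_ge0_le_integral => //.
  - by move=> x _; rewrite lee_fin sqr_ge0.
  - exact: measurable_sqr_EFin.
  - by move=> x _; rewrite expe2 mule_ge0.
  - exact: emeasurable_funM.
  - apply: ae_imp fF => x fx _.
    rewrite (_ : (f x ^+ 2)%:E = (`|f x|%:E ^+ 2)%E); first by rewrite lee_sqr.
    by rewrite expe2 -EFinM -expr2 real_normK ?num_real.
have L : L2T f by apply: L2T_intro => //; apply: le_lt_trans H _; rewrite ltry.
by split => //; apply: l2_le => //; rewrite mulr_ge0 ?conv_mass_ge0 ?l2_ge0.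
Qed.

End dominated.

Section kernel.
Variables (h : R -> R) (W : R).
Hypothesis mh : measurable_fun [set: R] h.
Hypothesis hW : (\int[mu]_z (`|h z|)%:E = W%:E)%E.

Let mah : measurable_fun [set: R] (fun z => `|h z|).
Proof. exact: measurableT_comp. Qed.

Lemma ae_conv_integrable u : L2T u -> {ae muT, forall x, conv_integrable h u x}.
Proof.
move=> Lu; have mu_ := L2T_measurable Lu.
have := young_fin mah (fun z => normr_ge0 (h z)) hW Lu.
apply: ae_imp => x Hx; apply/integrableP; split.
  by apply/measurable_EFinP; apply: measurable_funM => //; exact: measurable_reflect.
by under eq_integral => z _ do rewrite /= normrM.
Qed.

Lemma convT_L2 u : L2T u -> L2T (convT h u) /\ l2 (convT h u) <= W * l2 u.
Proof.
move=> Lu; have mu_ := L2T_measurable Lu.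
apply: (dominated_L2 mah (fun z => normr_ge0 (h z)) hW Lu).
- exact: convT_periodic.
- exact: convT_measurable.
apply: ae_imp (ae_conv_integrable Lu) => x Hx.
rewrite convTE//; last exact: L2T_periodic.
have := le_normr_Rintegral measurableT Hx; rewrite -lee_fin => /le_trans; apply.
rewrite /Rintegral fineK.
  by under eq_integral do rewrite normrM.
by have := integrable_fin_num measurableT (integrable_norm Hx).
Qed.

(** Splitting the integral requires both convolution integrands to be integrable, which Young's
    inequality grants for almost every [x]. *)
Lemma convT_lin (a : R) u v : L2T u -> L2T v ->
  convT h (a *: u + v) = a *: convT h u + convT h v %[ae muT].
Proof.
move=> Lu Lv; have Lw := L2T_lin a Lu Lv.
apply: ae_imp2 (ae_conv_integrable Lu) (ae_conv_integrable Lv) => x Hu Hv _.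
have Hau : mu.-integrable setT (EFin \o (fun z => a * (h z * u (x - z)))).
  by have := integrableZl measurableT a Hu.
have HD : conv_integrable h (a *: u + v) x.
  have := integrableD measurableT Hau Hv; apply: eq_integrable => // z _ /=.
  by rewrite -EFinD !fctE; congr EFin; rewrite mulrDr mulrCA.
rewrite convTE//; last exact: L2T_periodic.
have := convTE (L2T_periodic Lu) Hu; have := convTE (L2T_periodic Lv) Hv.
rewrite !fctE => -> ->; rewrite -[a *: _]/(a * _) -RintegralZl// -RintegralD//.
by apply: eq_Rintegral => z _; rewrite mulrDr [in RHS]mulrCA.
Qed.

End kernel.
End convolution.

(** * Dissipativity of the nonlocal transport operator *)

Section L2_inner.
Context {R : realType}.
Implicit Types u v f b : R -> R.

Lemma L2T_mul_integrable u v : L2T u -> L2T v ->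
  muT.-integrable setT (EFin \o (fun x => u x * v x)).
Proof.
by move=> [_ Lu] [_ Lv]; apply/Lfun1_integrable; exact: Lfun2_mul_Lfun1.
Qed.

Lemma L2T_sqr_integrable u : L2T u ->
  muT.-integrable setT (EFin \o (fun x => u x ^+ 2)).
Proof. by move=> [_ Lu]; exact: Lfun2_integrable_sqr. Qed.

Lemma l2_sqrE u : L2T u -> l2 u ^+ 2 = \int[muT]_x (u x ^+ 2).
Proof. by move=> Lu; rewrite /Rintegral -l2_sqr. Qed.

Lemma l2_addZ_sqr (t : R) u v : L2T u -> L2T v ->
  l2 (u + t *: v) ^+ 2 =
  l2 u ^+ 2 + 2 * t * \int[muT]_x (u x * v x) + t ^+ 2 * l2 v ^+ 2.
Proof.
move=> Lu Lv; have Lw : L2T (u + t *: v) by apply: L2TD => //; exact: L2TZ.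
rewrite !l2_sqrE//.
have i1 := L2T_sqr_integrable Lu; have i2 := L2T_sqr_integrable Lv.
have i3 := L2T_mul_integrable Lu Lv.
have i2' : muT.-integrable setT (EFin \o (fun x => t ^+ 2 * v x ^+ 2)).
  by have := integrableZl measurableT (t ^+ 2) i2.
have i3' : muT.-integrable setT (EFin \o (fun x => 2 * t * (u x * v x))).
  by have := integrableZl measurableT (2 * t) i3.
have i13 : muT.-integrable setT (EFin \o (fun x => u x ^+ 2 + 2 * t * (u x * v x))).
  by have := integrableD measurableT i1 i3'.
rewrite -!RintegralZl// -!RintegralD//.
by apply: eq_Rintegral => x _; rewrite !fctE -[t *: _]/(t * _); ring.
Qed.

Lemma L2T_bounded_mul (c : R) b f : (forall x, b (x + 1) = b x) ->
  measurable_fun [set: R] b -> 0 <= c -> {ae muT, forall x, `|b x| <= c} ->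
  L2T f -> L2T (fun x => b x * f x) /\ l2 (fun x => b x * f x) <= c * l2 f.
Proof.
move=> pb mb c0 bc Lf; have mf := L2T_measurable Lf.
have mbf : measurable_fun [set: R] (fun x => b x * f x) by exact: measurable_funM.
have H : (\int[muT]_x ((b x * f x) ^+ 2)%:E <= ((c * l2 f) ^+ 2)%:E)%E.
  rewrite exprMn [leRHS]EFinM l2_sqr// -ge0_integralZl//.
  - apply: ae_ge0_le_integral => //.
    + by move=> x _; rewrite lee_fin sqr_ge0.
    + exact: measurable_sqr_EFin.
    + by move=> x _; rewrite mule_ge0// lee_fin sqr_ge0.
    + by apply: measurable_funeM; exact: measurable_sqr_EFin.
    + apply: ae_imp bc => x bx _; rewrite -EFinM lee_fin exprMn.
      apply: ler_wpM2r; first exact: sqr_ge0.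
      by rewrite -[leLHS]real_normK ?num_real// ler_sqr.
  - exact: measurable_sqr_EFin.
  - by move=> x _; rewrite lee_fin sqr_ge0.
  - by rewrite lee_fin sqr_ge0.
have L : L2T (fun x => b x * f x).
  apply: L2T_intro => //; last by apply: le_lt_trans H _; rewrite ltry.
  by move=> x /=; rewrite pb (L2T_periodic Lf).
by split => //; apply: l2_le => //; rewrite mulr_ge0// l2_ge0.
Qed.

(** The arithmetic-geometric inequality |pq| <= (p^2 + q^2)/2, after which translation invariance
    makes the two squares equal. *)
Lemma int_mul_shift_le u (z : R) : L2T u ->
  (\int[muT]_x (`|u x * u (x - z)|)%:E <= (l2 u ^+ 2)%:E)%E.
Proof.
move=> Lu; have mu_ := L2T_measurable Lu; have pu := L2T_periodic Lu.
have muz : measurable_fun [set: R] (fun x => u (x - z)).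
  by apply: (measurableT_comp mu_); exact: measurable_funB.
have msq : measurable_fun [set: R] (fun x => (u x ^+ 2)%:E) by exact: measurable_sqr_EFin.
have msqz : measurable_fun [set: R] (fun x => (u (x - z) ^+ 2)%:E) by exact: measurable_sqr_EFin.
apply: (@le_trans _ _ (\int[muT]_x ((2^-1)%:E * ((u x ^+ 2)%:E + (u (x - z) ^+ 2)%:E)))%E).
  apply: ge0_le_integral => //.
  - apply/measurable_EFinP; apply: (measurableT_comp (@normr_measurable R setT)).
    exact: measurable_funM.
  - by apply: measurable_funeM; exact: emeasurable_funD.
  - move=> x _; rewrite -EFinD -EFinM lee_fin normrM.
    rewrite -(real_normK (num_real (u x))) -(real_normK (num_real (u (x - z)))).
    have := sqr_ge0 (`|u x| - `|u (x - z)|); lra.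
rewrite ge0_integralZl//.
- rewrite ge0_integralD//.
  + rewrite (@ge0_integral_muT_shift R (- z) (fun x => (u x ^+ 2)%:E))//.
    * by rewrite -l2_sqr// -EFinD -EFinM lee_fin; lra.
    * by move=> y; rewrite pu.
    * by move=> x; rewrite lee_fin sqr_ge0.
  + by move=> x _; rewrite lee_fin sqr_ge0.
  + by move=> x _; rewrite lee_fin sqr_ge0.
- exact: emeasurable_funD.
- by move=> x _; rewrite adde_ge0// lee_fin sqr_ge0.
Qed.

End L2_inner.

Section transport_operator.
Context {R : realType}.
Local Notation mu := (@lebesgue_measure R).
(** [b0] is a Lipschitz function equal to [b] almost everywhere: [b] itself is only a
    representative. [beta] and [L] bound [b] and the Lipschitz constant, [W] and [M1] are the
    absolute moments of [h] of orders 0 and 1. *)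
Variables (b b0 h : R -> R) (beta L W M1 : R).
Hypothesis pb : forall x, b (x + 1) = b x.
Hypothesis mb : measurable_fun [set: R] b.
Hypothesis beta0 : 0 <= beta.
Hypothesis bbeta : {ae muT, forall x, `|b x| <= beta}.
Hypothesis L0 : 0 <= L.
Hypothesis b0_lip : forall x y, `|b0 x - b0 y| <= L * `|x - y|.
Hypothesis bb0 : {ae mu, forall x, b x = b0 x}.
Hypothesis mh : measurable_fun [set: R] h.
Hypothesis hW : (\int[mu]_z (`|h z|)%:E = W%:E)%E.
Hypothesis hodd : {ae mu, forall z, h (- z) = - h z}.
Hypothesis hM1 : (\int[mu]_z (`|h z| * `|z|)%:E = M1%:E)%E.

Definition transport_op (u : R -> R) : R -> R := fun x => - b x * convT h u x.

Lemma transport_op_L2 u : L2T u ->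
  L2T (transport_op u) /\ l2 (transport_op u) <= beta * W * l2 u.
Proof.
move=> Lu; have [Lc cW] := convT_L2 mh hW Lu.
have [H1 H2] : L2T (transport_op u) /\ l2 (transport_op u) <= beta * l2 (convT h u).
  apply: (@L2T_bounded_mul R beta (fun x => - b x)) => //.
  - by move=> x; rewrite pb.
  - exact: measurableT_comp.
  - by apply: ae_imp bbeta => x; rewrite normrN.
by split => //; apply: le_trans H2 _; rewrite -mulrA; exact: ler_wpM2l.
Qed.

Lemma transport_op_lin (a : R) u v : L2T u -> L2T v ->
  transport_op (a *: u + v) = a *: transport_op u + transport_op v %[ae muT].
Proof.
move=> Lu Lv; have := convT_lin mh hW a Lu Lv.
apply: ae_imp => x /(_ I); rewrite /transport_op !fctE => -> _.
by rewrite -![a *: _]/(a * _); ring.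
Qed.

Section energy.
Variable u : R -> R.
Hypothesis Lu : L2T u.
Let mu_ : measurable_fun [set: R] u := L2T_measurable Lu.
Let pu := L2T_periodic Lu.

(** The correlation at lag z of [b u] with [u]; the energy is its integral against [h]. *)
Let J z := \int[muT]_x (b x * u x * u (x - z)).

Let Jint z : muT.-integrable setT (EFin \o (fun x => b x * u x * u (x - z))).
Proof.
have [Lbu _] := L2T_bounded_mul pb mb beta0 bbeta Lu.
apply: (L2T_mul_integrable Lbu (v := fun x => u (x - z))).
apply: L2T_intro.
- by move=> x; rewrite addrAC pu.
- by apply: (measurableT_comp mu_); exact: measurable_funB.
- rewrite (@ge0_integral_muT_shift R (- z) (fun x => (u x ^+ 2)%:E))//.
  + exact: int_muT_sqr_fin.
  + by move=> y; rewrite pu.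
  + exact: measurable_sqr_EFin.
  + by move=> x; rewrite lee_fin sqr_ge0.
Qed.

Let Jabs z : (\int[muT]_x (`|b x * u x * u (x - z)|)%:E <= (beta * l2 u ^+ 2)%:E)%E.
Proof.
have muz : measurable_fun [set: R] (fun x => `|u x * u (x - z)|).
  apply: (measurableT_comp (@normr_measurable R setT)); apply: measurable_funM => //.
  by apply: (measurableT_comp mu_); exact: measurable_funB.
apply: (@le_trans _ _ (\int[muT]_x (beta%:E * (`|u x * u (x - z)|)%:E))%E).
  apply: ae_ge0_le_integral => //.
  - apply/measurable_EFinP; apply: (measurableT_comp (@normr_measurable R setT)).
    by have /measurable_EFinP := measurable_int _ (Jint z).
  - by move=> x _; rewrite mule_ge0// lee_fin.
  - by apply: measurable_funeM; exact/measurable_EFinP.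
  - apply: ae_imp bbeta => x bx _; rewrite -EFinM lee_fin -mulrA normrM.
    exact: ler_wpM2r.
rewrite ge0_integralZl//; last exact/measurable_EFinP.
rewrite EFinM; apply: lee_wpmul2l; first by rewrite lee_fin.
exact: int_mul_shift_le.
Qed.

Let Jbnd z : `|J z| <= beta * l2 u ^+ 2.
Proof.
have := le_normr_Rintegral measurableT (Jint z) => /le_trans; apply.
rewrite -lee_fin /Rintegral fineK; first exact: Jabs.
by have := integrable_fin_num measurableT (integrable_norm (Jint z)).
Qed.

Let mF : measurable_fun [set: measurableTypeR R * measurableTypeR R]
  (fun p => b p.1 * u p.1 * (h p.2 * u (p.1 - p.2))).
Proof.
apply: measurable_funM.
  by apply: measurable_funM; apply: measurableT_comp.
exact: measurable_conv_integrand.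
Qed.

Let mJ : measurable_fun [set: R] J.
Proof.
apply: measurable_Rintegral_muT.
apply: measurable_funM.
  by apply: measurable_funM; [apply: (measurableT_comp mb)|apply: (measurableT_comp mu_)];
    exact: measurable_snd.
by apply: (measurableT_comp mu_); exact: measurable_funB.
Qed.

(** The double integral of absolute values is at most W beta |u|^2, so Fubini applies; for almost
    every [x] the integral over the line is the convolution, by [convTE]. *)
Let energy_fubini :
  \int[muT]_x (b x * u x * convT h u x) = \int[mu]_z (h z * J z).
Proof.
pose f (x z : R) := b x * u x * (h z * u (x - z)).
have fin : (\int[muT]_x \int[mu]_z `|(f x z)%:E| < +oo)%E.
  rewrite (_ : (\int[muT]_x \int[mu]_z `|(f x z)%:E| =
                \int[mu]_z \int[muT]_x `|(f x z)%:E|)%E); last first.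
    apply: (@tonelliT R (fun x z => `|(f x z)%:E|%E)) => //.
    by apply: measurableT_comp => //; exact/measurable_EFinP.
  apply: (@le_lt_trans _ _ (\int[mu]_z ((`|h z|)%:E * (beta * l2 u ^+ 2)%:E))%E).
    apply: ge0_le_integral => //.
    - by move=> z _; apply: integral_ge0.
    - apply: (@measurable_integral_muT R (fun z x => `|(f x z)%:E|%E)) => //.
      apply: measurableT_comp => //; apply/measurable_EFinP.
      apply: measurable_funM.
        by apply: measurable_funM; [exact: (measurableT_comp mb measurable_snd)
          |exact: (measurableT_comp mu_ measurable_snd)].
      apply: measurable_funM; first exact: (measurableT_comp mh measurable_fst).
      by apply: (measurableT_comp mu_); exact: measurable_funB.
    - apply: emeasurable_funM => //; apply/measurable_EFinP.
      exact: measurableT_comp.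
    - move=> z _.
      rewrite (_ : (fun x => _) = (fun x => (`|h z|)%:E * (`|b x * u x * u (x - z)|)%:E)%E).
        rewrite ge0_integralZl//.
          by apply: lee_wpmul2l; rewrite ?lee_fin//; exact: Jabs.
        apply/measurable_EFinP; apply: (measurableT_comp (@normr_measurable R setT)).
        by have /measurable_EFinP := measurable_int _ (Jint z).
      by apply/funext => x; rewrite abse_EFin -EFinM -normrM /f mulrCA.
  rewrite ge0_integralZr//.
  - by rewrite hW -EFinM ltry.
  - apply/measurable_EFinP; exact: measurableT_comp.
  - by rewrite lee_fin mulr_ge0// sqr_ge0.
have ifub : (circ \x mu)%E.-integrable setT
    (fun p : measurableTypeR R * measurableTypeR R => (f p.1 p.2)%:E).
  apply/integrable12ltyP; first exact/measurable_EFinP.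
  exact: fin.
have /(congr1 fine) := Fubini ifub.
rewrite /Rintegral => H; transitivity (fine (\int[circ]_x \int[mu]_y (f x y)%:E)%E).
  congr fine; apply: ae_eq_integral => //.
  - apply/measurable_EFinP; apply: measurable_funM; first exact: measurable_funM.
    exact: convT_measurable.
  - exact: (measurable_fubini_F ifub).
  apply: ae_imp (ae_conv_integrable mh hW Lu) => x Hx _.
  rewrite convTE// /f.
  under [RHS]eq_integral do rewrite EFinM.
  rewrite integralZl// EFinM /Rintegral fineK//.
  exact: integrable_fin_num.
rewrite H; congr fine; apply: eq_integral => z _.
rewrite /J /f (_ : (fun x => _) = (fun x => (h z)%:E * (b x * u x * u (x - z))%:E)%E).
  rewrite integralZl//; last exact: Jint.
  by rewrite EFinM /Rintegral fineK//; exact: integrable_fin_num (Jint z).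
by apply/funext => x; rewrite -EFinM mulrCA.
Qed.

(** A translation by [z] moves the shift onto [b u], so that J z and J (- z) differ only through the
    point at which [b] is evaluated. *)
Let JN z : J (- z) = \int[muT]_x (b (x - z) * u (x - z) * u x).
Proof.
rewrite /J /Rintegral; congr fine.
rewrite -(@integral_muT_shift R (- z) (fun x => (b x * u x * u (x - - z))%:E)).
- by apply: eq_integral => x _; rewrite opprK subrK.
- by move=> y; rewrite pb pu -addrA [1 + _]addrC addrA pu.
- by have := measurable_int _ (Jint (- z)).
Qed.

(** The integrand is (b x - b (x - z)) u x u (x - z). For fixed [z], [b] agrees with [b0] at both
    [x] and [x - z] for almost every [x], so the Lipschitz bound gives the factor L |z|. *)
Let Jdiff z : `|J z - J (- z)| <= L * `|z| * l2 u ^+ 2.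
Proof.
have iN : muT.-integrable setT (EFin \o (fun x => b (x - z) * u (x - z) * u x)).
  have [Lbu _] := L2T_bounded_mul pb mb beta0 bbeta Lu.
  apply: (L2T_mul_integrable (u := fun x => b (x - z) * u (x - z))) => //.
  apply: L2T_intro.
  - by move=> x; rewrite addrAC pu pb.
  - by apply: (measurableT_comp (L2T_measurable Lbu)); exact: measurable_funB.
  - rewrite (@ge0_integral_muT_shift R (- z) (fun x => ((b x * u x) ^+ 2)%:E))//.
    + exact: int_muT_sqr_fin Lbu.
    + by move=> y; rewrite pu pb.
    + by apply: measurable_sqr_EFin; exact: L2T_measurable.
    + by move=> x; rewrite lee_fin sqr_ge0.
rewrite JN /J -RintegralB//.
have iD : muT.-integrable setT (EFin \o (fun x =>
    b x * u x * u (x - z) - b (x - z) * u (x - z) * u x)).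
  exact: (integrableB measurableT (Jint z) iN).
have muz : measurable_fun [set: R] (fun x => `|u x * u (x - z)|).
  apply: (measurableT_comp (@normr_measurable R setT)); apply: measurable_funM => //.
  by apply: (measurableT_comp mu_); exact: measurable_funB.
have := le_normr_Rintegral measurableT iD.
move=> /le_trans; apply.
rewrite -lee_fin /Rintegral fineK; last first.
  by have := integrable_fin_num measurableT (integrable_norm iD).
apply: (@le_trans _ _ (\int[muT]_x ((L * `|z|)%:E * (`|u x * u (x - z)|)%:E))%E).
  apply: ae_ge0_le_integral => //.
  - have /measurable_EFinP mD := measurable_int _ iD.
    by apply/measurable_EFinP; apply: (measurableT_comp (@normr_measurable R setT) mD).
  - by move=> x _; rewrite mule_ge0// lee_fin mulr_ge0.
  - by apply: measurable_funeM; exact/measurable_EFinP.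
  - have bz : {ae mu, forall x, b (x - z) = b0 (x - z)} by exact: (ae_shift (- z) bb0).
    have : {ae mu, forall x, `|b x - b (x - z)| <= L * `|z|}.
      apply: ae_imp2 bb0 bz => x -> ->.
      by have := b0_lip x (x - z); rewrite subKr.
    move=> H; have : {ae muT, forall x, `|b x - b (x - z)| <= L * `|z|}.
      by apply/ae_muT; apply: ae_imp H.
    apply: ae_imp => x Hx _; rewrite -EFinM lee_fin.
    rewrite (_ : _ - _ = (b x - b (x - z)) * (u x * u (x - z))); last by ring.
    by rewrite normrM; exact: ler_wpM2r.
rewrite ge0_integralZl//.
- rewrite [leRHS]EFinM; apply: lee_wpmul2l; last exact: int_mul_shift_le.
  by rewrite lee_fin mulr_ge0.
- exact/measurable_EFinP.
- by rewrite lee_fin mulr_ge0.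
Qed.

(* As [h] is odd, the energy is half the integral of [h z * (J z - J (- z))],
   and a translation of the circle turns [J z - J (- z)] into the integral of
   [(b x - b (x - z)) * u x * u (x - z)], where [b] is Lipschitz. *)
Lemma energy_bound :
  `|\int[muT]_x (b x * u x * convT h u x)| <= 2^-1 * L * M1 * l2 u ^+ 2.
Proof.
rewrite energy_fubini.
have mah : measurable_fun [set: R] (fun z => `|h z|).
  exact: measurableT_comp.
have ih : mu.-integrable setT (EFin \o h).
  apply/integrableP; split; first exact/measurable_EFinP.
  by rewrite (_ : (\int[mu]_x _ = W%:E)%E) ?ltry.
have mJN : measurable_fun [set: R] (fun z => J (- z)).
  by apply: (measurableT_comp mJ); exact: (@oppr_measurable R setT).
have ihJ : mu.-integrable setT (EFin \o (fun z => h z * J z)).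
  have := @integrableMl _ _ _ mu setT measurableT _ J ih mJ.
  apply; exists (beta * l2 u ^+ 2); split; first exact: num_real.
  by move=> M hM z _; apply: le_trans (Jbnd z) (ltW hM).
have ihJN : mu.-integrable setT (EFin \o (fun z => h z * J (- z))).
  have := @integrableMl _ _ _ mu setT measurableT _ _ ih mJN.
  apply; exists (beta * l2 u ^+ 2); split; first exact: num_real.
  by move=> M hM z _; apply: le_trans (Jbnd (- z)) (ltW hM).
have E2 : \int[mu]_z (h z * J z) = - \int[mu]_z (h z * J (- z)).
  rewrite -mulN1r -RintegralZl//.
  rewrite /Rintegral -(@integral_reflect0 R (fun z => (h z * J z)%:E)); last first.
    by have := measurable_int _ ihJ.
  congr fine; apply: ae_eq_integral => //.
  - apply/measurable_EFinP; apply: measurable_funM => //.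
    by apply: (measurableT_comp mh); exact: (@oppr_measurable R setT).
  - apply/measurable_EFinP; apply: measurable_funM => //; exact: measurable_funM.
  by apply: ae_imp hodd => z hz _; rewrite hz mulNr mulN1r.
have -> : \int[mu]_z (h z * J z) = 2^-1 * \int[mu]_z (h z * J z - h z * J (- z)).
  rewrite RintegralB//; move: E2; set A := \int[_]_z _; set B := \int[_]_z _; lra.
rewrite normrM ger0_norm// -!mulrA; apply: ler_wpM2l => //.
have iD : mu.-integrable setT (EFin \o (fun z => h z * J z - h z * J (- z))).
  exact: (integrableB measurableT ihJ ihJN).
have := le_normr_Rintegral measurableT iD.
move=> /le_trans; apply.
rewrite -lee_fin /Rintegral fineK; last first.
  by have := integrable_fin_num measurableT (integrable_norm iD).
have mz : measurable_fun [set: R] (fun z => `|h z| * `|z|).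
  apply: measurable_funM => //; exact: (@normr_measurable R setT).
apply: (@le_trans _ _ (\int[mu]_z ((L * l2 u ^+ 2)%:E * (`|h z| * `|z|)%:E))%E).
  apply: ge0_le_integral => //.
  - have /measurable_EFinP mD := measurable_int _ iD.
    by apply/measurable_EFinP; apply: (measurableT_comp (@normr_measurable R setT) mD).
  - by apply: measurable_funeM; exact/measurable_EFinP.
  - move=> z _; rewrite -EFinM lee_fin -mulrBr normrM.
    rewrite (_ : L * _ * _ = `|h z| * (L * `|z| * l2 u ^+ 2)); last by ring.
    by apply: ler_wpM2l => //; exact: Jdiff.
rewrite ge0_integralZl//.
- by rewrite hM1 -EFinM lee_fin mulrAC [X in _ <= X]mulrA.
- exact/measurable_EFinP.
- by rewrite lee_fin mulr_ge0// sqr_ge0.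
Qed.

(** Expansion of the square: the cross term is -2 t times the energy, hence at most 2 t times the
    energy bound, and the last term costs (beta W)^2 t^2. So [K] of the growth estimate is
    [beta * W]. *)
Lemma transport_dissip (t : R) : 0 <= t ->
  l2 (u + t *: transport_op u) ^+ 2 <=
  (1 + 2 * (2^-1 * L * M1) * t + (beta * W) ^+ 2 * t ^+ 2) * l2 u ^+ 2.
Proof.
move=> t0; have [LA AW] := transport_op_L2 Lu.
rewrite l2_addZ_sqr//.
have -> : \int[muT]_x (u x * transport_op u x) =
    - \int[muT]_x (b x * u x * convT h u x).
  rewrite -mulN1r -RintegralZl//.
    by apply: eq_Rintegral => x _; rewrite /transport_op; ring.
  have [Lbu _] := L2T_bounded_mul pb mb beta0 bbeta Lu.
  exact: L2T_mul_integrable Lbu (convT_L2 mh hW Lu).1.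
have := energy_bound; set I := \int[_]_x _; rewrite ler_norml => /andP[I1 I2].
have : l2 (transport_op u) ^+ 2 <= (beta * W * l2 u) ^+ 2.
  by rewrite ler_sqr ?nnegrE ?l2_ge0//; apply: le_trans AW; exact: l2_ge0.
rewrite exprMn => /(ler_wpM2l (sqr_ge0 t)) H.
have H2 : 2 * t * - I <= 2 * t * (2^-1 * L * M1 * l2 u ^+ 2).
  by apply: ler_wpM2l; [rewrite mulr_ge0|lra].
lra.
Qed.

End energy.
End transport_operator.

(** * Test functions *)

Section smooth_bump.
Context {R : realType}.
Variables (a : R) (n : nat).

(* A syntactic algebra, closed under differentiation, that contains the
   approximations of the indicator of ]0, a[ used as test functions. *)
Inductive bump_expr :=
  | BCst of R | BSin0 | BCos0 | BSina | BCosa | BExp | BStep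
  | BAdd of bump_expr & bump_expr | BMul of bump_expr & bump_expr.

(** Positive on ]0, a[ and negative on ]a, 1[. Each sine changes sign under y |-> y + 1, so their
    product is 1-periodic. *)
Definition bump_phase (y : R) : R := sin (pi * y) * sin (pi * (a - y)).

(** [BStep] is the double exponential exp(-exp(-n phi)) of the phase phi: it lies in [0, 1], and as
    n grows it tends to 1 where phi > 0 and to 0 where phi < 0. *)
Fixpoint beval (e : bump_expr) (y : R) : R :=
  match e with
  | BCst c => c
  | BSin0 => sin (pi * y)
  | BCos0 => cos (pi * y)
  | BSina => sin (pi * (a - y))
  | BCosa => cos (pi * (a - y))
  | BExp => expR (- (n%:R * bump_phase y))
  | BStep => expR (- expR (- (n%:R * bump_phase y)))
  | BAdd e1 e2 => beval e1 y + beval e2 y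
  | BMul e1 e2 => beval e1 y * beval e2 y
  end.

Definition bphase' : bump_expr :=
  BMul (BCst pi) (BAdd (BMul BCos0 BSina) (BMul (BCst (-1)) (BMul BSin0 BCosa))).

Fixpoint bder (e : bump_expr) : bump_expr :=
  match e with
  | BCst c => BCst 0
  | BSin0 => BMul (BCst pi) BCos0
  | BCos0 => BMul (BCst (- pi)) BSin0
  | BSina => BMul (BCst (- pi)) BCosa
  | BCosa => BMul (BCst pi) BSina
  | BExp => BMul (BMul (BCst (- n%:R)) bphase') BExp
  | BStep => BMul (BMul (BMul (BCst n%:R) bphase') BExp) BStep
  | BAdd e1 e2 => BAdd (bder e1) (bder e2)
  | BMul e1 e2 => BAdd (BMul (bder e1) e2) (BMul e1 (bder e2))
  end.

Lemma is_derive_affine (c d y : R) : is_derive y (1 : R) (fun t : R => c * t + d) c.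
Proof.
have h1 : is_derive y (1 : R) ((cst c : R -> R) * id + cst d) (c *: 1 + y *: 0 + 0).
  by apply: is_deriveD.
by apply: (is_derive_eq h1); rewrite scaler0 !addr0 /GRing.scale/= mulr1.
Qed.

Lemma is_derive_comp_affine (f : R -> R) (df c d y : R) :
  is_derive (c * y + d) (1 : R) f df ->
  is_derive y (1 : R) (fun t : R => f (c * t + d)) (df * c).
Proof.
move=> h; exact: (is_derive1_comp (g := fun t => c * t + d) h (is_derive_affine c d y)).
Qed.

Lemma beval_derive (e : bump_expr) (y : R) :
  is_derive y (1 : R) (beval e) (beval (bder e) y).
Proof.
have dS0 : is_derive y (1 : R) (beval BSin0) (beval (bder BSin0) y).
  have := @is_derive_comp_affine sin _ pi 0 y (is_derive_sin _).
  rewrite (_ : (fun t => _) = beval BSin0); last by apply/funext => t /=; rewrite addr0.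
  by move=> h; apply: (is_derive_eq h) => /=; rewrite addr0; ring.
have dC0 : is_derive y (1 : R) (beval BCos0) (beval (bder BCos0) y).
  have := @is_derive_comp_affine cos _ pi 0 y (is_derive_cos _).
  rewrite (_ : (fun t => _) = beval BCos0); last by apply/funext => t /=; rewrite addr0.
  by move=> h; apply: (is_derive_eq h) => /=; rewrite addr0; ring.
have pE t : - pi * t + pi * a = pi * (a - t) by ring.
have dSa : is_derive y (1 : R) (beval BSina) (beval (bder BSina) y).
  have := @is_derive_comp_affine sin _ (- pi) (pi * a) y (is_derive_sin _).
  rewrite (_ : (fun t => _) = beval BSina); last by apply/funext => t /=; rewrite pE.
  by move=> h; apply: (is_derive_eq h) => /=; rewrite pE; ring.
have dCa : is_derive y (1 : R) (beval BCosa) (beval (bder BCosa) y).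
  have := @is_derive_comp_affine cos _ (- pi) (pi * a) y (is_derive_cos _).
  rewrite (_ : (fun t => _) = beval BCosa); last by apply/funext => t /=; rewrite pE.
  by move=> h; apply: (is_derive_eq h) => /=; rewrite pE; ring.
have dph : is_derive y (1 : R) bump_phase (beval bphase' y).
  have h := is_deriveM dS0 dSa; apply: (is_derive_eq h).
  by rewrite /= /GRing.scale/=; ring.
have dE : is_derive y (1 : R) (beval BExp) (beval (bder BExp) y).
  have h0 : is_derive y (1 : R) (fun t => - (n%:R * bump_phase t)) (- (n%:R * beval bphase' y)).
    rewrite (_ : (fun t => _) = (- n%:R) *: bump_phase); last first.
      by apply/funext => t; rewrite !fctE /GRing.scale/= mulNr.
    by apply: (is_derive_eq (is_deriveZ _ dph)); rewrite /GRing.scale/= mulNr.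
  have h := is_derive1_comp (is_derive_expR _) h0.
  by apply: (is_derive_eq h) => /=; ring.
have dH : is_derive y (1 : R) (beval BStep) (beval (bder BStep) y).
  have h := is_derive1_comp (is_derive_expR _) (is_deriveN dE).
  by apply: (is_derive_eq h) => /=; ring.
elim: e => //= [c|e1 h1 e2 h2|e1 h1 e2 h2].
- exact: is_derive_cst.
- exact: is_deriveD.
- have h := is_deriveM h1 h2; apply: (is_derive_eq h).
  by rewrite /GRing.scale/=; ring.
Qed.

Lemma beval_derive1n (e : bump_expr) (k : nat) :
  ((beval e)^`(k))%classic = beval (iter k bder e).
Proof.
elim: k => [//|k IH]; rewrite derive1nS IH; apply/funext => y.
by rewrite derive1E; have := beval_derive (iter k bder e) y; case.
Qed.

Lemma bump_phase_periodic (y : R) : bump_phase (y + 1) = bump_phase y.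
Proof.
rewrite /bump_phase mulrDr mulr1 sinDpi.
rewrite [in RHS](_ : pi * (a - y) = pi * (a - (y + 1)) + pi); last by ring.
by rewrite sinDpi mulrN mulNr.
Qed.

Lemma bump_smooth : smoothT (beval BStep).
Proof.
split; first by move=> y /=; rewrite bump_phase_periodic.
move=> k x; rewrite beval_derive1n.
by have := beval_derive (iter k bder BStep) x; case.
Qed.

Lemma bump_bound (y : R) : 0 <= beval BStep y <= 1.
Proof.
by rewrite /= expR_ge0/= -expR0 ler_expR oppr_le0 expR_ge0.
Qed.

End smooth_bump.

Section bump_limit.
Context {R : realType}.

Lemma bump_phase_gt0 (a y : R) : a <= 1 -> 0 < y < a -> 0 < bump_phase a y.
Proof.
move=> a1 /andP[y0 ya]; have p0 := pi_gt0 R.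
by rewrite /bump_phase mulr_gt0// sin_gt0_pi//; apply/andP; split; nra.
Qed.

Lemma bump_phase_lt0 (a y : R) : 0 <= a -> a < y < 1 -> bump_phase a y < 0.
Proof.
move=> a1 /andP[y0 ya]; have p0 := pi_gt0 R.
rewrite /bump_phase pmulr_rlt0 ?sin_gt0_pi//; last by apply/andP; split; nra.
rewrite (_ : pi * (a - y) = - (pi * (y - a))); last by ring.
by rewrite sinN oppr_lt0 sin_gt0_pi//; apply/andP; split; nra.
Qed.

(** The strict sign of the phase sends n phi to plus or minus infinity. At 0 and at [a] the phase
    vanishes and the bump stays at exp(-1), which is why these points are excluded; they form a null
    set. *)
Lemma bump_cvg (a y : R) : 0 < a <= 1 -> 0 < y < 1 -> y != a ->
  beval a n BStep y @[n --> \oo] --> (if y < a then 1 else 0 : R).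
Proof.
move=> /andP[a0 a1] /andP[y0 y1] ya.
have ninf (c : R) : 0 < c -> n%:R * c @[n --> \oo] --> +oo.
  move=> c0; apply/cvgryPge => A; near=> m.
  rewrite -ler_pdivrMr//; near: m; exact: nbhs_infty_ger.
case: (ltgtP y a) ya => // ylta _.
- have k0 : 0 < bump_phase a y by apply: bump_phase_gt0; rewrite ?y0.
  rewrite -[X in _ --> X]expR0; apply: (@continuous_cvg _ _ _ _ _ _ expR).
    exact: continuous_expR.
  rewrite -[X in _ --> X]oppr0; apply: cvgN.
  exact: (@cvg_comp _ _ _ (fun n => n%:R * bump_phase a y) (fun x => expR (- x))
    _ _ _ (ninf _ k0) (@cvgr_expR R)).
- have k0 : 0 < - bump_phase a y by rewrite oppr_gt0 bump_phase_lt0 ?ylta// ltW.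
  have e : expR (- (n%:R * bump_phase a y)) @[n --> \oo] --> +oo.
    apply/cvgryPge => A; near=> m.
    apply: le_trans (expR_ge1Dx _); rewrite -mulrN.
    have : A <= m%:R * - bump_phase a y by near: m; move/cvgryPge : (ninf _ k0); exact.
    by move=> /le_trans; apply; rewrite lerDr.
  exact: (@cvg_comp _ _ _ (fun n => expR (- (n%:R * bump_phase a y)))
    (fun x => expR (- x)) _ _ _ e (@cvgr_expR R)).
Unshelve. all: by end_near. Qed.

End bump_limit.

(** * The fundamental lemma of the calculus of variations on the circle *)

Section vanishing.
Context {R : realType}.
Local Notation mu := (@lebesgue_measure R).
Implicit Types u g w f : R -> R.

Lemma measurable_unit : measurable (`[0%R, 1%R[%classic : set (measurableTypeR R)).
Proof. exact: measurable_itv. Qed.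

Lemma Rintegral_muT f : measurable_fun [set: R] f ->
  \int[muT]_x f x = \int[mu]_(x in `[0, 1[) f x.
Proof. by move=> mf; rewrite /Rintegral integral_muT//; exact/measurable_EFinP. Qed.

Lemma integrable_muT f : measurable_fun [set: R] f ->
  muT.-integrable setT (EFin \o f) <-> mu.-integrable `[0, 1[ (EFin \o f).
Proof.
move=> mf; have maf : measurable_fun [set: R] (fun x => `|(EFin \o f) x|%E).
  by apply: measurableT_comp => //; exact/measurable_EFinP.
split=> /integrableP[_ H]; apply/integrableP; split.
- by apply: measurable_funTS; exact/measurable_EFinP.
- by move: H; rewrite integral_muT.
- exact/measurable_EFinP.
- by rewrite integral_muT.
Qed.

Lemma L1T_integrable u : LpT 1%E u -> muT.-integrable setT (EFin \o u).
Proof. by move=> [_ Lu]; exact/Lfun1_integrable. Qed.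

Lemma L1T_intro u : (forall x, u (x + 1) = u x) ->
  muT.-integrable setT (EFin \o u) -> LpT 1%E u.
Proof. by move=> pu iu; split => //; apply/Lfun1_integrable. Qed.

Lemma ae_neq (a : R) : {ae mu, forall x : R, x != a}.
Proof.
exists [set a]; split; [exact: measurable_set1|exact: lebesgue_measure_set1|].
by move=> x /= /negP; rewrite negbK => /eqP.
Qed.

Lemma smooth_derivable f : smoothT f -> forall x, derivable f x 1.
Proof. by move=> [_ /(_ 0%N)]. Qed.

Lemma smooth_derive f : smoothT f -> smoothT (f^`())%classic.
Proof.
move=> [pf df]; split; last by move=> n x; have := df n.+1 x; rewrite derive1Sn.
move=> x; rewrite !derive1E /derive.
rewrite (_ : (fun h : R => h^-1 *: ((f \o shift (x + 1)) (h *: 1) - f (x + 1))) =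
  (fun h : R => h^-1 *: ((f \o shift x) (h *: 1) - f x)))//.
by apply/funext => h /=; rewrite pf addrA pf.
Qed.

Lemma derivable_continuous_fun f : (forall x, derivable f x 1) -> continuous f.
Proof. by move=> df x; apply/differentiable_continuous/derivable1_diffP. Qed.

Lemma smooth_continuous f : smoothT f -> continuous f.
Proof. by move=> /smooth_derivable; exact: derivable_continuous_fun. Qed.

Lemma smooth_measurable f : smoothT f -> measurable_fun [set: R] f.
Proof. by move=> /smooth_continuous; exact: continuous_measurable_fun. Qed.

Lemma smooth_bounded f : smoothT f -> exists M : R, forall x, `|f x| <= M.
Proof.
move=> sf.
have cf : {within `[0, 1], continuous (fun x => `|f x|)}.
  apply: continuous_subspaceT => x.
  by apply: (@continuous_comp _ _ _ f (fun y : R => `|y|)); [exact: smooth_continuous|exact: norm_continuous].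
have [c _ Hc] := @EVT_max R (fun x => `|f x|) 0 1 ler01 cf.
exists `|f c| => x.
have [n /andP[n1 n2]] := unit_itv_cover x.
have := Hc (x - n%:~R).
rewrite -intrN (periodic_int (- n) x sf.1); apply.
by rewrite in_itv/= intrN; apply/andP; split; lra.
Qed.

Lemma smooth_mul_integrable w f : muT.-integrable setT (EFin \o w) -> smoothT f ->
  muT.-integrable setT (EFin \o (fun x => w x * f x)).
Proof.
move=> iw sf; have [M HM] := smooth_bounded sf.
apply: (@integrableMl _ _ _ muT setT measurableT _ f iw (smooth_measurable sf)).
exists M; split; first exact: num_real.
by move=> M' hM z _; apply: le_trans (HM z) (ltW hM).
Qed.

(** The bumps lie in [0, 1], so |w| dominates the products and their zero integrals pass to the
    limit; on the unit interval the limit function is the indicator of x < a. *)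
Lemma vanish_halfline w (a : R) : 0 < a <= 1 ->
  muT.-integrable setT (EFin \o w) ->
  (forall f, smoothT f -> \int[muT]_x (w x * f x) = 0) ->
  (\int[muT]_x (w x * (if x < a then 1 else 0))%:E = 0)%E.
Proof.
move=> a01 iw H.
have mw : measurable_fun [set: R] w by have /measurable_EFinP := measurable_int _ iw.
pose F n x := (w x * beval a n BStep x)%:E.
have mlim : measurable_fun [set: R] (fun x => (w x * (if x < a then 1 else 0))%:E).
  apply/measurable_EFinP; apply: measurable_funM => //.
  by apply: measurable_fun_ifT => //; apply: measurable_fun_ltr.
have [||||| _ _ +] := @dominated_convergence _ _ _ muT setT measurableT F
  (fun x => (w x * (if x < a then 1 else 0))%:E) (fun x => `|w x|%:E).
- move=> n; apply/measurable_EFinP; apply: measurable_funM => //.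
  exact: smooth_measurable (bump_smooth a n).
- exact: mlim.
- apply/ae_muT; apply: ae_imp2 (ae_neq 0) (ae_neq a) => x x0 xa /andP[h0 h1] _.
  apply: cvg_EFin; first by apply: nearW.
  apply: cvgM; first exact: cvg_cst.
  by apply: bump_cvg => //; rewrite lt_neqAle eq_sym x0 h0.
- exact: integrable_norm iw.
- apply: aeW => x n _; rewrite lee_fin normrM.
  have /andP[b0 b1] := bump_bound a n x.
  by rewrite (ger0_norm b0) -[leRHS]mulr1; exact: ler_wpM2l.
set I := (X in _ --> X -> _).
rewrite (_ : (fun _ => _) = (fun=> 0%E)); last first.
  apply/funext => n; have := H _ (bump_smooth a n).
  have iF := smooth_mul_integrable iw (bump_smooth a n).
  rewrite /Rintegral => /eqP; rewrite fine_eq0; first by move/eqP.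
  exact: integrable_fin_num iF.
move=> /(cvg_lim (@ereal_hausdorff R)) h; rewrite -[LHS]/I -h.
exact: lim_cst.
Qed.

(* The bumps give [w] zero integral over every [0, a[; Lebesgue differentiation
   in [a] concludes. *)
Lemma vanish_ae w : muT.-integrable setT (EFin \o w) ->
  (forall f, smoothT f -> \int[muT]_x (w x * f x) = 0) ->
  {ae muT, forall x, w x = 0}.
Proof.
move=> iw H.
have mw : measurable_fun [set: R] w by have /measurable_EFinP := measurable_int _ iw.
have iw' := (integrable_muT mw).1 iw.
(* Extension by zero makes the integral up to y over the half-line equal to the integral over
   [0, y], the form in which Lebesgue differentiation is applied. *)
pose f := w \_ (`[0%R, 1%R[%classic : set R).
have if_ : mu.-integrable setT (EFin \o f).
  have [+ _] := @integrable_mkcond _ (measurableTypeR R) R mu _ (EFin \o w) measurable_unit.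
  by rewrite restrict_EFin; apply.
have F0 (y : R) : 0 < y < 1 -> \int[mu]_(t in `]-oo, y]) f t = 0.
  move=> /andP[y0 y1].
  have iy : mu.-integrable `]-oo, y[ (EFin \o f).
    by apply: integrableS if_ => //; exact: measurable_itv.
  rewrite -Rintegral_itv_bndo_bndc//.
  have Hy := vanish_halfline _ iw H.
  have {Hy} := Hy y _; rewrite y0 (ltW y1) => /(_ isT).
  rewrite integral_muT; last first.
    apply/measurable_EFinP; apply: measurable_funM => //.
    by apply: measurable_fun_ifT => //; apply: measurable_fun_ltr.
  rewrite /Rintegral => Hy.
  rewrite -[RHS]/(fine 0%E) -[in RHS]Hy; congr fine.
  rewrite [LHS]integral_mkcond [RHS]integral_mkcond; apply: eq_integral => x _.
  rewrite /patch !mem_setE /= /f /patch mem_setE !in_itv/=.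
  by case: (x < y); case: ifP; rewrite ?mulr1 ?mulr0.
have Hloc : locally_integrable [set: R] f by apply: open_integrable_locally => //; exact: openT.
have ify (y : R) : mu.-integrable `]-oo, y] (EFin \o f).
  by apply: integrableS if_ => //; exact: measurable_itv.
have := FTC1Ny ify Hloc.
move=> HF; apply/ae_muT; apply: ae_imp2 HF (ae_neq 0) => x [_ Fx] x0 /andP[h0 h1].
have x01 : 0 < x < 1 by rewrite lt_neqAle eq_sym x0 h0.
have fx : f x = w x by rewrite /f /patch mem_setE in_itv/= h0 h1.
rewrite -fx -Fx.
(* The primitive of [f] vanishes on all of ]0, 1[, a neighbourhood of [x], so its derivative at [x]
   is 0. *)
rewrite derive1E; transitivity ('D_1 (cst 0 : R -> R) x); last exact: derive_cst.
apply: near_eq_derive; near=> y; apply: F0.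
have : y \in `]0, 1[ by near: y; apply: near_in_itvoo; rewrite in_itv.
by rewrite in_itv.
Unshelve. all: by end_near. Qed.

End vanishing.

(** * Primitives and weak derivatives *)

Section primitive.
Context {R : realType}.
Local Notation mu := (@lebesgue_measure R).
Implicit Types u g w f h : R -> R.

Lemma integral_period (c : R) (v : R -> \bar R) : (forall y, v (y + 1) = v y) ->
  measurable_fun [set: R] v ->
  (\int[mu]_(x in `[c, (c + 1)%R[%classic) v x = \int[muT]_x v x)%E.
Proof.
move=> pv mv.
have mI : measurable (`[c, (c + 1)%R[%classic : set (measurableTypeR R)) by exact: measurable_itv.
rewrite -(integral_muT_shift c pv mv) integral_muT; last first.
  by apply: (measurableT_comp mv); exact: measurable_funD.
rewrite [LHS]integral_mkcond [RHS]integral_mkcond -(integral_shift c).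
  apply: eq_integral => x _; rewrite /patch !mem_setE !in_itv/=.
  by rewrite lerDr [x + c]addrC ltrD2l.
by have [+ _] := measurable_restrictT v mI; apply; exact: measurable_funTS.
Qed.

Lemma norm_Rintegral_le f (M a b : R) : mu.-integrable `[a, b[ (EFin \o f) -> 0 <= M -> a <= b ->
  {ae mu, forall t, a <= t < b -> `|f t| <= M} ->
  `|\int[mu]_(t in `[a, b[) f t| <= M * (b - a).
Proof.
move=> if_ M0 ab fM; apply: le_trans (le_normr_Rintegral _ if_) _ => //.
have iN := integrable_norm if_.
rewrite -lee_fin /Rintegral fineK; last exact: integrable_fin_num iN.
apply: (@le_trans _ _ (\int[mu]_(t in `[a, b[) (cst M%:E) t)%E).
  apply: ae_ge0_le_integral => //.
  exact: (measurable_int _ iN).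
have -> : (\int[mu]_(t in `[a, b[) cst M%:E t = M%:E * mu `[a, b[)%E by exact: integral_cst.
rewrite lebesgue_measure_itv/= lte_fin.
by case: ifP => _; rewrite ?mule0 -?EFinD -?EFinM lee_fin// mulr_ge0// subr_ge0.
Qed.

Section periodic_L1.
Variable g : R -> R.
Hypothesis pg : forall y, g (y + 1) = g y.
Hypothesis ig : muT.-integrable setT (EFin \o g).

Let mg : measurable_fun [set: R] g.
Proof. by have /measurable_EFinP := measurable_int _ ig. Qed.

Let mag : measurable_fun [set: R] (fun x => `|(EFin \o g) x|%E).
Proof. by apply: measurableT_comp => //; exact/measurable_EFinP. Qed.

Lemma periodic_integrable_nat (a : R) (k : nat) :
  mu.-integrable `[a, a + k%:R[ (EFin \o g).
Proof.
have mI (c d : R) : measurable (`[c, d[%classic : set (measurableTypeR R)) by exact: measurable_itv.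
apply/integrableP; split; first by apply: measurable_funTS; exact/measurable_EFinP.
elim: k => [|k IH].
  by rewrite addr0 set_itv_ge ?integral_set0// bnd_simp ltxx.
rewrite (_ : `[a, a + k.+1%:R[%classic =
  `[a, a + k%:R[%classic `|` `[a + k%:R, a + k%:R + 1[%classic); last first.
  rewrite -addrA natr1; apply/seteqP; split=> x /=; rewrite !in_itv/=.
    by move=> /andP[-> x2] /=; case: (ltP x (a + k%:R)) => h; [left|right].
  have k0 : (0 : R) <= k%:R by [].
  by rewrite -natr1; case=> /andP[h1 h2]; apply/andP; split; lra.
rewrite ge0_integral_setU//.
- apply: lte_add_pinfty => //.
  rewrite integral_period//; last by move=> y /=; rewrite pg.
  by have /integrableP[] := ig.
- by apply: measurable_funTS.
- apply/disj_setPS => x [/=]; rewrite !in_itv/= => /andP[_ h1] /andP[h2 _].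
  by move: (lt_le_trans h1 h2); rewrite ltxx.
Qed.

Lemma periodic_integrable (a b : R) : mu.-integrable `[a, b[ (EFin \o g).
Proof.
have [k hk] : exists k : nat, b - a <= k%:R.
  by exists (Num.bound `|b - a|); apply: le_trans (ler_norm _) (ltW (archi_boundP (normr_ge0 (b - a)))).
apply: integrableS (periodic_integrable_nat a k) => //.
move=> x /=; rewrite !in_itv/= => /andP[-> xb]/=; lra.
Qed.

Definition gi (x y : R) : R := \int[mu]_(t in `[x, y[) g t.
(** The signed integral of [g] from 0 to x: [gi] is 0 when its bounds are in the wrong order, so one
    of the two terms always vanishes. *)
Definition prim (x : R) : R := gi 0 x - gi x 0.

Lemma gi_ge (x y : R) : y <= x -> gi x y = 0.
Proof. by move=> yx; rewrite /gi set_itv_ge ?Rintegral_set0// bnd_simp -leNgt. Qed.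

Lemma gi_add (x y z : R) : x <= y -> y <= z -> gi x z = gi x y + gi y z.
Proof.
move=> xy yz; rewrite /gi.
rewrite (_ : `[x, z[%classic = `[x, y[%classic `|` `[y, z[%classic); last first.
  apply/seteqP; split=> t /=; rewrite !in_itv/=.
    by move=> /andP[-> x2] /=; case: (ltP t y) => h; [left|right].
  by case=> /andP[h1 h2]; apply/andP; split; lra.
rewrite Rintegral_setU//; last first.
  apply/disj_setPS => t [/=]; rewrite !in_itv/= => /andP[_ h1] /andP[h2 _].
  by move: (lt_le_trans h1 h2); rewrite ltxx.
apply: integrableS (periodic_integrable x z) => //; first by apply: measurableU.
by move=> t /= []; rewrite !in_itv/= => /andP[h1 h2]; apply/andP; split; lra.
Qed.

Lemma prim_sub (x y : R) : x <= y -> prim y - prim x = gi x y.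
Proof.
move=> xy; rewrite /prim.
have [x0|x0] := leP 0 x.
  have y0 : 0 <= y := le_trans x0 xy.
  by rewrite (gi_ge x0) (gi_ge y0) !subr0 (gi_add x0 xy) addrC addKr.
have [y0|y0] := leP 0 y.
  by rewrite (gi_ge (ltW x0)) (gi_ge y0) (gi_add (ltW x0) y0); lra.
by rewrite (gi_ge (ltW x0)) (gi_ge (ltW y0)) (gi_add xy (ltW y0)); lra.
Qed.

Lemma gi_unit (x : R) : gi x (x + 1) = \int[muT]_t g t.
Proof.
rewrite /gi /Rintegral integral_period//; first by move=> y; rewrite pg.
exact/measurable_EFinP.
Qed.

Lemma prim_periodic : \int[muT]_t g t = 0 -> forall x, prim (x + 1) = prim x.
Proof.
by move=> g0 x; apply/eqP; rewrite -subr_eq0 prim_sub ?lerDl// gi_unit g0.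
Qed.

Lemma gi_norm (x y : R) : `|gi x y| <= \int[mu]_(t in `[x, y[) `|g t|.
Proof. exact: le_normr_Rintegral (periodic_integrable x y). Qed.

Lemma gi_bounded (M x y : R) : 0 <= M -> {ae mu, forall t, `|g t| <= M} -> x <= y ->
  `|gi x y| <= M * (y - x).
Proof.
move=> M0 gM xy; apply: norm_Rintegral_le (periodic_integrable x y) M0 xy _.
by apply: ae_imp gM.
Qed.

(** The integral is written over the whole line with a jointly measurable integrand that vanishes
    outside the bounds; the measurability part of Tonelli then applies to its positive and negative
    parts. *)
Lemma measurable_prim : measurable_fun [set: R] prim.
Proof.
have H (lo hi : R -> R -> bool) :
    measurable_fun [set: measurableTypeR R * measurableTypeR R] (fun p => lo p.1 p.2) ->
    measurable_fun [set: measurableTypeR R * measurableTypeR R] (fun p => hi p.1 p.2) ->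
  measurable_fun [set: R] (fun x => \int[mu]_t (if lo x t && hi x t then g t else 0)).
  move=> mlo mhi; apply: (measurableT_comp (fine_measurable measurableT)).
  pose F (p : measurableTypeR R * measurableTypeR R) : R :=
    if lo p.1 p.2 && hi p.1 p.2 then g p.2 else 0.
  have mF : measurable_fun [set: measurableTypeR R * measurableTypeR R] F.
    apply: measurable_fun_ifT => //; first exact: measurable_and.
    exact: (measurableT_comp mg measurable_snd).
  under eq_fun do rewrite integralE.
  have mE : measurable_fun [set: measurableTypeR R * measurableTypeR R] (fun p => (F p)%:E).
    exact/measurable_EFinP.
  apply: emeasurable_funB.
  - apply: (@measurable_integral_snd R (fun x t => (fun s => (F (x, s))%:E)^\+%E t)).
      rewrite (_ : (fun _ => _) = (fun p : measurableTypeR R * measurableTypeR R => (F p)%:E)^\+%E).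
        exact: measurable_funepos.
      by apply/funext => -[p q]; rewrite !funeposE.
    by move=> x y; exact: funepos_ge0.
  - apply: (@measurable_integral_snd R (fun x t => (fun s => (F (x, s))%:E)^\-%E t)).
      rewrite (_ : (fun _ => _) = (fun p : measurableTypeR R * measurableTypeR R => (F p)%:E)^\-%E).
        exact: measurable_funeneg.
      by apply/funext => -[p q]; rewrite !funenegE.
    by move=> x y; exact: funeneg_ge0.
have giE (x y : R) : gi x y = \int[mu]_t (if (x <= t) && (t < y) then g t else 0).
  rewrite /gi Rintegral_mkcond; apply: eq_Rintegral => t _.
  by rewrite /patch mem_setE in_itv.
rewrite /prim; apply: measurable_funB.
- rewrite (_ : gi 0 = fun x => \int[mu]_t (if (0 <= t) && (t < x) then g t else 0)); last first.
    by apply/funext => x; rewrite giE.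
  apply: (H (fun x t => 0 <= t) (fun x t => t < x)).
  + by apply: measurable_fun_ler => //; exact: measurable_snd.
  + by apply: measurable_fun_ltr; [exact: measurable_snd|exact: measurable_fst].
- rewrite (_ : (gi ^~ 0) = fun x => \int[mu]_t (if (x <= t) && (t < 0) then g t else 0)); last first.
    by apply/funext => x; rewrite giE.
  apply: (H (fun x t => x <= t) (fun x t => t < 0)).
  + by apply: measurable_fun_ler; [exact: measurable_fst|exact: measurable_snd].
  + by apply: measurable_fun_ltr => //; exact: measurable_snd.
Qed.

Lemma prim_unit (x : R) : 0 <= x -> prim x = gi 0 x.
Proof. by move=> x0; rewrite /prim (gi_ge x0) subr0. Qed.

Lemma prim_abs (x : R) : 0 <= x < 1 -> `|prim x| <= \int[muT]_t `|g t|.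
Proof.
move=> /andP[x0 x1]; rewrite prim_unit//; apply: le_trans (gi_norm 0 x) _.
rewrite -lee_fin /Rintegral fineK; last first.
  exact: integrable_fin_num (integrable_norm (periodic_integrable 0 x)).
rewrite fineK; last exact: integrable_fin_num (integrable_norm ig).
rewrite [leRHS]integral_muT//.
apply: ge0_subset_integral => //; first exact: measurable_funTS.
by move=> t /=; rewrite !in_itv/= => /andP[-> h]/=; lra.
Qed.

End periodic_L1.
End primitive.

(** * Integration by parts against test functions *)

Section by_parts.
Context {R : realType}.
Local Notation mu := (@lebesgue_measure R).
Implicit Types u g w f h : R -> R.

Lemma bounded_integrable_muT f (M : R) : measurable_fun [set: R] f ->
  (forall x, `|f x| <= M) -> muT.-integrable setT (EFin \o f).
Proof.
move=> mf fM; apply: measurable_bounded_integrable => //.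
  by rewrite muT_setT ltry.
exists M; split; first exact: num_real.
by move=> M' hM z _; apply: le_trans (fM z) (ltW hM).
Qed.

Lemma smooth_FTC f : smoothT f -> forall x y, x <= y ->
  \int[mu]_(t in `[x, y]) (f^`())%classic t = f y - f x.
Proof.
move=> sf x y; rewrite le_eqVlt => /predU1P[->|xy].
  by rewrite set_itv1 Rintegral_set1 subrr.
have cf := smooth_continuous sf.
have cf' := smooth_continuous (smooth_derive sf).
rewrite /Rintegral (@continuous_FTC2 _ _ f)//.
- exact: continuous_subspaceT.
- split.
  + by move=> z _; exact: smooth_derivable.
  + by apply: cvg_at_right_filter; exact: cf.
  + by apply: cvg_at_left_filter; exact: cf.
Qed.

(** The fundamental theorem on [t, 1], with f 1 = f 0 by periodicity, put in the form of an integral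
    over the region t < x that Fubini produces. *)
Lemma smooth_FTC_unit f : smoothT f -> forall t, 0 <= t < 1 ->
  \int[muT]_x (if t < x then (f^`())%classic x else 0) = f 0 - f t.
Proof.
move=> sf t /andP[t0 t1].
have mf' := smooth_measurable (smooth_derive sf).
have f10 : f 1 = f 0 by rewrite -[1]add0r sf.1.
rewrite -f10 -(smooth_FTC sf (ltW t1)).
rewrite Rintegral_muT; last by apply: measurable_fun_ifT => //; exact: measurable_fun_ltr.
have cf'I x y : mu.-integrable `[x, y] (EFin \o (f^`())%classic).
  apply: continuous_compact_integrable; first exact: segment_compact.
  by apply: continuous_subspaceT; exact: (smooth_continuous (smooth_derive sf)).
rewrite -(@Rintegral_itv_obnd_cbnd _ t (BRight 1)); last first.
  apply: integrableS (cf'I t 1) => //.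
  by move=> x /=; rewrite !in_itv/= => /andP[/ltW -> ->].
rewrite -(@Rintegral_itv_bndo_bndc _ (BRight t) 1); last first.
  apply: integrableS (cf'I t 1) => //.
  by move=> x /=; rewrite !in_itv/= => /andP[/ltW -> /ltW ->].
rewrite [LHS]Rintegral_mkcond [RHS]Rintegral_mkcond; apply: eq_Rintegral => x _.
rewrite /patch !mem_setE !in_itv/=.
case: (ltP t x) => tx /=; last by case: ifP.
by rewrite (le_trans t0 (ltW tx)).
Qed.

Lemma prim_gi_unit g : (forall y, g (y + 1) = g y) ->
  muT.-integrable setT (EFin \o g) -> forall x, 0 <= x < 1 ->
  prim g x = \int[muT]_t (if t < x then g t else 0).
Proof.
move=> pg ig x /andP[x0 x1].
have mg : measurable_fun [set: R] g by have /measurable_EFinP := measurable_int _ ig.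
rewrite prim_unit// Rintegral_muT; last by apply: measurable_fun_ifT => //; exact: measurable_fun_ltr.
rewrite /gi [LHS]Rintegral_mkcond [RHS]Rintegral_mkcond; apply: eq_Rintegral => t _.
rewrite /patch !mem_setE !in_itv/=.
case: (ltP t x) => tx /=; last by rewrite andbF; case: ifP.
by rewrite (lt_trans tx x1).
Qed.

(** Fubini on the triangle t < x: integrating f' first in x turns the left side into the integral of
    g t (f 0 - f t), and the mean of [g] being zero removes the term with f 0. *)
Lemma prim_by_parts g f : (forall y, g (y + 1) = g y) ->
  muT.-integrable setT (EFin \o g) -> \int[muT]_x g x = 0 -> smoothT f ->
  \int[muT]_x (prim g x * (f^`())%classic x) = - \int[muT]_x (g x * f x).
Proof.
move=> pg ig g0 sf.
have mg : measurable_fun [set: R] g by have /measurable_EFinP := measurable_int _ ig.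
have sf' := smooth_derive sf.
have mf' := smooth_measurable sf'.
have [M HM] := smooth_bounded sf'.
have M0 : 0 <= M by apply: le_trans (HM 0).
have iu x : muT.-integrable setT (EFin \o (fun t => if t < x then g t else 0)).
  apply: (@le_integrable _ _ R muT setT measurableT _ (EFin \o g)) => //.
    by apply/measurable_EFinP; apply: measurable_fun_ifT => //; exact: measurable_fun_ltr.
  by move=> t _ /=; rewrite lee_fin; case: ifP; rewrite ?normr0.
have il t : muT.-integrable setT (EFin \o (fun x => if t < x then (f^`())%classic x else 0)).
  have if' : muT.-integrable setT (EFin \o (f^`())%classic).
    exact: bounded_integrable_muT HM.
  apply: (@le_integrable _ _ R muT setT measurableT _ (EFin \o (f^`())%classic)) => //.
    by apply/measurable_EFinP; apply: measurable_fun_ifT => //; exact: measurable_fun_ltr.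
  by move=> x _ /=; rewrite lee_fin; case: ifP; rewrite ?normr0.
have igf := smooth_mul_integrable ig sf.
pose F (p : measurableTypeR R * measurableTypeR R) : R :=
  (if p.2 < p.1 then g p.2 else 0) * (f^`())%classic p.1.
have mF : measurable_fun [set: measurableTypeR R * measurableTypeR R] F.
  apply: measurable_funM; last exact: (measurableT_comp mf' measurable_fst).
  apply: measurable_fun_ifT => //; last exact: (measurableT_comp mg measurable_snd).
  by apply: measurable_fun_ltr; [exact: measurable_snd|exact: measurable_fst].
have iF : (circ \x circ)%E.-integrable setT (EFin \o F).
  apply/integrable21ltyP; first exact/measurable_EFinP.
  apply: (@le_lt_trans _ _ (\int[circ]_y (`|g y| * M)%:E)%E).
    apply: ge0_le_integral => //.
    - by move=> y _; apply: integral_ge0.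
    - apply: (@measurable_integral_muT R (fun y x => `|(F (x, y))%:E|%E)) => //.
      apply: measurableT_comp => //; apply/measurable_EFinP.
      apply: measurable_funM; last exact: (measurableT_comp mf' measurable_snd).
      apply: measurable_fun_ifT => //; last exact: (measurableT_comp mg measurable_fst).
      by apply: measurable_fun_ltr; [exact: measurable_fst|exact: measurable_snd].
    - by apply/measurable_EFinP; apply: measurable_funM => //; exact: measurableT_comp.
    - move=> y _; rewrite -[leRHS]mule1 -(@muT_setT R) -[X in (_ * X)%E]/(circ setT) -integral_cst//.
      apply: ge0_le_integral => //.
      + apply: measurableT_comp => //; apply/measurable_EFinP; rewrite /F/=.
        apply: measurable_funM; last exact: mf'.
        by apply: measurable_fun_ifT => //; exact: measurable_fun_ltr.
      + move=> x _; rewrite /= lee_fin /F/= normrM; apply: ler_pM => //.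
        by case: ifP => // _; rewrite normr0.
  under eq_integral do rewrite EFinM muleC.
  rewrite ge0_integralZl//.
  - by apply: lte_mul_pinfty => //; have /integrableP[] := ig.
  - by apply/measurable_EFinP; exact: measurableT_comp.
rewrite /Rintegral; transitivity (fine (\int[circ]_x \int[circ]_t (F (x, t))%:E)%E).
  congr fine; apply: ae_eq_integral => //.
  - by apply/measurable_EFinP; apply: measurable_funM => //; exact: measurable_prim.
  - exact: (measurable_fubini_F iF).
  apply/ae_muT; apply: aeW => x x01 _.
  rewrite (prim_gi_unit pg ig x01).
  transitivity (\int[muT]_t ((if (t < x)%R then g t else 0%R)%:E * ((f^`())%classic x)%:E))%E; last first.
    by apply: eq_integral => t _; rewrite -EFinM.
  rewrite integralZr//; last exact: iu x.
  rewrite EFinM /Rintegral fineK//.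
  exact: integrable_fin_num (iu x).
rewrite (Fubini iF).
transitivity (\int[muT]_t (f 0 * g t - g t * f t)).
  rewrite /Rintegral; congr fine; apply: ae_eq_integral => //.
  - exact: (measurable_fubini_G iF).
  - apply/measurable_EFinP; apply: measurable_funB; first exact: measurable_funM.
    by apply: measurable_funM => //; exact: smooth_measurable.
  apply/ae_muT; apply: aeW => t t01 _.
  rewrite [f 0 * _]mulrC -mulrBr -(smooth_FTC_unit sf t01) /F.
  rewrite EFinM /Rintegral fineK; last exact: integrable_fin_num (il t).
  rewrite -integralZl//; last exact: il t.
  transitivity (\int[muT]_x (F (x, t))%:E)%E; first by [].
  apply: eq_integral => x _; rewrite -EFinM /F /=.
  by case: ifP => _; rewrite ?mulr0 ?mul0r.
rewrite (RintegralB measurableT (integrableZl measurableT (f 0) ig) igf).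
by rewrite RintegralZl// g0 mulr0 sub0r.
Qed.

End by_parts.

(** * Weak derivatives and primitives *)

Section structure.
Context {R : realType}.
Local Notation mu := (@lebesgue_measure R).
Implicit Types u g w f h : R -> R.

(** The exceptional set is covered by countably many integer translates of a null subset of the unit
    interval. *)
Lemma ae_mu_periodic (P : R -> Prop) : (forall x, P (x + 1) = P x) ->
  {ae muT, forall x, P x} -> {ae mu, forall x, P x}.
Proof.
move=> pP /ae_muT H.
have Hn (n : nat) : {ae mu, forall x : R,
    0 <= x + (enum_int n)%:~R < 1 -> P (x + (enum_int n)%:~R)}.
  exact: ae_shift H.
apply: ae_imp (ae_foralln Hn) => x Hx.
have [n /andP[n1 n2]] := unit_itv_cover x.
have [_ _ /(_ (- n) I)[k _ kn]] := enum_int_bij.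
have := Hx k; rewrite kn (periodic_int (- n) x pP); apply.
by rewrite intrN; apply/andP; split; lra.
Qed.

Lemma ae_eq_integrable_muT u v : measurable_fun [set: R] u ->
  {ae muT, forall x, u x = v x} -> muT.-integrable setT (EFin \o v) ->
  muT.-integrable setT (EFin \o u).
Proof.
move=> mu_ uv iv; have /integrableP[mv fv] := iv.
apply/integrableP; split; first exact/measurable_EFinP.
rewrite (_ : (\int[muT]_x _ = \int[muT]_x `|(EFin \o v) x|)%E)//.
apply: ae_eq_integral => //.
- by apply: measurableT_comp => //; exact/measurable_EFinP.
- exact: measurableT_comp.
- by apply: ae_imp uv => x /= -> _.
Qed.

Lemma L2T_L1T u : L2T u -> LpT 1%E u.
Proof.
move=> [pu Lu]; split => //; apply: Lfun_subset12 Lu.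
by rewrite muT_setT.
Qed.

Lemma smooth_cst (c : R) : smoothT (cst c : R -> R).
Proof.
split=> // n x; suff [d ->] : exists d : R, ((cst c : R -> R)^`(n))%classic = cst d by [].
elim: n c => [|n IH] c; first by exists c.
rewrite derive1Sn (_ : ((cst c : R -> R)^`())%classic = cst 0)//.
by apply/funext => y; rewrite derive1_cst.
Qed.

Lemma smooth_of_derive f : periodic f 1 -> (forall x, derivable f x 1) ->
  smoothT (f^`())%classic -> smoothT f.
Proof.
move=> pf df [_ sf]; split; first exact: pf.
by case=> [|n] x; [exact: df|rewrite derive1Sn; exact: sf].
Qed.

Lemma smooth_integrable f : smoothT f -> muT.-integrable setT (EFin \o f).
Proof.
move=> sf; have [M HM] := smooth_bounded sf.
exact: bounded_integrable_muT (smooth_measurable sf) HM.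
Qed.

Lemma smooth_add_cst h (c : R) : smoothT h -> smoothT (fun x => h x - c).
Proof.
move=> sh; have dh x : derivable (fun x => h x - c) x 1.
  by apply: derivableB => //; exact: smooth_derivable.
apply: smooth_of_derive; [by move=> x; rewrite sh.1|exact: dh|].
rewrite (_ : (_^`())%classic = (h^`())%classic); first exact: smooth_derive.
apply/funext => x; rewrite !derive1E deriveB ?derive_cst ?subr0//.
exact: smooth_derivable.
Qed.

(** The classical fundamental theorem gives prim h the derivative h; smoothness of prim h is then
    that of h, and zero mean provides periodicity. *)
Lemma prim_smooth h : smoothT h -> \int[muT]_x h x = 0 ->
  smoothT (prim h) /\ ((prim h)^`())%classic = h.
Proof.
move=> sh h0; have ih := smooth_integrable sh.
have key x : derivable (prim h) x 1 /\ ((prim h)^`())%classic x = h x.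
  have x1 : x < x + 1 by rewrite ltrDl.
  have x0 : x - 1 < x by rewrite ltrBlDr ltrDl.
  have iI : mu.-integrable `[x - 1, x + 1] (EFin \o h).
    apply: continuous_compact_integrable; first exact: segment_compact.
    by apply: continuous_subspaceT; exact: (smooth_continuous sh).
  have chx : {for x, continuous h} by exact: smooth_continuous.
  have [] := continuous_FTC1_closed x1 iI x0 chx.
  set F := (fun _ => _) => dF F'.
  (* Near [x] the integral based at x - 1 and [prim h] differ by the constant prim h (x - 1); a base
     point to the left of [x] avoids a case distinction on the sign of [x]. *)
  have HF : {near x, (fun y => F y + prim h (x - 1)) =1 prim h}.
    near=> y.
    have y0 : x - 1 < y by near: y; exact: lt_nbhsr.
    have y1 : y < x + 1 by near: y; exact: lt_nbhsl.
    rewrite /F -Rintegral_itv_bndo_bndc; first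
      by rewrite -[X in X + _]/(gi h _ _) -(prim_sub sh.1 ih (ltW y0)) subrK.
    by apply: integrableS iI => // z /=; rewrite !in_itv/= => /andP[-> /ltW/le_trans->]//; exact: ltW.
  have dFc : derivable (fun y => F y + prim h (x - 1)) x 1.
    by apply: derivableD; [exact: dF|exact: derivable_cst].
  split; first exact: near_eq_derivable HF dFc.
  rewrite derive1E -(near_eq_derive _ HF) deriveD; [|exact: dF|exact: derivable_cst].
  rewrite derive_cst addr0 -derive1E.
  exact: F'.
split; last by apply/funext => x; exact: (key x).2.
apply: smooth_of_derive; first by move=> x; rewrite prim_periodic//; exact: sh.1.
  by move=> x; exact: (key x).1.
by rewrite (_ : (_^`())%classic = h)//; apply/funext => x; exact: (key x).2.
Unshelve. all: by end_near. Qed.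

(* The primitive of [h] minus its mean is again a test function. *)
Lemma du_bois_reymond w : muT.-integrable setT (EFin \o w) ->
  (forall f, smoothT f -> \int[muT]_x (w x * (f^`())%classic x) = 0) ->
  exists c : R, {ae muT, forall x, w x = c}.
Proof.
move=> iw H; exists (\int[muT]_x w x); set c := \int[muT]_x w x.
have ic : muT.-integrable setT (EFin \o (cst c : R -> R)).
  exact: smooth_integrable (smooth_cst c).
have iwc : muT.-integrable setT (EFin \o (fun x => w x - c)) by exact: (integrableB measurableT iw ic).
suff : {ae muT, forall x, w x - c = 0} by apply: ae_imp => x /subr0_eq.
apply: vanish_ae => // h sh.
pose m := \int[muT]_x h x.
have ih := smooth_integrable sh.
have icst (k : R) : muT.-integrable setT (EFin \o (cst k : R -> R)).
  exact: smooth_integrable (smooth_cst k).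
have Icst (k : R) : \int[muT]_x (cst k : R -> R) x = k.
  by rewrite Rintegral_cst// muT_setT mulr1.
have [] := prim_smooth (smooth_add_cst m sh).
  by rewrite (RintegralB measurableT ih (icst m)) Icst subrr.
move=> /H + e; rewrite e => E.
have iwh := smooth_mul_integrable iw sh.
have : \int[muT]_x (w x * h x) = m * c.
  move: E; under eq_Rintegral do rewrite mulrBr [w _ * m]mulrC.
  by rewrite (RintegralB measurableT iwh (integrableZl measurableT m iw)) RintegralZl// => /subr0_eq.
move=> Ewh; under eq_Rintegral do rewrite mulrBl.
rewrite (RintegralB measurableT iwh (integrableZl measurableT c ih)) RintegralZl// Ewh.
by rewrite mulrC subrr.
Qed.

(** Test against the constant 1, whose derivative is 0. *)
Lemma weak_derivative_mean0 u g : weak_derivative u g -> \int[muT]_x g x = 0.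
Proof.
move=> [Lu Lg /(_ _ (smooth_cst 1))].
rewrite (_ : ((cst 1 : R -> R)^`())%classic = cst 0); last by apply/funext => x; rewrite derive1_cst.
under eq_Rintegral do rewrite mulr0.
under [in RHS]eq_Rintegral do rewrite mulr1.
by rewrite Rintegral_cst// mul0r => /eqP; rewrite eq_sym oppr_eq0 => /eqP.
Qed.

Lemma prim_integrable g : (forall y, g (y + 1) = g y) ->
  muT.-integrable setT (EFin \o g) -> \int[muT]_x g x = 0 ->
  muT.-integrable setT (EFin \o prim g).
Proof.
move=> pg ig g0; apply: (@bounded_integrable_muT _ _ (\int[muT]_t `|g t|)).
  exact: measurable_prim.
move=> x; have [n /andP[n1 n2]] := unit_itv_cover x.
rewrite -(periodic_int (- n) x (prim_periodic pg ig g0)).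
by apply: prim_abs => //; rewrite intrN; apply/andP; split; lra.
Qed.

(** By parts, u - prim g is orthogonal to all derivatives of test functions, so it is constant by
    [du_bois_reymond]. Both sides being periodic, the identity extends from the unit interval to the
    line. *)
Lemma weak_derivative_prim u g : weak_derivative u g ->
  exists c : R, {ae mu, forall x, u x = c + prim g x}.
Proof.
move=> wug; have [Lu Lg H] := wug; have g0 := weak_derivative_mean0 wug.
have ig := L1T_integrable Lg; have iu := L1T_integrable Lu.
have ip := prim_integrable Lg.1 ig g0.
have iup : muT.-integrable setT (EFin \o (fun x => u x - prim g x)).
  exact: (integrableB measurableT iu ip).
have [f sf|c Hc] := du_bois_reymond iup.
  under eq_Rintegral do rewrite mulrBl.
  have i1 := smooth_mul_integrable iu (smooth_derive sf).
  have i2 := smooth_mul_integrable ip (smooth_derive sf).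
  by rewrite (RintegralB measurableT i1 i2) H// (prim_by_parts Lg.1 ig g0 sf) subrr.
exists c; apply: ae_mu_periodic.
  by move=> x; rewrite (Lu.1 x) (prim_periodic Lg.1 ig g0).
by apply: ae_imp Hc => x <-; rewrite subrK.
Qed.

Lemma integral_derive_smooth f : smoothT f -> \int[muT]_x (f^`())%classic x = 0.
Proof.
move=> sf.
have i0 : muT.-integrable setT (EFin \o (cst 0 : R -> R)) by exact: smooth_integrable (smooth_cst 0).
have c0 : \int[muT]_x (cst 0 : R -> R) x = 0 by rewrite Rintegral_cst// mul0r.
have := smooth_FTC sf ler01; rewrite (_ : f 1 = f 0); last by rewrite -[1]add0r sf.1.
rewrite subrr -(@Rintegral_itv_bndo_bndc _ (BLeft 0) 1).
  by rewrite Rintegral_muT//; exact: smooth_measurable (smooth_derive sf).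
apply/integrable_muT; first exact: smooth_measurable (smooth_derive sf).
exact: smooth_integrable (smooth_derive sf).
Qed.

(** The converse of [weak_derivative_prim]: by parts for [prim g], while the constant [c]
    contributes nothing because the derivative of a test function has mean zero. *)
Lemma prim_weak_derivative u g (c : R) : periodic u 1 -> measurable_fun [set: R] u ->
  LpT 1%E g -> \int[muT]_x g x = 0 ->
  {ae muT, forall x, u x = c + prim g x} -> weak_derivative u g.
Proof.
move=> pu mu_ Lg g0 Hu; have ig := L1T_integrable Lg.
have ip := prim_integrable Lg.1 ig g0.
have ic : muT.-integrable setT (EFin \o (cst c : R -> R)) by exact: smooth_integrable (smooth_cst c).
have icp : muT.-integrable setT (EFin \o (fun x => c + prim g x)).
  exact: (integrableD measurableT ic ip).
have iu : muT.-integrable setT (EFin \o u).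
  exact: ae_eq_integrable_muT icp.
split => //; first exact: L1T_intro.
move=> f sf; rewrite -(prim_by_parts Lg.1 ig g0 sf).
have i1 := smooth_mul_integrable ic (smooth_derive sf).
have i2 := smooth_mul_integrable ip (smooth_derive sf).
have i3 := smooth_mul_integrable iu (smooth_derive sf).
have i4 := smooth_mul_integrable icp (smooth_derive sf).
transitivity (\int[muT]_x ((c + prim g x) * (f^`())%classic x)).
  rewrite /Rintegral; congr fine; apply: ae_eq_integral => //.
  - exact: measurable_int i3.
  - exact: measurable_int i4.
  - by apply: ae_imp Hu => x -> _.
under eq_Rintegral do rewrite mulrDl.
rewrite (RintegralD measurableT i1 i2) RintegralZl ?integral_derive_smooth ?mulr0 ?add0r//.
exact: smooth_integrable (smooth_derive sf).
Qed.

Lemma weak_derivative_unique u g h : weak_derivative u g -> weak_derivative u h ->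
  {ae muT, forall x, g x = h x}.
Proof.
move=> [Lu Lg Hg] [_ Lh Hh]; have ig := L1T_integrable Lg; have ih := L1T_integrable Lh.
have igh : muT.-integrable setT (EFin \o (fun x => g x - h x)).
  exact: (integrableB measurableT ig ih).
suff : {ae muT, forall x, g x - h x = 0} by apply: ae_imp => x /subr0_eq.
apply: vanish_ae => // f sf; under eq_Rintegral do rewrite mulrBl.
have i1 := smooth_mul_integrable ig sf; have i2 := smooth_mul_integrable ih sf.
rewrite (RintegralB measurableT i1 i2); apply/eqP; rewrite subr_eq0; apply/eqP.
by apply: oppr_inj; rewrite -Hg// -Hh.
Qed.

Lemma weak_derivative_lin (a : R) u v g h : weak_derivative u g -> weak_derivative v h ->
  weak_derivative (a *: u + v) (a *: g + h).
Proof.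
move=> [Lu Lg Hg] [Lv Lh Hh].
have iu := L1T_integrable Lu; have iv := L1T_integrable Lv.
have ig := L1T_integrable Lg; have ih := L1T_integrable Lh.
have lin (p q : R -> R) (f : R -> R) : 
    muT.-integrable setT (EFin \o p) -> muT.-integrable setT (EFin \o q) ->
    smoothT f -> \int[muT]_x ((a *: p + q) x * f x) =
    a * \int[muT]_x (p x * f x) + \int[muT]_x (q x * f x).
  move=> ip iq sf; under eq_Rintegral do rewrite !fctE mulrDl -mulrA.
  have i1 := smooth_mul_integrable ip sf; have i2 := smooth_mul_integrable iq sf.
  by rewrite (RintegralD measurableT (integrableZl measurableT a i1) i2) RintegralZl.
have Llin p q : LpT 1%E p -> LpT 1%E q -> LpT 1%E (a *: p + q).
  move=> Lp Lq; apply: L1T_intro; first by move=> x; rewrite !fctE Lp.1 Lq.1.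
  exact: (integrableD measurableT (integrableZl measurableT a (L1T_integrable Lp)) (L1T_integrable Lq)).
split; [exact: Llin|exact: Llin|] => f sf.
rewrite (lin u v _ iu iv (smooth_derive sf)) (lin g h _ ig ih sf).
by rewrite Hg// Hh// mulrN opprD.
Qed.

Lemma wderivP u g : weak_derivative u g -> weak_derivative u (wderiv u).
Proof. by move=> H; apply: (@xgetPex _ (cst 0) [set g | weak_derivative u g]); exists g. Qed.

Lemma wderiv_ae u g : weak_derivative u g -> {ae muT, forall x, wderiv u x = g x}.
Proof. by move=> H; exact: weak_derivative_unique (wderivP H) H. Qed.

End structure.

(** * The spaces W^{1,infinity}, H^1 and H^2 of the circle *)

Section sobolev.
Context {R : realType}.
Local Notation mu := (@lebesgue_measure R).
Implicit Types u v g w f h b : R -> R.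

Lemma ess_bound u : LpT +oo%E u ->
  {ae mu, forall x, `|u x| <= fine (LpTnorm +oo%E u)}.
Proof.
move=> [pu Lu]; have : (LpTnorm +oo%E u < +oo)%E.
  by move: Lu; rewrite inE => /andP[_ /[!inE]].
have : (0 <= LpTnorm +oo%E u)%E by exact: Lnorm_ge0.
(* The norm of exponent infinity is an essential supremum only when the total mass is positive,
   which [muT_setT] supplies. *)
rewrite /LpTnorm unlock muT_setT lte01 => N0 Nfin.
apply: ae_mu_periodic; first by move=> x; rewrite pu.
apply: ae_imp (ess_sup_ge muT (abse \o (EFin \o u))) => x /= h.
by rewrite -lee_fin fineK// ge0_fin_numE.
Qed.

Lemma ess_norm_ae u v : {ae muT, forall x, u x = v x} ->
  LpTnorm +oo%E u = LpTnorm +oo%E v.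
Proof.
move=> uv; rewrite /LpTnorm unlock muT_setT lte01.
by apply: eq_ess_sup; apply: ae_imp uv => x /= ->.
Qed.

Lemma W1infty_wderiv b : W1inftyT b ->
  weak_derivative b (wderiv b) /\ LpT +oo%E (wderiv b).
Proof.
move=> [Lb [g Lg bg]]; have wb := wderivP bg; split => //.
have [_ L1 _] := wb.
apply: LpT_intro; [exact: L1.1|exact: LpT_measurable L1|].
rewrite (ess_norm_ae (wderiv_ae bg)).
by move: Lg => [_]; rewrite inE => /andP[_ /[!inE]].
Qed.

(** Almost everywhere [b] is a constant plus the primitive of b'. That primitive is defined
    everywhere and increases between two points by an integral bounded by L times their distance. *)
Lemma W1infty_lipschitz b (L := fine (LpTnorm +oo%E (wderiv b))) : W1inftyT b ->
  exists b0, {ae mu, forall x, b x = b0 x} /\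
    forall x y, `|b0 x - b0 y| <= L * `|x - y|.
Proof.
move=> /W1infty_wderiv[wb Loo]; have [_ L1 _] := wb.
have ig := L1T_integrable L1.
have L0 : 0 <= L by apply: fine_ge0; exact: Lnorm_ge0.
have [c Hc] := weak_derivative_prim wb.
exists (fun x => c + prim (wderiv b) x); split => // x y.
rewrite opprD addrACA subrr add0r.
wlog xy : x y / x <= y => [H|].
  have [/H//|/ltW/H] := leP x y.
  by rewrite distrC [`|y - x|]distrC.
rewrite distrC [`|x - y|]distrC (ger0_norm (_ : 0 <= y - x)) ?subr_ge0//.
rewrite (prim_sub L1.1 ig xy).
by apply: (gi_bounded L1.1 ig L0 _ xy); exact: ess_bound.
Qed.

Lemma L2T_ae u v : periodic v 1 -> measurable_fun [set: R] v ->
  {ae muT, forall x, v x = u x} -> L2T u -> L2T v.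
Proof.
move=> pv mv vu Lu; apply: L2T_intro => //.
rewrite (_ : (\int[muT]_x _ = \int[muT]_x (u x ^+ 2)%:E)%E).
  by rewrite -l2_sqr// ltry.
apply: ae_eq_integral => //.
- exact: measurable_sqr_EFin.
- by apply: measurable_sqr_EFin; exact: L2T_measurable.
- by apply: ae_imp vu => x -> _.
Qed.

Lemma H1T_wderiv u : H1T u ->
  [/\ L2T u, L2T (wderiv u) & weak_derivative u (wderiv u)].
Proof.
move=> [Lu [g Lg ug]]; have wu := wderivP ug; split => //.
have [_ L1 _] := wu.
exact: L2T_ae L1.1 (LpT_measurable L1) (wderiv_ae ug) Lg.
Qed.

Lemma H1T_intro u g : L2T u -> L2T g -> weak_derivative u g -> H1T u.
Proof. by move=> Lu Lg ug; split => //; exists g. Qed.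

Lemma weak_derivative_ae u v g : periodic v 1 -> measurable_fun [set: R] v ->
  {ae muT, forall x, v x = u x} -> weak_derivative u g -> weak_derivative v g.
Proof.
move=> pv mv vu [Lu Lg H].
have iu := L1T_integrable Lu.
have iv := ae_eq_integrable_muT mv vu iu.
split => //; first exact: L1T_intro.
move=> f sf; rewrite -H//.
have i1 := smooth_mul_integrable iu (smooth_derive sf).
have i2 := smooth_mul_integrable iv (smooth_derive sf).
rewrite /Rintegral; congr fine; apply: ae_eq_integral => //.
- exact: measurable_int i2.
- exact: measurable_int i1.
- by apply: ae_imp vu => x -> _.
Qed.

Lemma H1T_ae u v : periodic v 1 -> measurable_fun [set: R] v ->
  {ae muT, forall x, v x = u x} -> H1T u -> H1T v.
Proof.
move=> pv mv vu /H1T_wderiv[Lu Lg wu].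
exact: H1T_intro (L2T_ae pv mv vu Lu) Lg (weak_derivative_ae pv mv vu wu).
Qed.

Lemma H1T_lin (a : R) u v : H1T u -> H1T v -> H1T (a *: u + v).
Proof.
move=> /H1T_wderiv[Lu Lu' wu] /H1T_wderiv[Lv Lv' wv].
apply: (H1T_intro _ _ (weak_derivative_lin a wu wv)); exact: L2T_lin.
Qed.

Lemma weak_derivative0 : weak_derivative (0 : R -> R) 0.
Proof.
have L0 : LpT 1%E (0 : R -> R) by apply: L2T_L1T; exact: L2T0.
split=> // f _; rewrite -[LHS]opprK; congr (- _).
have H (h : R -> R) : \int[muT]_x ((0 : R -> R) x * h x) = 0.
  under eq_Rintegral do rewrite mul0r.
  by rewrite Rintegral_cst// mul0r.
by rewrite !H oppr0.
Qed.

(** [H2T] asks for regularity of the chosen representative [wderiv u]; it is transferred from [g],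
    which agrees with it almost everywhere. *)
Lemma H2T_intro u g g2 : L2T u -> L2T g -> L2T g2 ->
  weak_derivative u g -> weak_derivative g g2 -> H2T u.
Proof.
move=> Lu Lg Lg2 ug gg2; have Hu := H1T_intro Lu Lg ug; split => //.
have [_ Lu' wu] := H1T_wderiv Hu.
apply: H1T_ae (wderiv_ae ug) (H1T_intro Lg Lg2 gg2); first exact: Lu'.1.
exact: L2T_measurable.
Qed.

Lemma H2T_linear : linear_subspace (@H2T R).
Proof.
split; first exact: H2T_intro L2T0 L2T0 L2T0 weak_derivative0 weak_derivative0.
move=> a u v [Hu Hu'] [Hv Hv'].
have [Lu Lu' wu] := H1T_wderiv Hu; have [Lv Lv' wv] := H1T_wderiv Hv.
have [_ Lu2 wu2] := H1T_wderiv Hu'; have [_ Lv2 wv2] := H1T_wderiv Hv'.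
apply: (H2T_intro _ _ _ (weak_derivative_lin a wu wv) (weak_derivative_lin a wu2 wv2));
  exact: L2T_lin.
Qed.

Lemma H2T_wderiv u : H2T u -> [/\ L2T u, L2T (wderiv u), L2T (wderiv (wderiv u)),
   weak_derivative u (wderiv u) & weak_derivative (wderiv u) (wderiv (wderiv u))].
Proof. by move=> [/H1T_wderiv[Lu Lu' wu] /H1T_wderiv[_ Lu2 wu2]]; split. Qed.

Lemma H2normE u : H2T u -> H2norm u =
  (Num.sqrt (l2 u ^+ 2 + l2 (wderiv u) ^+ 2 + l2 (wderiv (wderiv u)) ^+ 2))%:E.
Proof.
move=> /H2T_wderiv[Lu Lu' Lu2 _ _]; rewrite /H2norm !L2norm_fin// -!EFin_expe.
rewrite -!EFinD poweR_EFin powR12_sqrt// !addr_ge0// sqr_ge0//.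
Qed.

Lemma l2_le_H2norm u : H2T u -> ((l2 (wderiv (wderiv u)))%:E <= H2norm u)%E.
Proof.
move=> Hu; rewrite (H2normE Hu) lee_fin -[leLHS]ger0_norm ?l2_ge0// -sqrtr_sqr.
by rewrite ler_wsqrtr// lerDr addr_ge0// sqr_ge0.
Qed.

(** [wderiv 0] is a chosen representative, known to be 0 only almost everywhere, so the norms are
    compared through [l2_ae_eq]. *)
Lemma H2norm0 : H2norm (0 : R -> R) = 0%E.
Proof.
have H0 := H2T_linear.1; rewrite (H2normE H0).
have [L0 L1 L2 w1 w2] := H2T_wderiv H0.
have e1 : {ae muT, forall x, wderiv 0 x = (0 : R -> R) x} := wderiv_ae weak_derivative0.
have e2 : {ae muT, forall x, wderiv (wderiv 0) x = (0 : R -> R) x}.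
  apply: wderiv_ae; apply: weak_derivative_ae e1 weak_derivative0; first exact: L1.1.
  exact: L2T_measurable.
rewrite (l2_ae_eq L1 L2T0 _); last by apply: ae_imp e1.
rewrite (l2_ae_eq L2 L2T0 _); last by apply: ae_imp e2.
by rewrite l2_0 expr0n/= !addr0 sqrtr0.
Qed.

Lemma H2T_dense : dense_for H2norm (@H2T R) H2T.
Proof.
split=> // u Hu e e0; exists u => //.
by rewrite subrr H2norm0 lte_fin.
Qed.

End sobolev.

(** * Consistency *)

Section rescaling.
Context {R : realType}.
Local Notation mu := (@lebesgue_measure R).
Implicit Types u f : R -> R.

Lemma ge0_integral_dilate (e : R) (f : R -> \bar R) : 0 < e ->
  measurable_fun [set: R] f -> (forall x, (0 <= f x)%E) ->
  (\int[mu]_x f (x / e)%R = e%:E * \int[mu]_x f x)%E.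
Proof.
move=> e0 mf f0; rewrite -{2}(invrK e) -(@ge0_integral_affine R e^-1 0)//; last by rewrite invr_gt0.
by apply: eq_integral => x _; rewrite addr0 mulrC.
Qed.

Lemma Rintegral_dilate (e : R) f : 0 < e -> mu.-integrable setT (EFin \o f) ->
  \int[mu]_x f (x / e) = e * \int[mu]_x f x.
Proof.
move=> e0 if_; have /integrableP[mf _] := if_.
have ip := integrable_funepos measurableT if_.
have in_ := integrable_funeneg measurableT if_.
rewrite /Rintegral [in LHS]integralE [in RHS]integralE.
have -> : (\int[mu]_x ((fun y => (f (y / e)%R)%:E)^\+%E x) =
           \int[mu]_x ((EFin \o f)^\+%E (x / e)%R))%E.
  by apply: eq_integral => x _; rewrite !funeposE.
have -> : (\int[mu]_x ((fun y => (f (y / e)%R)%:E)^\-%E x) =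
           \int[mu]_x ((EFin \o f)^\-%E (x / e)%R))%E.
  by apply: eq_integral => x _; rewrite !funenegE.
rewrite !ge0_integral_dilate//.
- rewrite -(fineK (integrable_fin_num measurableT ip)).
  rewrite -(fineK (integrable_fin_num measurableT in_)).
  by rewrite -!EFinM -!EFinB /= mulrBr.
- exact: measurable_funeneg.
- exact: measurable_funepos.
Qed.

Variables (eta : R -> R) (e : R).
Hypothesis e0 : 0 < e.
Hypothesis eta_L1 : mu.-integrable [set: R] (EFin \o eta).
Hypothesis eta_odd : {ae mu, forall z : R, eta (- z) = - eta z}.
Hypothesis eta_mean : \int[mu]_z eta z = 0.
Hypothesis eta_moment : \int[mu]_z (z * eta z) = -1.
Hypothesis C_eta_fin : ((2^-1)%:E * \int[mu]_z (`|z| ^+ 2 * `|eta z|)%:E < +oo)%E.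

Definition rescaled : R -> R := fun z => e ^- 2 * eta (z / e).

Let meta : measurable_fun [set: R] eta.
Proof. by have /measurable_EFinP := measurable_int _ eta_L1. Qed.

Let mmom (k : nat) : measurable_fun [set: R] (fun z => (`|eta z| * `|z| ^+ k)%:E).
Proof.
apply/measurable_EFinP; apply: measurable_funM; first exact: measurableT_comp.
by apply: measurable_funX; exact: (@normr_measurable R setT).
Qed.

Lemma measurable_rescaled : measurable_fun [set: R] rescaled.
Proof.
apply: measurable_funM => //; apply: (measurableT_comp meta).
exact: measurable_funM.
Qed.

Lemma rescaled_odd : {ae mu, forall z, rescaled (- z) = - rescaled z}.
Proof.
have e' : 0 < e^-1 by rewrite invr_gt0.
apply: ae_imp (ae_affine 0 e' eta_odd) => x.
by rewrite addr0 [e^-1 * x]mulrC /rescaled mulNr => ->; rewrite mulrN.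
Qed.

Definition abs_moment (k : nat) : R := fine (\int[mu]_z (`|eta z| * `|z| ^+ k)%:E).

Let C2 : (\int[mu]_z (`|eta z| * `|z| ^+ 2)%:E < +oo)%E.
Proof.
rewrite (_ : \int[mu]_z _ = \int[mu]_z (`|z| ^+ 2 * `|eta z|)%:E)%E; last first.
  by apply: eq_integral => z _; rewrite mulrC.
move: C_eta_fin; set I := (\int[_]_z _)%E.
have I0 : (0 <= I)%E by apply: integral_ge0 => z _; rewrite lee_fin mulr_ge0// exprn_ge0.
move=> H; rewrite -[I]mul1e -(@divff _ (2 : R))// EFinM -muleA.
by rewrite lte_mul_pinfty.
Qed.

Let C0 : (\int[mu]_z (`|eta z| * `|z| ^+ 0)%:E < +oo)%E.
Proof.
have /integrableP[_] := eta_L1; congr (_ < _)%E.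
by apply: eq_integral => z _; rewrite expr0 mulr1.
Qed.

(** The first moment is controlled by the moments of orders 0 and 2, as t <= 1 + t^2. *)
Let C1 : (\int[mu]_z (`|eta z| * `|z| ^+ 1)%:E < +oo)%E.
Proof.
apply: (@le_lt_trans _ _ (\int[mu]_z ((`|eta z| * `|z| ^+ 0)%:E + (`|eta z| * `|z| ^+ 2)%:E))%E).
  apply: ge0_le_integral => //.
  - exact: mmom.
  - exact: (emeasurable_funD (mmom 0) (mmom 2)).
  - move=> z _; rewrite -EFinD lee_fin -mulrDr; apply: ler_wpM2l => //.
    by rewrite expr0 expr1; have := sqr_ge0 (`|z| - 1); rewrite sqrrB; have := normr_ge0 z; nra.
rewrite ge0_integralD//; first exact: lte_add_pinfty.
all: first [exact: mmom|by move=> z _; rewrite lee_fin mulr_ge0// exprn_ge0].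
Qed.

Lemma abs_momentE (k : nat) : (k <= 2)%N ->
  (\int[mu]_z (`|eta z| * `|z| ^+ k)%:E = (abs_moment k)%:E)%E.
Proof.
move=> k2; rewrite fineK// ge0_fin_numE.
  by case: k k2 => [|[|[|]]].
by apply: integral_ge0 => z _; rewrite lee_fin mulr_ge0// exprn_ge0.
Qed.

Lemma abs_moment_ge0 k : 0 <= abs_moment k.
Proof. by apply: fine_ge0; apply: integral_ge0 => z _; rewrite lee_fin mulr_ge0// exprn_ge0. Qed.

(** The amplitude gives e^-2, the weight e^k and the substitution e, in total e^(k-1). For k = 0
    this is the size 1/e of the operator norm, for k = 1 a growth rate free of e, for k = 2 the
    order of consistency. *)
Lemma rescaled_moment (k : nat) : (k <= 2)%N ->
  (\int[mu]_z (`|rescaled z| * `|z| ^+ k)%:E = (e ^+ k / e * abs_moment k)%:E)%E.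
Proof.
move=> k2.
have e'0 : 0 <= e ^- 2 * e ^+ k by rewrite mulr_ge0 ?invr_ge0 ?exprn_ge0// ltW.
transitivity (\int[mu]_z ((e ^- 2 * e ^+ k)%:E * (`|eta (z / e)| * `|z / e| ^+ k)%:E))%E.
  apply: eq_integral => z _; rewrite -EFinM /rescaled normrM (ger0_norm (_ : 0 <= e ^- 2)); last first.
    by rewrite invr_ge0 exprn_ge0// ltW.
  rewrite normrM exprMn (ger0_norm (_ : 0 <= e^-1)) ?invr_ge0 ?(ltW e0)// exprVn.
  congr EFin; field; rewrite ?expf_neq0//; exact: lt0r_neq0.
rewrite ge0_integralZl//.
- rewrite (ge0_integral_dilate e0 (mmom k)); last by move=> z; rewrite lee_fin mulr_ge0// exprn_ge0.
  rewrite abs_momentE// -!EFinM; congr EFin.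
  by field; exact: lt0r_neq0.
- apply: (measurableT_comp (mmom k)); exact: measurable_funM.
Qed.

Lemma rescaled_L1 : (\int[mu]_z `|rescaled z|%:E = (e^-1 * abs_moment 0)%:E)%E.
Proof.
have := rescaled_moment (leq0n 2); rewrite expr0 div1r => <-.
by apply: eq_integral => z _; rewrite expr0 mulr1.
Qed.

Lemma rescaled_M1 : (\int[mu]_z (`|rescaled z| * `|z|)%:E = (abs_moment 1)%:E)%E.
Proof.
have := @rescaled_moment 1 isT; rewrite expr1 divff ?lt0r_neq0// mul1r => <-.
by apply: eq_integral => z _; rewrite expr1.
Qed.

Lemma rescaled_M2 : (\int[mu]_z (`|rescaled z| * `|z| ^+ 2)%:E = (e * abs_moment 2)%:E)%E.
Proof.
rewrite rescaled_moment//; congr EFin; congr (_ * _).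
by rewrite expr2 mulfK// lt0r_neq0.
Qed.

Lemma abs_moment1 : abs_moment 1 = \int[mu]_z (`|z| * `|eta z|).
Proof. by rewrite /abs_moment /Rintegral; congr fine; apply: eq_integral => z _; rewrite expr1 mulrC. Qed.

Lemma rescaled_integrable : mu.-integrable setT (EFin \o rescaled).
Proof.
apply/integrableP; split; first by apply/measurable_EFinP; exact: measurable_rescaled.
by rewrite (_ : (\int[mu]_x _ = (e^-1 * abs_moment 0)%:E)%E) ?ltry//; exact: rescaled_L1.
Qed.

Lemma id_eta_integrable : mu.-integrable setT (EFin \o (fun z => z * eta z)).
Proof.
apply/integrableP; split; first by apply/measurable_EFinP; exact: measurable_funM.
apply: le_lt_trans C1; rewrite le_eqVlt; apply/orP; left; apply/eqP.
by apply: eq_integral => z _ /=; rewrite normrM mulrC expr1.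
Qed.

Lemma id_rescaled_integrable : mu.-integrable setT (EFin \o (fun z => z * rescaled z)).
Proof.
apply/integrableP; split.
  by apply/measurable_EFinP; apply: measurable_funM => //; exact: measurable_rescaled.
rewrite (_ : (\int[mu]_x _ = (abs_moment 1)%:E)%E) ?ltry//.
by rewrite -rescaled_M1; apply: eq_integral => z _ /=; rewrite normrM mulrC.
Qed.

Lemma rescaled_mean : \int[mu]_z rescaled z = 0.
Proof.
have ed : mu.-integrable setT (EFin \o (fun z => eta (z / e))).
  have := integrableZl measurableT (e ^+ 2) rescaled_integrable.
  rewrite (_ : (fun _ => _) = EFin \o (fun z => eta (z / e)))//.
  apply/funext => z /=; rewrite -EFinM /rescaled mulrA divff ?mul1r//.
  by rewrite expf_neq0// lt0r_neq0.
by rewrite /rescaled RintegralZl// (Rintegral_dilate e0 eta_L1) eta_mean !mulr0.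
Qed.

Lemma rescaled_first_moment : \int[mu]_z (z * rescaled z) = -1.
Proof.
have en : e != 0 by exact: lt0r_neq0.
have E z : z * rescaled z = e^-1 * (z / e * eta (z / e)).
  by rewrite /rescaled; field.
have ed : mu.-integrable setT (EFin \o (fun z => z / e * eta (z / e))).
  have := integrableZl measurableT e id_rescaled_integrable.
  rewrite (_ : (fun _ => _) = EFin \o (fun z => z / e * eta (z / e)))//.
  by apply/funext => z /=; rewrite -EFinM E mulrA divff ?mul1r.
under eq_Rintegral do rewrite E.
rewrite RintegralZl//.
by rewrite (Rintegral_dilate e0 id_eta_integrable) eta_moment mulrA mulVf// mul1r.
Qed.

End rescaling.

(** * Taylor remainder and consistency error *)

Section consistency.
Context {R : realType}.
Local Notation mu := (@lebesgue_measure R).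
Implicit Types u g h f : R -> R.

Section taylor.
Variables (g g2 : R -> R) (c : R).
Hypotheses (pg : forall x, g (x + 1) = g x) (ig : muT.-integrable setT (EFin \o g)).
Hypotheses (pg2 : forall x, g2 (x + 1) = g2 x) (ig2 : muT.-integrable setT (EFin \o g2)).
Hypothesis gE : {ae mu, forall x, g x = c + prim g2 x}.

Let N (a b : R) := \int[mu]_(t in `[a, b[) `|g2 t|.

Let iN (a b : R) : mu.-integrable `[a, b[ (EFin \o (fun t => `|g2 t|)).
Proof. exact: integrable_norm (periodic_integrable pg2 ig2 a b). Qed.

Let N_mono (a b a' b' : R) : a' <= a -> b <= b' -> N a b <= N a' b'.
Proof.
move=> ha hb; rewrite -lee_fin /N /Rintegral.
rewrite fineK; last exact: integrable_fin_num (iN a b).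
rewrite fineK; last exact: integrable_fin_num (iN a' b').
apply: ge0_subset_integral => //; first exact: measurable_int (iN a' b').
by move=> t /=; rewrite !in_itv/= => /andP[h1 h2]; rewrite (le_trans ha h1) (lt_le_trans h2 hb).
Qed.

(** On [a, b[ the values of [g] differ from [g x] by an integral of [g2] within that interval, at
    most [N a b] in absolute value. The formula for [g x] is assumed at this very point because [gE]
    holds only almost everywhere. *)
Lemma taylor_gi (a b x : R) : a <= x <= b -> g x = c + prim g2 x ->
  `|gi g a b - (b - a) * g x| <= N a b * (b - a).
Proof.
move=> /andP[ax xb] gx; have ab := le_trans ax xb.
have iab := periodic_integrable pg ig a b.
have ic : mu.-integrable `[a, b[ (EFin \o (cst (g x) : R -> R)).
  exact: (@periodic_integrable R _ _ (smooth_integrable (smooth_cst (g x)))).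
have -> : gi g a b - (b - a) * g x = \int[mu]_(t in `[a, b[) (g t - g x).
  rewrite (RintegralB _ iab ic)// Rintegral_cst//.
  have -> : fine (mu `[a, b[) = b - a.
    rewrite lebesgue_measure_itv/= lte_fin; case: ltP => //= ba.
    by apply/esym/eqP; rewrite subr_eq0 eq_le ab ba.
  by rewrite mulrC.
apply: norm_Rintegral_le => //.
- exact: (integrableB _ iab ic).
- by apply: Rintegral_ge0.
apply: ae_imp gE => t gt /andP[t1 t2].
rewrite gt gx opprD addrACA subrr add0r.
have [tx|xt] := leP t x.
  rewrite distrC (prim_sub pg2 ig2 tx); apply: le_trans (gi_norm pg2 ig2 t x) _.
  exact: N_mono.
rewrite (prim_sub pg2 ig2 (ltW xt)); apply: le_trans (gi_norm pg2 ig2 x t) _.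
by apply: N_mono => //; exact: ltW.
Qed.

(** The interval between x - z and x lies within distance |z| of x; enlarging it to |s| <= |z|, with
    t = x - s, gives a bound in convolution form, ready for Young's inequality. *)
Lemma taylor_conv (x z : R) : g x = c + prim g2 x ->
  ((`|prim g (x - z) - prim g x + z * g x|)%:E <=
   \int[mu]_s (`|z| * (if (`|s| <= `|z|)%R then `|g2 (x - s)| else 0))%:E)%E.
Proof.
move=> gx.
have mg2 : measurable_fun [set: R] g2 by have /measurable_EFinP := measurable_int _ ig2.
have mF : measurable_fun [set: R] (fun s => (if `|s| <= `|z| then `|g2 (x - s)| else 0)%:E).
  apply/measurable_EFinP; apply: measurable_fun_ifT => //.
    by apply: measurable_fun_ler => //; exact: (@normr_measurable R setT).
  apply: (measurableT_comp (@normr_measurable R setT)); apply: (measurableT_comp mg2).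
  exact: measurable_funB.
have H (a b : R) : a <= x <= b -> b - a = `|z| ->
    ((N a b * (b - a))%:E <=
   \int[mu]_s (`|z| * (if (`|s| <= `|z|)%R then `|g2 (x - s)| else 0))%:E)%E.
  move=> /andP[ax xb] bz; rewrite bz mulrC EFinM.
  under eq_integral do rewrite EFinM.
  rewrite ge0_integralZl//; last by move=> s _; rewrite lee_fin; case: ifP.
  apply: lee_wpmul2l; first by rewrite lee_fin.
  rewrite /N /Rintegral fineK; last exact: integrable_fin_num (iN a b).
  rewrite integral_mkcond -(@integral_reflect R x); last first.
    have [+ _] := measurable_restrictT (EFin \o (fun t => `|g2 t|)) (measurable_itv `[a, b[).
    by apply; exact: measurable_int (iN a b).
  apply: ge0_le_integral => //.
  - by move=> s _; rewrite /patch; case: ifP => // _; rewrite lee_fin.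
  - have [+ _] := measurable_restrictT (EFin \o (fun t => `|g2 t|)) (measurable_itv `[a, b[).
    move=> /(_ (measurable_int _ (iN a b))) mr.
    by apply: (measurableT_comp mr); exact: measurable_funB.
  - move=> s _; rewrite /patch mem_setE in_itv/=; case: ifP => [/andP[h1 h2]|_].
      rewrite (_ : `|s| <= `|z|)// -bz ler_norml; apply/andP; split; lra.
    by rewrite lee_fin; case: ifP.
have [z0|z0] := leP 0 z.
  have xz : x - z <= x by lra.
  rewrite (_ : prim g (x - z) - prim g x + z * g x =
    - (gi g (x - z) x - (x - (x - z)) * g x)); last first.
    by rewrite -(prim_sub pg ig xz); ring.
  rewrite normrN; apply: le_trans (H (x - z) x _ _); last 2 first.
  - by rewrite xz lexx.
  - by rewrite ger0_norm//; ring.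
  by rewrite lee_fin; apply: taylor_gi => //; rewrite xz lexx.
have xz : x <= x - z by lra.
rewrite (_ : prim g (x - z) - prim g x + z * g x = gi g x (x - z) - (x - z - x) * g x); last first.
  by rewrite -(prim_sub pg ig xz); ring.
apply: le_trans (H x (x - z) _ _); last 2 first.
- by rewrite xz lexx.
- by rewrite ltr0_norm//; ring.
by rewrite lee_fin; apply: taylor_gi => //; rewrite xz lexx.
Qed.

End taylor.

Section error_bound.
Variables (h : R -> R) (W M1 M2 : R).
Hypothesis mh : measurable_fun [set: R] h.
Hypothesis hW : (\int[mu]_z (`|h z|)%:E = W%:E)%E.
Hypothesis hM1 : (\int[mu]_z (`|h z| * `|z|)%:E = M1%:E)%E.
Hypothesis hM2 : (\int[mu]_z (`|h z| * `|z| ^+ 2)%:E = M2%:E)%E.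
Hypothesis h_mean : \int[mu]_z h z = 0.
Hypothesis h_moment : \int[mu]_z (z * h z) = -1.

(* Taylor's formula bounds the remainder at [x] by the integral over [z] of
   [`|h z| * `|z|] times the integral of [`|u''(x - s)|] over [`|s| <= `|z|],
   which is the convolution of [`|u''|] with the kernel [w] below. *)
Let q (z s : R) : R := `|h z| * `|z| * (if `|s| <= `|z| then 1 else 0).
Let w (s : R) : R := fine (\int[mu]_z (q z s)%:E).

Let q0 z s : 0 <= q z s.
Proof. by rewrite mulr_ge0 ?mulr_ge0//; case: ifP. Qed.

Let mn : measurable_fun [set: R] (fun x : R => `|x|).
Proof. exact: (@normr_measurable R setT). Qed.

Let mhz : measurable_fun [set: R] (fun z => `|h z| * `|z|).
Proof. by apply: measurable_funM => //; exact: (measurableT_comp mn mh). Qed.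

Let mq : measurable_fun [set: measurableTypeR R * measurableTypeR R] (fun p => q p.1 p.2).
Proof.
apply: measurable_funM; first exact: (measurableT_comp mhz measurable_fst).
apply: measurable_fun_ifT => //.
by apply: measurable_fun_ler; [exact: (measurableT_comp mn measurable_snd)|
  exact: (measurableT_comp mn measurable_fst)].
Qed.

Let mqs : measurable_fun [set: measurableTypeR R * measurableTypeR R] (fun p => q p.2 p.1).
Proof.
apply: measurable_funM; first exact: (measurableT_comp mhz measurable_snd).
apply: measurable_fun_ifT => //.
by apply: measurable_fun_ler; [exact: (measurableT_comp mn measurable_fst)|
  exact: (measurableT_comp mn measurable_snd)].
Qed.

Let wE s : ((w s)%:E = \int[mu]_z (q z s)%:E)%E.
Proof.
rewrite /w fineK// ge0_fin_numE; last by apply: integral_ge0 => z _; rewrite lee_fin.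
apply: (@le_lt_trans _ _ M1%:E); last by rewrite ltry.
rewrite -hM1; apply: ge0_le_integral => //.
- by move=> z _; rewrite lee_fin.
- apply/measurable_EFinP; apply: measurable_funM; first exact: mhz.
  by apply: measurable_fun_ifT => //; exact: measurable_fun_ler.
- exact/measurable_EFinP.
- move=> z _; rewrite lee_fin /q -[leRHS]mulr1; apply: ler_wpM2l; first exact: mulr_ge0.
  by case: ifP.
Qed.

Let w0 s : 0 <= w s.
Proof. by apply: fine_ge0; apply: integral_ge0 => z _; rewrite lee_fin. Qed.

Let mw : measurable_fun [set: R] w.
Proof.
apply/measurable_EFinP; rewrite (_ : EFin \o w = fun s => \int[mu]_z (q z s)%:E)%E; last first.
  by apply/funext => s; rewrite /= wE.
apply: (@measurable_integral_snd R (fun s z => (q z s)%:E)).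
- exact/measurable_EFinP.
- by move=> s z; rewrite lee_fin.
Qed.

(** Tonelli: for fixed z the interval |s| <= |z| has length 2 |z|, which turns the weight |h z| |z|
    into 2 |h z| |z|^2. *)
Let wW : (\int[mu]_s (w s)%:E = (2 * M2)%:E)%E.
Proof.
under eq_integral do rewrite wE.
rewrite (_ : (\int[mu]_s _ = \int[mu]_z \int[mu]_s (q z s)%:E)%E); last first.
  apply: (@fubini_tonelli _ _ _ _ _ mu mu (fun p => (q p.2 p.1)%:E)).
    exact/measurable_EFinP.
  by move=> p; rewrite lee_fin.
rewrite EFinM -hM2 -ge0_integralZl//; last first.
  apply/measurable_EFinP; apply: measurable_funM; first exact: (measurableT_comp mn mh).
  exact: measurable_funX.
apply: eq_integral => z _.
have -> : (\int[mu]_s (q z s)%:E = \int[mu]_(s in `[(- `|z|)%R, `|z|%R]) (cst (`|h z| * `|z|)%R%:E s))%E.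
  rewrite [RHS]integral_mkcond; apply: eq_integral => s _.
  by rewrite /patch mem_setE in_itv/= -ler_norml /q; case: ifP; rewrite ?mulr1 ?mulr0.
have -> : (\int[mu]_(s in `[(- `|z|)%R, `|z|%R]) (cst (`|h z| * `|z|)%R%:E s) =
   (`|h z| * `|z|)%R%:E * mu `[(- `|z|)%R, `|z|%R])%E by exact: integral_cst.
have -> : (mu `[(- `|z|)%R, `|z|%R] = (2 * `|z|)%R%:E)%E.
  rewrite lebesgue_measure_itv/= lte_fin; case: ltP => [_|z0].
    by rewrite -EFinB; congr EFin; ring.
  by have z1 := normr_ge0 z; rewrite (_ : 2 * `|z| = 0)//; lra.
by rewrite -!EFinM; congr EFin; ring.
Qed.

(** The error is dominated almost everywhere by the convolution of |u''| with [w], so [dominated_L2]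
    bounds its norm by the mass 2 M2 of [w]. *)
Lemma convT_sub_wderiv u (f := fun x => convT h u x - wderiv u x) : H2T u ->
  L2T f /\ l2 f <= 2 * M2 * l2 (wderiv (wderiv u)).
Proof.
move=> /H2T_wderiv[Lu Lg Lg2 wu wg].
set g := wderiv u in Lg wu wg f *; set g2 := wderiv g in Lg2 wg *.
have ig := L1T_integrable (L2T_L1T Lg); have ig2 := L1T_integrable (L2T_L1T Lg2).
have mg2 := L2T_measurable Lg2.
have [c uE] := weak_derivative_prim wu; have [c' gE] := weak_derivative_prim wg.
have ih : mu.-integrable setT (EFin \o h).
  apply/integrableP; split; first exact/measurable_EFinP.
  by rewrite (_ : (\int[mu]_x _ = W%:E)%E) ?ltry.
have izh : mu.-integrable setT (EFin \o (fun z => z * h z)).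
  apply/integrableP; split; first by apply/measurable_EFinP; exact: measurable_funM.
  rewrite (_ : (\int[mu]_x _ = M1%:E)%E) ?ltry// -hM1.
  by apply: eq_integral => z _ /=; rewrite normrM mulrC.
apply: (dominated_L2 mw w0 wW Lg2).
- by move=> x; rewrite /f convT_periodic ?Lg.1//; exact: Lu.1.
- apply: measurable_funB; last exact: L2T_measurable.
  by apply: convT_measurable => //; exact: L2T_measurable.
have uE' : {ae muT, forall x, u x = c + prim g x} by apply/ae_muT; apply: ae_imp uE.
have gE' : {ae muT, forall x, g x = c' + prim g2 x} by apply/ae_muT; apply: ae_imp gE.
have ugE : {ae muT, forall x, u x = c + prim g x /\ g x = c' + prim g2 x}.
  by apply: ae_imp2 uE' gE'.
apply: ae_imp2 (ae_conv_integrable mh hW Lu) ugE => x cx [ux gx].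
have mgx : measurable_fun [set: R] (fun s => g2 (x - s)).
  by apply: (measurableT_comp mg2); exact: measurable_funB.
have mqg : measurable_fun [set: measurableTypeR R * measurableTypeR R]
    (fun p => (q p.1 p.2 * `|g2 (x - p.2)|)%:E).
  apply/measurable_EFinP; apply: measurable_funM => //.
  by apply: (measurableT_comp mn); exact: (measurableT_comp mgx measurable_snd).
(* The mean zero of [h] allows the subtraction of u x, and the first moment -1 makes the term z g x
   account for - g x; thus the integral of [r] is the error at [x]. *)
pose r z := h z * (u (x - z) - u x + z * g x).
have ir : mu.-integrable setT (EFin \o r).
  have := integrableD measurableT (integrableB measurableT cx (integrableZl measurableT (u x) ih))
    (integrableZl measurableT (g x) izh).
  apply: eq_integrable => // z _ /=; rewrite -!EFinM -EFinB -EFinD /r; congr EFin; ring.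
have -> : f x = \int[mu]_z r z.
  transitivity (\int[mu]_z (h z * u (x - z) - u x * h z + g x * (z * h z))); last first.
    by apply: eq_Rintegral => z _; rewrite /r; ring.
  have iuh := integrableZl measurableT (u x) ih; have igh := integrableZl measurableT (g x) izh.
  rewrite (RintegralD measurableT (integrableB measurableT cx iuh) igh).
  rewrite (RintegralB measurableT cx iuh) !RintegralZl// h_mean h_moment.
  by rewrite /f (convTE Lu.1 cx) mulr0 subr0 mulrN1.
apply: (@le_trans _ _ (\int[mu]_z `|r z|%:E)%E).
  have iN := integrable_norm ir.
  apply: (@le_trans _ _ (\int[mu]_z `|r z|)%:E).
    by rewrite lee_fin; exact: le_normr_Rintegral ir.
  by rewrite /Rintegral fineK//; exact: integrable_fin_num iN.
apply: (@le_trans _ _ (\int[mu]_z \int[mu]_s (q z s * `|g2 (x - s)|)%:E)%E).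
  apply: ae_ge0_le_integral => //.
  - exact: (measurable_int _ (integrable_norm ir)).
  - by move=> z _; apply: integral_ge0 => s _; rewrite lee_fin mulr_ge0.
  - apply: (@measurable_integral_snd R (fun z s => (q z s * `|g2 (x - s)|)%:E)).
      exact: mqg.
    by move=> z s; rewrite lee_fin mulr_ge0.
  (* For fixed [x], a reflection and a translation transport the null set of [uE] to the variable
     z. *)
  have : {ae mu, forall z, u (x - z) = c + prim g (x - z)}.
    have := ae_opp (ae_shift x uE).
    by apply: ae_imp => z; rewrite addrC.
  apply: ae_imp => z uz _.
  rewrite /r uz ux normrM (_ : c + _ - _ + _ = prim g (x - z) - prim g x + z * g x); last by ring.
  rewrite EFinM.
  apply: le_trans (lee_wpmul2l _ (taylor_conv (L2T_periodic Lg) ig (L2T_periodic Lg2) ig2 gE z gx)) _.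
    by rewrite lee_fin.
  rewrite -ge0_integralZl//.
  - rewrite le_eqVlt; apply/orP; left; apply/eqP; apply: eq_integral => s _.
    by rewrite -EFinM /q; congr EFin; case: ifP => _; ring.
  - apply/measurable_EFinP; apply: measurable_funM => //.
    apply: measurable_fun_ifT => //; first exact: measurable_fun_ler.
    exact: (measurableT_comp mn mgx).
  - by move=> s _; rewrite lee_fin mulr_ge0//; case: ifP.
(* Integrating first in z makes the weight [w s] appear, and with it the convolution with |u''|. *)
rewrite (_ : (\int[mu]_z \int[mu]_s (q z s * `|g2 (x - s)|)%:E =
              \int[mu]_s \int[mu]_z (q z s * `|g2 (x - s)|)%:E)%E); last first.
  apply: (@fubini_tonelli _ _ _ _ _ mu mu (fun p => (q p.1 p.2 * `|g2 (x - p.2)|)%:E)) => //.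
  by move=> p; rewrite lee_fin mulr_ge0.
rewrite le_eqVlt; apply/orP; left; apply/eqP; apply: eq_integral => s _.
rewrite EFinM wE; under eq_integral do rewrite EFinM.
rewrite ge0_integralZr//.
- apply/measurable_EFinP; apply: measurable_funM; first exact: mhz.
  by apply: measurable_fun_ifT => //; exact: measurable_fun_ler.
- by move=> z _; rewrite lee_fin.
Qed.

End error_bound.
End consistency.

(** * The core *)

Section core_approximation.
Context {R : realType}.
Local Notation mu := (@lebesgue_measure R).
Implicit Types u g h f k : R -> R.

Lemma L1_le_l2 f : L2T f -> \int[muT]_x `|f x| <= l2 f.
Proof.
move=> Lf; have mf := L2T_measurable Lf.
have iN := integrable_norm (L1T_integrable (L2T_L1T Lf)).
rewrite -ler_sqr ?nnegrE ?l2_ge0//; last by apply: Rintegral_ge0.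
rewrite -lee_fin l2_sqr// EFin_expe /Rintegral fineK; last exact: integrable_fin_num iN.
have mn : measurable_fun [set: R] (fun x => `|f x|).
  exact: measurableT_comp.
have := @cauchy_schwarz _ _ R muT (cst 1) (fun x => `|f x|) (measurable_cst _) mn
  (fun=> ler01) (fun x => normr_ge0 (f x)).
have -> : (\int[muT]_x (cst (1 : R) x)%:E = 1)%E.
  transitivity (\int[muT]_x (cst 1%:E x : \bar R))%E; first by [].
  by rewrite integral_cst// muT_setT mule1.
rewrite mul1e.
under eq_integral do rewrite mul1r.
under [X in (_ <= X)%E]eq_integral do rewrite mul1r real_normK ?num_real//.
by [].
Qed.

(** Dominated convergence for the squares, with G^2 as dominating function. *)
Lemma L2_dominated_vanish (f : nat -> R -> R) (G : R -> R) :
  (forall n, L2T (f n)) -> L2T G -> (forall n x, `|f n x| <= `|G x|) ->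
  {ae muT, forall x, f n x @[n --> \oo] --> 0} ->
  forall d : R, 0 < d -> exists n, l2 (f n) < d.
Proof.
move=> Lf LG fG f0 d d0.
have [||||| _ _ +] := @dominated_convergence _ _ _ muT setT measurableT
  (fun n x => (f n x ^+ 2)%:E) (cst 0%E) (fun x => (G x ^+ 2)%:E).
- by move=> n; apply: measurable_sqr_EFin; exact: L2T_measurable.
- exact: measurable_cst.
- apply: ae_imp f0 => x fx _; apply: cvg_EFin; first by apply: nearW.
  rewrite /= -(mulr0 0) (_ : _ \o _ = fun n => f n x * f n x); last first.
    by apply/funext => n /=; rewrite expr2.
  exact: cvgM.
- exact: (L2T_sqr_integrable LG).
- apply: aeW => x n _; rewrite lee_fin normrX.
  by rewrite -[leRHS]real_normK ?num_real// ler_sqr ?nnegrE.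
rewrite integral0 => H.
have d2 : 0 < d ^+ 2 by rewrite exprn_gt0.
have H' : (\int[muT]_x (f n x ^+ 2)%:E)%E @[n --> \oo] --> (0 : R)%:E by exact: H.
have [N _ /(_ N (leqnn N)) /= HN] := cvgr_lt _ (fine_cvg H') _ d2.
by exists N; rewrite -ltr_sqr ?nnegrE ?l2_ge0 ?(ltW d0)// l2_sqrE.
Qed.

(** Truncation is by the level sets of |g|. The bound gained provides the constant that dominates
    all Steklov means in [steklov_approx]. *)
Lemma truncation_approx g (d : R) : L2T g -> 0 < d ->
  exists2 g1, L2T g1 /\ (exists2 M, 0 <= M & forall x, `|g1 x| <= M) & l2 (g - g1) < d.
Proof.
move=> Lg d0; have mg := L2T_measurable Lg.
pose t (n : nat) x := if `|g x| <= n%:R then g x else 0.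
have Lt n : L2T (t n).
  apply: L2T_intro.
  - by move=> x; rewrite /t Lg.1.
  - apply: measurable_fun_ifT => //; apply: measurable_fun_ler => //.
    exact: measurableT_comp.
  - apply: (@le_lt_trans _ _ (\int[muT]_x (g x ^+ 2)%:E)%E); last first.
      by rewrite -l2_sqr// ltry.
    apply: ge0_le_integral => //.
    + by move=> x _; rewrite lee_fin sqr_ge0.
    + apply: measurable_sqr_EFin; apply: measurable_fun_ifT => //; apply: measurable_fun_ler => //.
      exact: measurableT_comp.
    + exact: measurable_sqr_EFin.
    + by move=> x _; rewrite lee_fin /t; case: ifP => // _; rewrite expr0n sqr_ge0.
have [|n x||n Hn] := @L2_dominated_vanish (fun n => g - t n) g _ Lg _ _ d d0.
- by move=> n; exact: L2TB.
- by rewrite !fctE /t; case: ifP; rewrite ?subrr ?normr0 ?subr0.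
- apply: aeW => x; apply: cvg_near_cst.
  near=> n; rewrite !fctE /t ifT ?subrr//.
  by near: n; exact: nbhs_infty_ger.
exists (t n) => //; split => //; exists n%:R => // x.
by rewrite /t; case: ifP => // _; rewrite normr0.
Unshelve. all: by end_near. Qed.

(** * Steklov means of a bounded function *)

Section steklov.
Variables (g : R -> R) (M : R).
Hypotheses (Lg : L2T g) (M0 : 0 <= M) (gM : forall x, `|g x| <= M).

Let pg : forall x, g (x + 1) = g x := Lg.1.
Let ig := L1T_integrable (L2T_L1T Lg).
Let mg := L2T_measurable Lg.

(** The mean of [g] over [x, x + e], written as a difference quotient of the primitive so that its
    limit is a derivative. *)
Definition steklov (e : R) : R -> R := fun x => e^-1 * (prim g (x + e) - prim g x).

(** The primitive gains the mean of [g] over each period; this gain cancels in the difference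
    quotient, so the Steklov mean is periodic even when [g] has nonzero mean. *)
Let prim1 x : prim g (x + 1) = prim g x + \int[muT]_t g t.
Proof.
have x1 : x <= x + 1 by rewrite lerDl.
by rewrite -(gi_unit pg ig x) -(prim_sub pg ig x1) [RHS]addrC subrK.
Qed.

Lemma steklov_periodic e x : steklov e (x + 1) = steklov e x.
Proof. by rewrite /steklov [x + 1 + e]addrAC !prim1 opprD addrACA subrr addr0. Qed.

Lemma measurable_steklov e : measurable_fun [set: R] (steklov e).
Proof.
have mp := measurable_prim ig.
apply: measurable_funM => //; apply: measurable_funB => //.
by apply: (measurableT_comp mp); exact: measurable_funD.
Qed.

Lemma steklov_bounded e x : 0 < e -> `|steklov e x| <= M.
Proof.
move=> e0; have xe : x <= x + e by rewrite lerDl ltW.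
rewrite /steklov (prim_sub pg ig xe) normrM gtr0_norm ?invr_gt0//.
rewrite mulrC ler_pdivrMr//.
have gMae : {ae mu, forall t, `|g t| <= M} by apply: aeW.
have := gi_bounded pg ig M0 gMae xe.
by rewrite addrAC subrr add0r.
Qed.

Lemma L2T_bounded f (K : R) : periodic f 1 -> measurable_fun [set: R] f ->
  (forall x, `|f x| <= K) -> L2T f.
Proof.
move=> pf mf fK; apply: L2T_intro => //.
apply: (@le_lt_trans _ _ (\int[muT]_x (cst (K ^+ 2)%:E x))%E).
  apply: ge0_le_integral => //.
  - by move=> x _; rewrite lee_fin sqr_ge0.
  - exact: measurable_sqr_EFin.
  - move=> x _; rewrite lee_fin -[leLHS]real_normK ?num_real// ler_sqr ?nnegrE//.
    exact: le_trans (fK x).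
by rewrite integral_cst// muT_setT mule1 ltry.
Qed.

Lemma steklov_L2 e : 0 < e -> L2T (steklov e).
Proof.
move=> e0; apply: (@L2T_bounded _ M).
- exact: steklov_periodic.
- exact: measurable_steklov.
- by move=> x; exact: steklov_bounded.
Qed.

(** The difference quotient of [g] has mean zero by translation invariance, and its primitive is the
    Steklov mean up to a constant. Being in L^2, it makes the Steklov mean an H^1 function. *)
Lemma steklov_weak_derivative e (h := fun x => e^-1 * (g (x + e) - g x)) : 0 < e ->
  [/\ L2T h, \int[muT]_x h x = 0 & weak_derivative (steklov e) h].
Proof.
move=> e0.
have mgs : measurable_fun [set: R] (fun x => g (x + e)).
  by apply: (measurableT_comp mg); exact: measurable_funD.
have Lgs : L2T (fun x => g (x + e)).
  by apply: (@L2T_bounded _ M) => // x; rewrite addrAC pg.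
have Lh : L2T h by have := L2TZ e^-1 (L2TB Lgs Lg).
have igs := L1T_integrable (L2T_L1T Lgs); have ih := L1T_integrable (L2T_L1T Lh).
have h0 : \int[muT]_x h x = 0.
  rewrite /h RintegralZl//; last by have := integrableB measurableT igs ig.
  rewrite (RintegralB measurableT igs ig) (_ : \int[muT]_x g (x + e) = \int[muT]_x g x) ?subrr ?mulr0//.
  rewrite /Rintegral (@integral_muT_shift R e (EFin \o g))//; last exact/measurable_EFinP.
  by move=> x /=; rewrite pg.
(* The constant is the value of the Steklov mean at 0. *)
split => //; apply: (@prim_weak_derivative R _ _ (e^-1 * (prim g e - prim g 0))).
- exact: steklov_periodic.
- exact: measurable_steklov.
- exact: L2T_L1T.
- exact: h0.
apply/ae_muT; apply: aeW => x /andP[x0 x1].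
rewrite (prim_unit _ x0).
have -> : gi h 0 x = e^-1 * (gi (fun t => g (t + e)) 0 x - gi g 0 x).
  have i1 := periodic_integrable Lgs.1 igs 0 x; have i2 := periodic_integrable pg ig 0 x.
  rewrite /gi /h RintegralZl//; last exact: (integrableB _ i1 i2).
  by rewrite RintegralB.
have -> : gi (fun t => g (t + e)) 0 x = gi g e (x + e).
  rewrite /gi /Rintegral; congr fine.
  rewrite [LHS]integral_mkcond [RHS]integral_mkcond -[RHS](integral_shift e).
    apply: eq_integral => t _; rewrite /patch !mem_setE !in_itv/=.
    by rewrite lerDr ltrD2r.
  have [+ _] := measurable_restrictT (EFin \o g) (measurable_itv `[e, (x + e)[).
  by apply; apply: measurable_funTS; exact/measurable_EFinP.
rewrite -!(prim_sub pg ig)//; last by rewrite lerDr.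
by rewrite /steklov; ring.
Qed.

(** Lebesgue differentiation for the extension of [g] by zero, whose primitive coincides with
    [prim g] on ]0, 1[. *)
Lemma prim_derivable_ae : {ae muT, forall x, derivable (prim g) x 1 /\ ((prim g)^`())%classic x = g x}.
Proof.
pose f := g \_ (`[0%R, 1%R[%classic : set R).
have if_ : mu.-integrable setT (EFin \o f).
  have [+ _] := @integrable_mkcond _ (measurableTypeR R) R mu _ (EFin \o g) (@measurable_unit R).
  by rewrite restrict_EFin; apply; exact/(integrable_muT mg).1.
have Hloc : locally_integrable [set: R] f by apply: open_integrable_locally => //; exact: openT.
have ify (y : R) : mu.-integrable `]-oo, y] (EFin \o f).
  by apply: integrableS if_ => //; exact: measurable_itv.
have F0 (y : R) : 0 < y < 1 -> \int[mu]_(t in `]-oo, y]) f t = prim g y.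
  move=> /andP[y0 y1].
  have iy : mu.-integrable `]-oo, y[ (EFin \o f).
    by apply: integrableS if_ => //; exact: measurable_itv.
  rewrite -Rintegral_itv_bndo_bndc// (prim_unit _ (ltW y0)) /gi.
  rewrite [LHS]Rintegral_mkcond [RHS]Rintegral_mkcond; apply: eq_Rintegral => x _.
  rewrite /patch !mem_setE /= /f /patch mem_setE !in_itv/=.
  case: (ltP x y) => xy; last by rewrite andbF.
  by rewrite (lt_trans xy y1) !andbT.
have HF := FTC1Ny ify Hloc.
apply/ae_muT; apply: ae_imp2 HF (ae_neq 0) => x [dF Fx] x0 /andP[h0 h1].
have x01 : 0 < x < 1 by rewrite lt_neqAle eq_sym x0 h0.
have fx : f x = g x by rewrite /f /patch mem_setE in_itv/= h0 h1.
have near_eq : {near x, (fun y => \int[mu]_(t in `]-oo, y]) f t) =1 prim g}.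
  near=> y; apply: F0.
  have : y \in `]0, 1[ by near: y; apply: near_in_itvoo; rewrite in_itv.
  by rewrite in_itv.
split; first exact: near_eq_derivable near_eq dF.
by rewrite -fx -Fx !derive1E; apply/esym; exact: near_eq_derive near_eq.
Unshelve. all: by end_near. Qed.

Lemma steklov_approx (d : R) : 0 < d -> exists2 e, 0 < e & l2 (g - steklov e) < d.
Proof.
move=> d0.
pose e (n : nat) : R := n.+1%:R^-1.
have e0 n : 0 < e n by rewrite invr_gt0.
have [||n x||n Hn] := @L2_dominated_vanish (fun n => g - steklov (e n)) (cst (2 * M)) _ _ _ _ d d0.
- by move=> n; apply: L2TB => //; exact: steklov_L2.
- by apply: (@L2T_bounded _ (2 * M)) => // x; rewrite ger0_norm// mulr_ge0.
- rewrite !fctE (ger0_norm (_ : 0 <= 2 * M)) ?mulr_ge0//.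
  apply: le_trans (ler_normB _ _) _; rewrite mulr_natl mulr2n; apply: lerD => //.
  exact: steklov_bounded.
- apply: ae_imp prim_derivable_ae => x [dx gx]; rewrite derive1E in gx.
  have q0 : (fun h : R => h^-1 *: ((prim g \o shift x) (h *: (1 : R)) - prim g x)) @ 0^'
      --> 'D_1 (prim g) x := dx.
  (* The derivative is a limit along punctured neighbourhoods of 0, so the steps must be nonzero as
     well as tend to 0. *)
  have ce : (fun n => e n) @ \oo --> (0 : R)^'.
    move=> P HP; have H2 : \forall n \near \oo, e n != 0 -> P (e n) := @cvg_harmonic R _ HP.
    change (\forall n \near \oo, P (e n)).
    apply: filterS H2 => n /= Hn; apply: Hn.
    exact: (lt0r_neq0 (e0 n)).
  have qe := cvg_comp _ _ ce q0.
  suff : g x - steklov (e n) x @[n --> \oo] --> g x - 'D_1 (prim g) x by rewrite gx subrr.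
  apply: cvgB; first exact: cvg_cst.
  rewrite (_ : (fun n => steklov (e n) x) =
    (fun n => (e n)^-1 *: ((prim g \o shift x) (e n *: (1 : R)) - prim g x)))//.
  by apply/funext => n; rewrite /steklov /= [x + _]addrC [_ *: 1]mulr1.
by exists (e n).
Qed.

End steklov.
End core_approximation.

Section core.
Context {R : realType}.
Local Notation mu := (@lebesgue_measure R).
Implicit Types u g h f k b : R -> R.

Lemma L2T_cst (c : R) : L2T (cst c : R -> R).
Proof. by apply: (@L2T_bounded _ _ `|c|). Qed.

Lemma l2_cst (c : R) : l2 (cst c : R -> R) = `|c|.
Proof.
apply/eqP; rewrite -(@eqrXn2 _ 2) ?l2_ge0//; apply/eqP; apply: EFin_inj.
rewrite l2_sqr; last exact: L2T_cst.
rewrite real_normK ?num_real//.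
transitivity (\int[muT]_x (cst (c ^+ 2)%:E x : \bar R))%E; first by [].
by rewrite integral_cst// muT_setT mule1.
Qed.

(** Truncation and Steklov mean cost d/4 each. As [g] has mean zero, the mean of [s] is that of
    [s - g], at most its L^2 norm on a space of mass 1, so removing it costs less than the remaining
    d/2. *)
Lemma mean0_H1T_approx g (d : R) : L2T g -> \int[muT]_x g x = 0 -> 0 < d ->
  exists k k', [/\ L2T k, L2T k', weak_derivative k k', \int[muT]_x k x = 0 & l2 (g - k) < d].
Proof.
move=> Lg g0 d0.
have d4 : 0 < d / 4 by rewrite divr_gt0.
have [g1 [Lg1 [M M0 gM]] Hg1] := truncation_approx Lg d4.
have [e e0 He] := steklov_approx Lg1 M0 gM d4.
have [Lh h0 wk] := steklov_weak_derivative Lg1 gM e0.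
have Lk := steklov_L2 Lg1 M0 gM e0.
set s := steklov g1 e in Lk wk He; set h := (fun x => _) in Lh h0 wk.
pose m := \int[muT]_x s x.
have gs : l2 (g - s) < d / 2.
  have -> : g - s = (g - g1) + (g1 - s) by apply/funext => x; rewrite !fctE; ring.
  apply: le_lt_trans (l2D (L2TB Lg Lg1) (L2TB Lg1 Lk)) _; lra.
have is_ := L1T_integrable (L2T_L1T Lk); have ig := L1T_integrable (L2T_L1T Lg).
have ic := L1T_integrable (L2T_L1T (L2T_cst m)).
have mE : `|m| < d / 2.
  apply: le_lt_trans gs; rewrite -normrN.
  have -> : - m = \int[muT]_x (g x - s x) by rewrite (RintegralB measurableT ig is_) g0 sub0r.
  apply: le_trans (le_normr_Rintegral measurableT (integrableB measurableT ig is_)) _.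
  exact: (L1_le_l2 (L2TB Lg Lk)).
exists (s - cst m), h; split => //.
- exact: L2TB Lk (L2T_cst m).
- have [c Hc] := weak_derivative_prim wk.
  apply: (@prim_weak_derivative R _ _ (c - m)) => //.
  + exact: (L2TB Lk (L2T_cst m)).1.
  + exact: L2T_measurable (L2TB Lk (L2T_cst m)).
  + exact: L2T_L1T.
  + apply/ae_muT; apply: ae_imp Hc => x sx _; rewrite !fctE sx; ring.
- rewrite (RintegralB measurableT is_ ic) Rintegral_cst// muT_setT mulr1 subrr//.
have -> : g - (s - cst m) = (g - s) + cst m by apply/funext => x; rewrite !fctE; ring.
apply: le_lt_trans (l2D (L2TB Lg Lk) (L2T_cst m)) _; rewrite l2_cst; lra.
Qed.

Lemma primB_abs g k : L2T g -> L2T k -> forall x, 0 <= x < 1 ->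
  `|prim g x - prim k x| <= l2 (g - k).
Proof.
move=> Lg Lk x x01; have Lgk := L2TB Lg Lk.
have ig := L1T_integrable (L2T_L1T Lg); have ik := L1T_integrable (L2T_L1T Lk).
have igk := L1T_integrable (L2T_L1T Lgk).
have -> : prim g x - prim k x = prim (g - k) x.
  have /andP[x0 _] := x01; rewrite !(prim_unit _ x0) /gi.
  have i1 := periodic_integrable Lg.1 ig 0 x; have i2 := periodic_integrable Lk.1 ik 0 x.
  by rewrite -(RintegralB _ i1 i2).
apply: le_trans (prim_abs Lgk.1 igk x01) _.
exact: L1_le_l2.
Qed.

(** With [k] close to u' and f = c + prim k, both u - f and its derivative are bounded in L^2 by
    [l2 (g - k)]; the graph norm is then at most (1 + beta) times it, whence the choice of [d]. *)
Lemma H2T_core b (beta : R) : (forall x, b (x + 1) = b x) -> measurable_fun [set: R] b ->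
  0 <= beta -> {ae muT, forall x, `|b x| <= beta} -> core (A_op b) (@H2T R).
Proof.
move=> pb mb beta0 bbeta; split; first exact: H2T_linear.
split; first by move=> u [].
move=> u Hu e e0; have [Lu Lg wu] := H1T_wderiv Hu.
set g := wderiv u in Lg wu.
have B0 : 0 < 1 + beta by rewrite ltr_pwDl.
have d0 : 0 < e / (1 + beta) by rewrite divr_gt0.
set d := e / (1 + beta) in d0.
have [k [k' [Lk Lk' wk k0 gk]]] := mean0_H1T_approx Lg (weak_derivative_mean0 wu) d0.
have [c uE] := weak_derivative_prim wu.
have ik := L1T_integrable (L2T_L1T Lk).
pose f x := c + prim k x.
have pf : periodic f 1 by move=> x; rewrite /f (prim_periodic Lk.1 ik k0).
have mf : measurable_fun [set: R] f by apply: measurable_funD => //; exact: measurable_prim.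
have wf : weak_derivative f k.
  apply: (@prim_weak_derivative R _ _ c) => //; first exact: L2T_L1T.
  exact: aeW.
have ufE : {ae muT, forall x, 0 <= x < 1 -> `|u x - f x| <= l2 (g - k)}.
  apply/ae_muT; apply: ae_imp uE => x -> _ x01.
  by rewrite /f opprD addrACA subrr add0r; exact: primB_abs.
have Lf : L2T f.
  apply: (@L2T_bounded _ _ (`|c| + l2 k)) => // x.
  rewrite /f; apply: le_trans (ler_normD _ _) _; rewrite lerD2l.
  have [n /andP[n1 n2]] := unit_itv_cover x.
  rewrite -(periodic_int (- n) x (prim_periodic Lk.1 ik k0)).
  apply: le_trans (prim_abs Lk.1 ik _) _; last exact: L1_le_l2.
  by rewrite intrN; apply/andP; split; lra.
have Hf : H2T f := H2T_intro Lf Lk Lk' wf wk.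
exists f => //.
have Luf := L2TB Lu Lf.
have luf : l2 (u - f) <= l2 (g - k).
  apply: l2_le => //; first exact: l2_ge0.
  apply: (@le_trans _ _ (\int[muT]_x (cst (l2 (g - k) ^+ 2)%:E x : \bar R))%E); last first.
    by rewrite integral_cst// muT_setT mule1.
  apply: ae_ge0_le_integral => //.
  - by move=> x _; rewrite lee_fin sqr_ge0.
  - exact: measurable_sqr_EFin (L2T_measurable Luf).
  - by move=> x _; rewrite lee_fin sqr_ge0.
  have uf' : {ae muT, forall x, `|u x - f x| <= l2 (g - k)}.
    apply/ae_muT; move/ae_muT: ufE; apply: ae_imp => x h x01; exact: h.
  apply: ae_imp uf' => x uf _.
  by rewrite lee_fin -[leLHS]real_normK ?num_real// ler_sqr ?nnegrE ?l2_ge0.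
have wuf : {ae muT, forall x, wderiv (u - f) x = (g - k) x}.
  have := weak_derivative_lin (-1) wf wu.
  rewrite (_ : -1 *: f + u = u - f); last by rewrite scaleN1r addrC.
  rewrite (_ : -1 *: k + g = g - k); last by rewrite scaleN1r addrC.
  exact: wderiv_ae.
have Huf : H1T (u - f).
  have := H1T_lin (-1) Hf.1 Hu.
  by rewrite (_ : -1 *: f + u = u - f)//; rewrite scaleN1r addrC.
have [_ Lw _] := H1T_wderiv Huf.
have lw : l2 (wderiv (u - f)) = l2 (g - k).
  by apply: l2_ae_eq Lw (L2TB Lg Lk) _; apply: ae_imp wuf.
have [|||LA lA] := @L2T_bounded_mul R beta (fun x => - b x) (wderiv (u - f)) _ _ beta0 _ Lw.
- by move=> x; rewrite pb.
- exact: measurableT_comp.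
- by apply: ae_imp bbeta => x; rewrite normrN.
rewrite /graph_norm (L2norm_fin Luf) (L2norm_fin LA) -EFinD lte_fin.
apply: (@le_lt_trans _ _ ((1 + beta) * l2 (g - k))).
  by rewrite mulrDl mul1r; apply: lerD => //; apply: le_trans lA _; rewrite lw.
by rewrite mulrC -ltr_pdivlMr.
Qed.

End core.

Theorem lemma6p1 (R : realType) (b eta : R -> R)
  (hb : W1inftyT b)
  (eta_L1 : lebesgue_measure.-integrable [set: R] (EFin \o eta))
  (eta_odd : {ae lebesgue_measure, forall z : R, eta (- z) = - eta z})
  (eta_mean : \int[lebesgue_measure]_z eta z = 0)
  (eta_moment : \int[lebesgue_measure]_z (z * eta z) = -1)
  (C_eta_fin : ((2^-1)%:E * \int[lebesgue_measure]_z
                  (`|z| ^+ 2 * `|eta z|)%:E < +oo)%E) :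
  let M : R := 1 in
  let omega : R := 2^-1 * fine (LpTnorm +oo%E (wderiv b))
                   * \int[lebesgue_measure]_z (`|z| * `|eta z|) in
  exists (D0 : set (R -> R)) (r : R -> R),
    [/\ linear_subspace D0,
        dense_for H2norm D0 H2T,
        core (A_op b) D0,
        r =O_ (0^'+) (fun eps : R => eps) &
        (forall eps : R, 0 < eps ->
          exists2 S : R -> (R -> R) -> R -> R,
            generates (A_eps b eta eps) S &
            forall t : R, 0 <= t ->
              (opnorm (S t) <= (M * expR (omega * t))%:E)%E)
        /\
        (forall eps : R, 0 < eps -> forall phi, D0 phi ->
          (L2norm (A_eps b eta eps phi - A_op b phi)%R
            <= (r eps)%:E * H2norm phi)%E)].
Proof.
move=> M omega.
have [wb Lwb] := W1infty_wderiv hb.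
have [b0 [bb0 b0_lip]] := W1infty_lipschitz hb.
have pb : forall x, b (x + 1) = b x := hb.1.1.
have mb : measurable_fun [set: R] b := LpT_measurable hb.1.
pose L := fine (LpTnorm +oo%E (wderiv b)).
have L0 : 0 <= L by apply: fine_ge0; exact: Lnorm_ge0.
pose beta := fine (LpTnorm +oo%E b).
have beta0 : 0 <= beta by apply: fine_ge0; exact: Lnorm_ge0.
have bbeta : {ae muT, forall x, `|b x| <= beta}.
  by apply/ae_muT; apply: ae_imp (ess_bound hb.1).
(* In r, beta bounds b, 2 times the second moment is the mass of the Taylor kernel, and eps comes
   from rescaling that moment. *)
exists (@H2T R), (fun eps => eps * (2 * beta * abs_moment eta 2)).
split.
- exact: H2T_linear.
- exact: H2T_dense.
- exact: H2T_core beta0 bbeta.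
(* The added 1 keeps the constant positive, as the criterion demands, even when [beta] is 0. *)
- apply/eqO_exP; exists (2 * beta * abs_moment eta 2 + 1).
    by rewrite ltr_pwDr// !mulr_ge0// abs_moment_ge0.
  apply: nearW => eps; rewrite normrM mulrC; apply: ler_wpM2r => //.
  by rewrite ger0_norm ?lerDl// !mulr_ge0// abs_moment_ge0.
split=> eps e0.
- pose h := rescaled eta eps.
  have mh := measurable_rescaled eps eta_L1 : measurable_fun [set: R] h.
  have hW := rescaled_L1 e0 eta_L1 C_eta_fin.
  have hM1 := rescaled_M1 e0 eta_L1 C_eta_fin.
  have hodd := rescaled_odd e0 eta_odd.
  have W0 : 0 <= eps^-1 * abs_moment eta 0.
    by rewrite mulr_ge0 ?invr_ge0 ?(ltW e0)// abs_moment_ge0.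
  have K0 : 0 <= beta * (eps^-1 * abs_moment eta 0) by exact: mulr_ge0.
  have BL u (Lu : L2T (u : R -> R)) := (transport_op_L2 pb mb beta0 bbeta mh hW Lu).1.
  have BK u (Lu : L2T (u : R -> R)) := (transport_op_L2 pb mb beta0 bbeta mh hW Lu).2.
  have Blin := transport_op_lin b mh hW.
  (* [transport_op b h] is the action of [A_eps b eta eps] by unfolding, and its domain is all of
     [L2T], as for the generator. *)
  exists (Sexp (transport_op b h)).
    split; first exact: (Sexp_C0 K0 BL Blin BK).
    by move=> u v; exact: (Sexp_generator K0 BL BK).
  move=> t t0; rewrite mul1r.
  apply: (opnorm_Sexp K0 BL Blin BK) => //.
    by rewrite !mulr_ge0// Rintegral_ge0// => z _; exact: mulr_ge0.
  (* Since the first absolute moment is the same for [h] and for eta, omega is the rate of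
     [transport_dissip] whatever the value of eps. *)
  move=> u s Lu s0; rewrite /omega -abs_moment1 -/L.
  exact: (transport_dissip pb mb beta0 bbeta L0 b0_lip bb0 mh hW hodd hM1 Lu s0).
move=> phi Hphi.
have [Lphi _ _ _ _] := H2T_wderiv Hphi.
have mh := measurable_rescaled eps eta_L1.
have hW := rescaled_L1 e0 eta_L1 C_eta_fin.
have hM1 := rescaled_M1 e0 eta_L1 C_eta_fin.
have hM2 := rescaled_M2 e0 eta_L1 C_eta_fin.
have h_mean := rescaled_mean e0 eta_L1 eta_mean C_eta_fin.
have h_mom := rescaled_first_moment e0 eta_L1 eta_moment C_eta_fin.
have [Lf lf] := convT_sub_wderiv mh hW hM1 hM2 h_mean h_mom Hphi.
have [|||LA lA] := @L2T_bounded_mul R beta (fun x => - b x) _ _ _ beta0 _ Lf.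
- by move=> x; rewrite pb.
- exact: measurableT_comp.
- by apply: ae_imp bbeta => x; rewrite normrN.
have E : A_eps b eta eps phi - A_op b phi =
    (fun x => - b x * (convT (rescaled eta eps) phi x - wderiv phi x)).
  by apply/funext => x; rewrite !fctE mulrBr.
rewrite E (L2norm_fin LA).
apply: (@le_trans _ _ ((eps * (2 * beta * abs_moment eta 2)) * l2 (wderiv (wderiv phi)))%:E).
  rewrite lee_fin; apply: le_trans lA _.
  apply: le_trans (ler_wpM2l beta0 lf) _.
  by rewrite le_eqVlt; apply/orP; left; apply/eqP; ring.
rewrite EFinM; apply: lee_wpmul2l; last exact: l2_le_H2norm.
by rewrite lee_fin !mulr_ge0// ?(ltW e0)// abs_moment_ge0.
Qed.
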